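(* Let $a>0$. Then $L_a^{\infty}(\ell^2)$ is a Hilbert $C^*$-module over $L^{\infty}[0,a]$ with the pointwise operations, the action of $L^{\infty}[0,a]$ given by $(h,f)\mapsto h^af$, and the inner product $$\langle f,g\rangle_{L_a^{\infty}(\ell^2)}(x)=\sum_{n\in\mathbb Z}f(x-na)\overline{g(x-na)},$$ and it contains $X_a(L^{\infty},\ell^2)$ as a closed Hilbert $L^{\infty}[0,a]$-submodule. The map $$U_a:L_a^{\infty}(\ell^2)\to\ell^2_{\mathbb Z,\mathrm{strong}}(L^{\infty}[0,a]),\qquad U_af=\big((T_{-na}f)\chi_{[0,a]}\big)_n,$$ is a unitary operator of Hilbert $L^{\infty}[0,a]$-modules whose adjoint is given by $U_a^*((f_n)_n)=f$, where $f$ is defined by $f|_{[na,(n+1)a]}=T_{na}f_n$ for all $n\in\mathbb Z$. Moreover, $$U_a|_{X_a(L^{\infty},\ell^2)}:X_a(L^{\infty},\ell^2)\to\ell^2_{\mathbb Z}(L^{\infty}[0,a])$$ is also a unitary operator of Hilbert $C^*$-modules. In particular, $L_a^{\infty}(\ell^2)$ is self-dual. Finally, $L_a^{\infty}(\ell^2)$ is naturally (anti-linearly) isomorphic to the dual $X_a(L^{\infty},\ell^2)'$ of $X_a(L^{\infty},\ell^2)$.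
   Context: Functions are identified when equal almost everywhere. $T_c f(x)=f(x-c)$. For $h\in L^\infty[0,a]$, $h^a$ is its $a$-periodic extension to $\mathbb R$. $L^\infty[0,a]$ is a commutative von Neumann algebra acting by multiplication on $L^2[0,a]$; ''(strong)'' refers to the corresponding strong operator topology. $L_a^{\infty}(\ell^2)=\{f:\mathbb R\to\mathbb C\text{ measurable}: \|f\|^2_{L_a^{\infty}(\ell^2)}=\operatorname{ess\,sup}_{x\in[0,a]}\sum_{n\in\mathbb Z}|f(x-na)|^2<\infty\}$. $X_a(L^{\infty},\ell^2)=\{f:\mathbb R\to\mathbb C\text{ measurable}: \sum_{n\in\mathbb Z}|(T_{-na}f)\chi_{[0,a]}|^2\text{ converges in norm in }L^\infty[0,a]\}$. For a von Neumann algebra $A$: $\ell^2_{\mathbb Z}(A)=\{(a_n)_{n\in\mathbb Z}:\sum_n a_na_n^*\text{ converges in norm}\}$ and $\ell^2_{\mathbb Z,\mathrm{strong}}(A)=\{(a_n)_{n\in\mathbb Z}:\sup_N\|\sum_{n=-N}^Na_na_n^*\|<\infty\}$, left Hilbert $A$-modules with inner products $\sum_n a_nb_n^*$ converging in norm, respectively strongly. For a left Hilbert $A$-module $X$, $X'$ is the space of bounded $A$-linear maps $X\to A$; $X$ is self-dual if each $L\in X'$ has the form $L(y)=\langle y,x\rangle$ for some $x\in X$. The natural anti-linear map $L_a^{\infty}(\ell^2)\to X_a(L^{\infty},\ell^2)'$ is $g\mapsto\langle\cdot,g\rangle_{L_a^{\infty}(\ell^2)}|_{X_a(L^\infty,\ell^2)}$.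 A unitary operator of Hilbert modules over the same algebra is a surjective module map preserving the inner products. *)

(* Defs.v *)
From HB Require Import structures.
From mathcomp Require Import all_boot all_order all_algebra.
From mathcomp Require Import finmap complex.
From mathcomp Require Import all_classical all_reals all_analysis.
From mathcomp Require Import ess_sup_inf.
From mathcomp Require summability.

Set Implicit Arguments.
Unset Strict Implicit.
Unset Printing Implicit Defensive.

Import Order.TTheory GRing.Theory Num.Theory.
Import numFieldNormedType.Exports.

Local Open Scope classical_set_scope.
Local Open Scope ring_scope.
Local Open Scope complex_scope.

(* Spaces of functions "identified when equal almost everywhere" are setoids:
   an ambient vector space [car], the set [dom] of the functions belonging to
   the space and the relation [eqv] under which they are identified. All maps
   below are total on the ambient type and only constrained on [dom]. *)

Section Abstract.
Variable R : realType.
Local Notation C := R[i].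

(* The operations of an algebra of operators on a Hilbert space, whose vectors
   are [hdom] with norm [hnorm]; [aapp h xi] is the operator h applied to xi.
   The record carries no axioms: it is only used for [Linf] below. *)
Record opalg := OpAlg {
  acar : lmodType C;
  adom : set acar;
  aeqv : acar -> acar -> Prop;
  amul : acar -> acar -> acar;
  aone : acar;
  astar : acar -> acar;
  anorm : acar -> R;
  hcar : Type;
  hdom : set hcar;
  hnorm : hcar -> R;
  aapp : acar -> hcar -> hcar }.

(* Likewise only operations; the axioms are in [hilbert_module]. *)
Record premodule (A : opalg) := PreModule {
  mcar : lmodType C;
  mdom : set mcar;
  meqv : mcar -> mcar -> Prop;
  mact : acar A -> mcar -> mcar;
  mip : mcar -> mcar -> acar A }.

Section Modules.
Variable A : opalg.

Definition mnorm (E : premodule A) (x : mcar E) : R :=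
  Num.sqrt (anorm (mip x x)).

Definition apositive (x : acar A) : Prop :=
  exists2 b, adom b & aeqv x (amul b (astar b)).

Definition msetoid (E : premodule A) : Prop :=
  [/\ forall x, mdom x -> @meqv A E x x,
      forall x y, mdom x -> mdom y -> @meqv A E x y -> meqv y x &
      forall x y z, mdom x -> mdom y -> mdom z ->
        @meqv A E x y -> meqv y z -> meqv x z].

Definition mclosed (E : premodule A) (S : set (mcar E)) : Prop :=
  [/\ S 0,
      forall x y, S x -> S y -> S (x + y),
      forall (c : C) x, S x -> S (c *: x) &
      forall h x, adom h -> S x -> S (mact h x)].

Definition mcompat (E : premodule A) : Prop :=
  [/\ forall x x' y y' : mcar E, mdom x -> mdom x' -> mdom y -> mdom y' ->
        meqv x x' -> meqv y y' -> meqv (x + y) (x' + y'),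
      forall (c : C) (x x' : mcar E), mdom x -> mdom x' ->
        meqv x x' -> meqv (c *: x) (c *: x'),
      forall h h' (x x' : mcar E), adom h -> adom h' -> mdom x -> mdom x' ->
        aeqv h h' -> meqv x x' -> meqv (mact h x) (mact h' x') &
      forall x x' y y' : mcar E, mdom x -> mdom x' -> mdom y -> mdom y' ->
        meqv x x' -> meqv y y' -> aeqv (mip x y) (mip x' y')].

Definition maction (E : premodule A) : Prop :=
  (forall h (x y : mcar E), adom h -> mdom x -> mdom y ->
     meqv (mact h (x + y)) (mact h x + mact h y)) /\
  (forall h k (x : mcar E), adom h -> adom k -> mdom x ->
     meqv (mact (h + k) x) (mact h x + mact k x)) /\
  (forall h k (x : mcar E), adom h -> adom k -> mdom x ->
     meqv (mact (amul h k) x) (mact h (mact k x))) /\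
  (forall x : mcar E, mdom x -> meqv (mact (aone A) x) x) /\
  (forall (c : C) h (x : mcar E), adom h -> mdom x ->
     meqv (mact (c *: h) x) (c *: mact h x)) /\
  (forall (c : C) h (x : mcar E), adom h -> mdom x ->
     meqv (mact h (c *: x)) (c *: mact h x)).

Definition minner (E : premodule A) : Prop :=
  (forall x y : mcar E, mdom x -> mdom y -> adom (mip x y)) /\
  (forall x y z : mcar E, mdom x -> mdom y -> mdom z ->
     aeqv (mip (x + y) z) (mip x z + mip y z)) /\
  (forall (c : C) (x y : mcar E), mdom x -> mdom y ->
     aeqv (mip (c *: x) y) (c *: mip x y)) /\
  (forall h (x y : mcar E), adom h -> mdom x -> mdom y ->
     aeqv (mip (mact h x) y) (amul h (mip x y))) /\
  (forall x y : mcar E, mdom x -> mdom y ->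
     aeqv (mip y x) (astar (mip x y))) /\
  (forall x : mcar E, mdom x -> apositive (mip x x)) /\
  (forall x : mcar E, mdom x -> aeqv (mip x x) 0 -> meqv x 0).

Definition mcvg (E : premodule A) (u : nat -> mcar E) (x : mcar E) : Prop :=
  (fun n => mnorm (u n - x)) @ \oo --> (0 : R).

Definition mcauchy (E : premodule A) (u : nat -> mcar E) : Prop :=
  forall e : R, 0 < e -> exists N : nat,
    forall m n, (N <= m)%N -> (N <= n)%N -> mnorm (u m - u n) < e.

Definition mcomplete (E : premodule A) : Prop :=
  forall u : nat -> mcar E, (forall n, mdom (u n)) -> mcauchy u ->
    exists2 x, mdom x & mcvg u x.

(* Left Hilbert C*-module over A: the inner product is A-linear in its first
   variable. *)
Definition hilbert_module (E : premodule A) : Prop :=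
  msetoid E /\ mclosed (@mdom A E) /\ mcompat E /\ maction E /\ minner E /\
  mcomplete E.

Definition restrict (E : premodule A) (S : set (mcar E)) : premodule A :=
  @PreModule A (mcar E) S (@meqv A E) (@mact A E) (@mip A E).

Definition closed_submodule (E : premodule A) (S : set (mcar E)) : Prop :=
  [/\ S `<=` @mdom A E, mclosed S &
      forall (u : nat -> mcar E) x, (forall n, S (u n)) -> mdom x ->
        mcvg u x -> S x].

Definition module_map (E F : premodule A) (T : mcar E -> mcar F) : Prop :=
  (forall x, mdom x -> mdom (T x)) /\
  (forall x y, mdom x -> mdom y -> meqv x y -> meqv (T x) (T y)) /\
  (forall x y, mdom x -> mdom y -> meqv (T (x + y)) (T x + T y)) /\
  (forall (c : C) x, mdom x -> meqv (T (c *: x)) (c *: T x)) /\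
  (forall h x, adom h -> mdom x -> meqv (T (mact h x)) (mact h (T x))).

Definition unitary (E F : premodule A) (T : mcar E -> mcar F) : Prop :=
  [/\ hilbert_module E, hilbert_module F, module_map T,
      forall x y, mdom x -> mdom y -> aeqv (mip (T x) (T y)) (mip x y) &
      forall y, mdom y -> exists2 x, mdom x & meqv (T x) y].

Definition adjoint (E F : premodule A) (T : mcar E -> mcar F)
    (T' : mcar F -> mcar E) : Prop :=
  (forall y, mdom y -> mdom (T' y)) /\
  (forall x y, mdom x -> mdom y -> aeqv (mip (T x) y) (mip x (T' y))).

Definition alg_module : premodule A :=
  @PreModule A (acar A) (@adom A) (@aeqv A) (@amul A)
    (fun x y => amul x (astar y)).

(* Membership of L in X', the space of bounded A-linear maps X -> A. *)
Definition in_dual (X : premodule A) (L : mcar X -> acar A) : Prop :=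
  @module_map X alg_module L /\
  exists M : R, forall x, mdom x -> anorm (L x) <= M * mnorm x.

Definition dual_eqv (X : premodule A) (L L' : mcar X -> acar A) : Prop :=
  forall x, mdom x -> aeqv (L x) (L' x).

Definition dual_norm (X : premodule A) (L : mcar X -> acar A) : R :=
  sup [set anorm (L x) | x in [set x | mdom x /\ mnorm x <= 1]].

Definition self_dual (X : premodule A) : Prop :=
  forall L : mcar X -> acar A, in_dual L ->
    exists2 x, mdom x & forall y, mdom y -> aeqv (L y) (mip y x).

(* P : E -> X' is an isometric anti-linear isomorphism; the action on X' is
   (L h)(x) = L(x) h, which P intertwines with g |-> h^* g. *)
Definition antilinear_iso_dual (E X : premodule A)
    (P : mcar E -> mcar X -> acar A) : Prop :=
  (forall g, mdom g -> in_dual (P g)) /\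
  (forall g k, mdom g -> mdom k -> dual_eqv (P (g + k)) (P g + P k)) /\
  (forall (c : C) g, mdom g -> dual_eqv (P (c *: g)) (c^* *: P g)) /\
  (forall h g, adom h -> mdom g ->
     dual_eqv (P (mact h g)) (fun x => amul (P g x) (astar h))) /\
  (forall g k, mdom g -> mdom k -> (meqv g k <-> dual_eqv (P g) (P k))) /\
  (forall L, in_dual L -> exists2 g, mdom g & dual_eqv (P g) L) /\
  (forall g, mdom g -> dual_norm (P g) = mnorm g).

End Modules.

Section Ell2.
Variable A : opalg.

(* sum_(n in Z) u n = s in norm, resp. strongly, as an unordered sum: the limit
   is taken along the directed set of finite subsets of Z. *)
Definition norm_sum (u : int -> acar A) (s : acar A) : Prop :=
  [/\ forall n, adom (u n), adom s &
      (fun F => anorm (summability.partial_sum u F - s))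
        @ summability.totally --> (0 : R)].

Definition strong_sum (u : int -> acar A) (s : acar A) : Prop :=
  [/\ forall n, adom (u n), adom s &
      forall xi, hdom xi ->
        (fun F => hnorm (aapp (summability.partial_sum u F - s) xi))
          @ summability.totally --> (0 : R)].

Definition gram (a b : int -> acar A) : int -> acar A :=
  fun n => amul (a n) (astar (b n)).

Definition ell2_dom : set (int -> acar A) :=
  [set a | (forall n, adom (a n)) /\ exists s, norm_sum (gram a a) s].

Definition ell2s_dom : set (int -> acar A) :=
  [set a | (forall n, adom (a n)) /\
     exists M : R, forall N : nat,
       anorm (\sum_(k < N.*2.+1) gram a a (k%:Z - N%:Z)) <= M].

(* The inner products are chosen by [xget] among the (equivalent) sums. *)
Definition ell2 : premodule A :=
  @PreModule A (int -> acar A) ell2_dom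
    (fun a b => forall n, aeqv (a n) (b n))
    (fun h a n => amul h (a n))
    (fun a b => xget 0 (norm_sum (gram a b))).

Definition ell2s : premodule A :=
  @PreModule A (int -> acar A) ell2s_dom
    (fun a b => forall n, aeqv (a n) (b n))
    (fun h a n => amul h (a n))
    (fun a b => xget 0 (strong_sum (gram a b))).

End Ell2.
End Abstract.

Section Concrete.
Variable R : realType.
Local Notation C := R[i].
Local Notation mu := (@lebesgue_measure R).

Local Notation cmod := (@Normc.normc R).

(* Borel measurability; up to equality almost everywhere this gives the same
   functions as Lebesgue measurability. *)
Definition cmeasurable (D : set R) (f : R -> C) : Prop :=
  measurable_fun D (fun x => complex.Re (f x)) /\ measurable_fun D (fun x => complex.Im (f x)).

Definition esssup (a : R) (f : R -> \bar R) : \bar R :=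
  ess_sup (mrestr mu (measurable_itv `[0, a])) f.

(* Unordered sum over Z; it is the usual sum when u is [csummable]. *)
Definition csum (u : int -> C) : C :=
  (summability.sum (fun n => complex.Re (u n) : R^o)) +i*
  (summability.sum (fun n => complex.Im (u n) : R^o)).

Definition csummable (u : int -> C) : Prop :=
  summable [set: int] (fun n => (cmod (u n))%:E).

Definition L2norm2 (a : R) (xi : R -> C) : \bar R :=
  \int[mu]_(x in `[0, a]) ((cmod (xi x)) ^+ 2)%:E.

(* L^oo[0,a] acting on L^2[0,a] by multiplication. A function on [0,a] is
   represented by any function on R, its values outside [0,a] being ignored. *)
Definition Linf (a : R) : opalg R :=
  @OpAlg R (R -> C^o)
    [set h | cmeasurable `[0, a] h /\
             (esssup a (fun x => (cmod (h x))%:E) < +oo)%E]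
    (fun h k => h = k %[ae mu in `[0, a]%classic])
    (fun h k x => h x * k x)
    (fun=> 1)
    (fun h x => (h x)^*)
    (fun h => fine (esssup a (fun x => (cmod (h x))%:E)))
    (R -> C)
    [set xi | cmeasurable `[0, a] xi /\ (L2norm2 a xi < +oo)%E]
    (fun xi => Num.sqrt (fine (L2norm2 a xi)))
    (fun h xi x => h x * xi x).

Definition translate (c : R) (f : R -> C) : R -> C := fun x => f (x - c).

Definition perext (a : R) (h : R -> C) : R -> C :=
  fun x => h (x - (Num.floor (x / a))%:~R * a).

Definition La_norm2 (a : R) (f : R -> C) : \bar R :=
  esssup a (fun x =>
    \esum_(n in [set: int]) ((cmod (f (x - n%:~R * a))) ^+ 2)%:E).

Definition La_terms (a : R) (f g : R -> C) (x : R) : int -> C :=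
  fun n => f (x - n%:~R * a) * (g (x - n%:~R * a))^*.

Definition La (a : R) : premodule (Linf a) :=
  @PreModule R (Linf a) (R -> C^o)
    [set f | cmeasurable setT f /\ (La_norm2 a f < +oo)%E]
    (fun f g => f = g %[ae mu])
    (fun h f x => perext a h x * f x)
    (fun f g x => csum (La_terms a f g x)).

Definition piece (a : R) (f : R -> C) (n : int) : R -> C :=
  fun x => translate (- (n%:~R * a)) f x * (\1_`[0, a] x)%:C.

Definition Xa (a : R) : set (mcar (La a)) :=
  [set f | cmeasurable setT f /\
     exists s, @norm_sum R (Linf a)
       (fun n x => ((cmod (piece a f n x)) ^+ 2)%:C) s].

Definition XaM (a : R) : premodule (Linf a) := restrict (@Xa a).

Definition Ua (a : R) (f : mcar (La a)) : mcar (ell2s (Linf a)) := piece a f.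

Definition Uadj (a : R) (b : mcar (ell2s (Linf a))) : mcar (La a) :=
  fun x => let n := Num.floor (x / a) in translate (n%:~R * a) (b n) x.

End Concrete.

(* Main.v *)
(** On the fibre [x - n a], [n] in Z, of a point [x] of [0,a[, an element of
    [La a] is a square-summable sequence, and the inner product, the norm and
    the action of [L^oo[0,a]] are those of [l^2(Z)] computed fibrewise, almost
    everywhere. Completeness is thus Fatou's lemma on fibres; the elements of
    [Xa a] are those whose fibrewise tails are uniformly small.
    [Uadj] is exactly linear, and the sequence modules inherit their structure
    through it. For the strong sums, dominated convergence applies because the
    fibrewise Cauchy-Schwarz inequality bounds the remainders.
    A bounded module map [L] on [Xa a] or [La a] is represented by the [g] whose
    fibre coordinates are the conjugates of the values of [L] on the unit
    pieces. Testing [L] on truncations of [g] bounds [g]; multiplying by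
    indicator functions turns the norm bound on [L] into a bound almost
    everywhere, so that [L] sends pointwise vanishing tails to pointwise
    vanishing functions, and [L y = <y, g>] follows from its finite case. *)
Require Import Defs.
From mathcomp Require Import all_boot all_order all_algebra finmap.
From mathcomp Require Import complex.
From mathcomp Require Import all_classical all_reals all_analysis.
From mathcomp Require Import ess_sup_inf measurable_realfun zify ring lra.
From mathcomp Require summability.
Import Order.TTheory GRing.Theory Num.Theory.
Import numFieldNormedType.Exports.
Local Open Scope classical_set_scope.
Local Open Scope ring_scope.
Set Implicit Arguments.
Unset Strict Implicit.
Unset Printing Implicit Defensive.

(** * The complex modulus *)

(** Two constraints shape the proof. Identities hold only almost everywhere, so a statement
    quantified over tolerances, pairs of indices or finite sets of integers is reduced to countably
    many instances before the exceptional null sets are united: tolerances become [n.+1%:R^-1], and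
    finite sets are replaced by the symmetric boxes, which are cofinal among them. Moreover the
    unordered sums, [fine] and [xget] are total and return default values, so that summability or
    finiteness has to be established before a sum is manipulated, and measurability of a sum has to
    take the default value into account. Two conventions also have to be reconciled. The inner
    product of [La a] reads [f] at [x - n a], whereas [Ua] reads it at [x + n a], hence the
    reversals of indices from [n] to [- n]. The intervals of the definitions are closed, whereas
    [Num.floor] cuts the line into half-open ones; the common endpoints form a null set. *)

Section ComplexModulus.
Variable R : realType.
Local Notation C := R[i].
Local Notation cmod := (@Normc.normc R).
Local Open Scope complex_scope.
Implicit Types z w : C.

Lemma cmod_ge0 z : 0 <= cmod z.
Proof. by case: z => x y; rewrite /= sqrtr_ge0. Qed.

Lemma sqr_cmod z : cmod z ^+ 2 = complex.Re z ^+ 2 + complex.Im z ^+ 2.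
Proof. by case: z => x y; rewrite /= sqr_sqrtr// addr_ge0// sqr_ge0. Qed.

Lemma cmodD z w : cmod (z + w) <= cmod z + cmod w.
Proof. exact: (@le_normcD R z w). Qed.

Lemma cmodN z : cmod (- z) = cmod z.
Proof. exact: (@normcN R z). Qed.

Lemma cmodBC z w : cmod (z - w) = cmod (w - z).
Proof. by rewrite -cmodN opprB. Qed.

Lemma cmodJ z : cmod z^* = cmod z.
Proof. by case: z => x y; rewrite /= sqrrN. Qed.

Lemma cmod0 : cmod 0 = 0. Proof. exact: Normc.normc0. Qed.

Lemma cmod_realE (x : R) : cmod x%:C = `|x|.
Proof. by rewrite /= expr0n addr0 sqrtr_sqr. Qed.

Lemma cmod_real (x : R) : 0 <= x -> cmod x%:C = x.
Proof. by move=> x0; rewrite cmod_realE ger0_norm. Qed.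

Lemma cmodB_le z w t : cmod (z - w) <= cmod (z - t) + cmod (t - w).
Proof. by apply: le_trans (cmodD _ _); rewrite addrA subrK. Qed.

Lemma cReD z w : complex.Re (z + w) = complex.Re z + complex.Re w.
Proof. by case: z w => [? ?] [? ?]. Qed.

Lemma cImD z w : complex.Im (z + w) = complex.Im z + complex.Im w.
Proof. by case: z w => [? ?] [? ?]. Qed.

Lemma cReB z w : complex.Re (z - w) = complex.Re z - complex.Re w.
Proof. by case: z w => [? ?] [? ?]. Qed.

Lemma cImB z w : complex.Im (z - w) = complex.Im z - complex.Im w.
Proof. by case: z w => [? ?] [? ?]. Qed.

Lemma cReM z w : complex.Re (z * w) =
  complex.Re z * complex.Re w - complex.Im z * complex.Im w.
Proof. by case: z w => [? ?] [? ?]. Qed.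

Lemma cImM z w : complex.Im (z * w) =
  complex.Re z * complex.Im w + complex.Im z * complex.Re w.
Proof. by case: z w => [? ?] [? ?]. Qed.

Lemma cReJ z : complex.Re z^* = complex.Re z.
Proof. by case: z. Qed.

Lemma cImJ z : complex.Im z^* = - complex.Im z.
Proof. by case: z. Qed.

Lemma ReImP z w :
  complex.Re z = complex.Re w -> complex.Im z = complex.Im w -> z = w.
Proof. by case: z w => [? ?] [? ?] /= -> ->. Qed.

Lemma conjcM z w : (z * w)^* = z^* * w^*.
Proof. exact: rmorphM. Qed.

Lemma mulcJ z : z * z^* = (cmod z ^+ 2)%:C.
Proof.
rewrite sqr_cmod; apply: ReImP; rewrite ?cReM ?cImM ?cReJ ?cImJ /=;
  first by rewrite mulrN opprK -!expr2.
by rewrite mulrN mulrC addNr.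
Qed.

Lemma Re_le_cmod z : `|complex.Re z| <= cmod z.
Proof.
by rewrite -(@ler_pXn2r _ 2)// ?nnegrE ?cmod_ge0// real_normK ?num_real//
  sqr_cmod lerDl sqr_ge0.
Qed.

Lemma Im_le_cmod z : `|complex.Im z| <= cmod z.
Proof.
by rewrite -(@ler_pXn2r _ 2)// ?nnegrE ?cmod_ge0// real_normK ?num_real//
  sqr_cmod lerDr sqr_ge0.
Qed.

Lemma cmod_le_ReIm z : cmod z <= `|complex.Re z| + `|complex.Im z|.
Proof.
rewrite -(@ler_pXn2r _ 2)// ?nnegrE ?cmod_ge0 ?addr_ge0// sqr_cmod sqrrD.
by rewrite !real_normK ?num_real// addrAC lerDl mulrn_wge0// mulr_ge0.
Qed.

Lemma cmodD_sqr z w : cmod (z + w) ^+ 2 <= 2 * cmod z ^+ 2 + 2 * cmod w ^+ 2.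
Proof.
rewrite !sqr_cmod cReD cImD.
have h (x y : R) : (x + y) ^+ 2 <= 2 * x ^+ 2 + 2 * y ^+ 2.
  rewrite -subr_ge0 [X in 0 <= X](_ : _ = (x - y) ^+ 2) ?sqr_ge0//.
  by rewrite sqrrD sqrrB; lra.
have := h (complex.Re z) (complex.Re w); have := h (complex.Im z) (complex.Im w); lra.
Qed.

Lemma cmod_sum I (r : seq I) (P : pred I) (F : I -> C) :
  cmod (\sum_(i <- r | P i) F i) <= \sum_(i <- r | P i) cmod (F i).
Proof.
elim/big_rec2 : _ => [|i x z _ le]; first by rewrite cmod0.
by apply: le_trans (cmodD _ _) _; rewrite lerD2l.
Qed.

Lemma sum_Re I (r : seq I) (P : pred I) (F : I -> C) :
  complex.Re (\sum_(i <- r | P i) F i) = \sum_(i <- r | P i) complex.Re (F i).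
Proof. by elim/big_rec2 : _ => // i x z _ <-; rewrite cReD. Qed.

Lemma sum_Im I (r : seq I) (P : pred I) (F : I -> C) :
  complex.Im (\sum_(i <- r | P i) F i) = \sum_(i <- r | P i) complex.Im (F i).
Proof. by elim/big_rec2 : _ => // i x z _ <-; rewrite cImD. Qed.

End ComplexModulus.

(** * Unordered sums *)

Section UnorderedSums.
Variables (R : realType) (I : choiceType).
Implicit Types (F G : {fset I}).
Local Open Scope fset_scope.

Lemma partial_sumE (V : zmodType) (u : I -> V) F :
  summability.partial_sum u F = \sum_(i <- F) u i.
Proof. by rewrite /summability.partial_sum (big_seq_fsetE _ F predT). Qed.

Lemma lee_sum_fset (f : I -> \bar R) F G : (forall i, 0 <= f i)%E -> F `<=` G ->
  (\sum_(i <- F) f i <= \sum_(i <- G) f i)%E.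
Proof.
move=> f0 /fsubsetP FG; rewrite [leRHS](bigID (fun i => i \in F))/=.
rewrite [X in (_ <= X + _)%E]big_fset_condE/= (_ : [fset i in G | i \in F] = F).
  by rewrite leeDl// sume_ge0.
by apply/fsetP => i; rewrite !inE andb_idl// => /FG.
Qed.

(** A tail stays a family on the whole index type, with the neutral value [z] in place of the
    removed entries, so that tails for different finite sets are compared term by term under sums
    over [setT]. *)
Definition outside {V : Type} (z : V) F (u : I -> V) : I -> V :=
  fun i => if i \in F then z else u i.

Local Open Scope ereal_scope.

Lemma fsum_le_esum (f : I -> \bar R) F : (forall i, 0 <= f i) ->
  \sum_(i <- F) f i <= \esum_(i in setT) f i.
Proof.
move=> f0; apply: esum_ge; exists [set` F]; first by split => //; exact: finite_fset.
by rewrite (@fsbig_finite _ _ _ _ _ _ (finite_fset F)) set_fsetK.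
Qed.

Lemma esum_le_ub (f : I -> \bar R) y :
  (forall F, \sum_(i <- F) f i <= y) -> \esum_(i in setT) f i <= y.
Proof.
move=> fy; apply: ge_ereal_sup => _ [A [finA _] <-].
by rewrite fsbig_finite.
Qed.

Lemma esum_outside (f : I -> \bar R) F : (forall i, 0 <= f i) ->
  \esum_(i in setT) f i =
  \sum_(i <- F) f i + \esum_(i in setT) outside 0 F f i.
Proof.
move=> f0; rewrite (esumID [set` F])// !setTI; congr (_ + _).
  rewrite (esum_fset (finite_fset F))//.
  by rewrite (@fsbig_finite _ _ _ _ _ _ (finite_fset F)) set_fsetK.
rewrite esum_mkcond; apply: eq_esum => i _; rewrite /outside in_setC.
by rewrite mem_setE if_neg.
Qed.

Lemma outside_ge0 (f : I -> \bar R) F i : (forall i, 0 <= f i) -> 0 <= outside 0 F f i.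
Proof. by move=> f0; rewrite /outside; case: ifP. Qed.

Lemma esum_outside_le (f : I -> \bar R) F G : (forall i, 0 <= f i) -> F `<=` G ->
  \esum_(i in setT) outside 0 G f i <= \esum_(i in setT) outside 0 F f i.
Proof.
move=> f0 /fsubsetP FG; apply: le_esum => i _; rewrite /outside.
by case: ifPn => iG; case: ifPn => // iF; rewrite FG in iG.
Qed.

(** The total is the supremum of the finite sums, so some finite sum misses it by at most [e];
    cancelling that finite number leaves the tail. *)
Lemma esum_tail (f : I -> \bar R) (e : R) : (forall i, 0 <= f i) ->
  \esum_(i in setT) f i < +oo -> (0 < e)%R ->
  exists F, \esum_(i in setT) outside 0 F f i <= e%:E.
Proof.
move=> f0 foo e0.
have ffin : \esum_(i in setT) f i \is a fin_num.
  by rewrite ge0_fin_numE// esum_ge0.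
have [_ [A [finA _] <-]] := ub_ereal_sup_adherent e0 ffin.
rewrite fsbig_finite// => lt; exists (fset_set A).
move: lt; rewrite -[ereal_sup _]/(\esum_(i in setT) f i).
rewrite (esum_outside (fset_set A))// => /ltW.
have Sfin : \sum_(i <- fset_set A) f i \is a fin_num.
  by rewrite ge0_fin_numE ?sume_ge0//; apply: le_lt_trans (fsum_le_esum _ _) _.
by rewrite leeBlDr// leeD2lE.
Qed.

Lemma totally_sub F (P : {fset I} -> Prop) :
  (forall G, (F `<=` G)%fset -> P G) -> \forall G \near summability.totally, P G.
Proof. by move=> FP; exists F. Qed.

Lemma esum_finsupp (f : I -> \bar R) F : (forall i, 0 <= f i) ->
  (forall i, i \notin F -> f i = 0) -> \esum_(i in setT) f i = \sum_(i <- F) f i.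
Proof.
move=> f0 fF; rewrite (esum_outside F)// esum1 ?adde0// => i _.
by rewrite /outside; case: ifPn => // /fF.
Qed.

Lemma esumZ (f : I -> \bar R) (k : R) : (0 <= k)%R -> (forall i, 0 <= f i) ->
  \esum_(i in setT) (k%:E * f i) = k%:E * \esum_(i in setT) f i.
Proof.
move=> k0 f0.
have le (c : R) (g : I -> \bar R) : (0 <= c)%R -> (forall i, 0 <= g i) ->
    \esum_(i in setT) (c%:E * g i) <= c%:E * \esum_(i in setT) g i.
  move=> c0 g0; apply: esum_le_ub => F.
  by rewrite -ge0_sume_distrr// lee_wpmul2l ?lee_fin//; exact: fsum_le_esum.
apply/eqP; rewrite eq_le le//=.
have [<-|kN0] := eqVneq 0%R k; last have {}k0 : (0 < k)%R by rewrite lt_neqAle kN0.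
  by rewrite mul0e esum_ge0// => i _; rewrite mul0e.
(* The reverse inequality is the first one for the inverse of [k]. *)
rewrite -lee_pdivlMl//; apply: le_trans (le _ _ _ _); rewrite ?invr_ge0 ?(ltW k0)//.
  by apply: le_esum => i _; rewrite muleA -EFinM mulVf ?gt_eqF// mul1e.
by move=> i; rewrite mule_ge0// lee_fin ltW.
Qed.

End UnorderedSums.

(** * Real families: absolute summability and convergence along finite sets *)

Section RealSums.
Variables (R : realType) (I : choiceType).
Implicit Types (F G : {fset I}) (u f : I -> R).

Lemma ler_sum_fset f F G : (forall i, 0 <= f i) -> (F `<=` G)%fset ->
  \sum_(i <- F) f i <= \sum_(i <- G) f i.
Proof.
move=> f0 FG; rewrite -lee_fin -!sumEFin; by apply: lee_sum_fset.
Qed.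

Lemma fine_esum_outside f F : (forall i, 0 <= f i) ->
  (\esum_(i in setT) (f i)%:E < +oo)%E ->
  fine (\esum_(i in setT) (f i)%:E) =
  \sum_(i <- F) f i + fine (\esum_(i in setT) (outside 0 F f i)%:E).
Proof.
move=> f0 foo; have f0' i : (0 <= (f i)%:E)%E by rewrite lee_fin.
have outE : \esum_(i in setT) (outside 0 F f i)%:E =
    \esum_(i in setT) outside 0%E F (fun i => (f i)%:E) i.
  by apply: eq_esum => i _; rewrite /outside; case: ifP.
rewrite (esum_outside F)// fineD.
- by rewrite outE sumEFin.
- by rewrite sumEFin.
- rewrite ge0_fin_numE; last by apply: esum_ge0 => i _; exact: outside_ge0.
  by apply: le_lt_trans foo; rewrite (esum_outside F f0') leeDr// sume_ge0.
Qed.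

Let pos u i := Num.max (u i) 0.
Let neg u i := Num.max (- u i) 0.

Let posneg u i : u i = pos u i - neg u i.
Proof.
rewrite /pos /neg; have [u0|u0] := leP (u i) 0.
  by rewrite max_l ?oppr_ge0// sub0r opprK.
by rewrite max_r ?subr0// oppr_le0 ltW.
Qed.

Let pos_ge0 u i : 0 <= pos u i. Proof. by rewrite le_max lexx orbT. Qed.
Let neg_ge0 u i : 0 <= neg u i. Proof. by rewrite le_max lexx orbT. Qed.

Let posDneg u i : pos u i + neg u i = `|u i|.
Proof.
rewrite /pos /neg; have [u0|u0] := leP (u i) 0.
  by rewrite max_l ?oppr_ge0// add0r ler0_norm.
by rewrite max_r ?oppr_le0 ?(ltW u0)// addr0 gtr0_norm.
Qed.

(** Once a finite set contains [F0], the tails [U] and [V] of the positive and negative parts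
    satisfy [U + V <= e], and the error of the partial sum is [|U - V|]. Writing the limit with
    these two parts makes it measurable in a parameter. *)
Lemma real_sum_cvg u : (\esum_(i in setT) (`|u i|)%:E < +oo)%E ->
  (summability.partial_sum u : _ -> R^o) @ summability.totally -->
  (fine (\esum_(i in setT) (Num.max (u i) 0)%:E) -
   fine (\esum_(i in setT) (Num.max (- u i) 0)%:E) : R^o).
Proof.
move=> uoo.
have poo : (\esum_(i in setT) (pos u i)%:E < +oo)%E.
  by apply: le_lt_trans uoo; apply: le_esum => i _; rewrite lee_fin -posDneg lerDl.
have noo : (\esum_(i in setT) (neg u i)%:E < +oo)%E.
  by apply: le_lt_trans uoo; apply: le_esum => i _; rewrite lee_fin -posDneg lerDr.
have FF : ProperFilter (@summability.totally I) := summability.totally_filter.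
apply/cvgrPdist_le => e e0.
have [//|//|//|F0 F0e] := @esum_tail R I (fun i => `|u i|%:E) e.
apply: (totally_sub (F := F0)) => F F0F.
rewrite partial_sumE.
rewrite -[X in `|X - _|]/(fine (\esum_(i in setT) (pos u i)%:E) -
  fine (\esum_(i in setT) (neg u i)%:E)).
rewrite (fine_esum_outside F (pos_ge0 u))//.
rewrite (fine_esum_outside F (neg_ge0 u))//.
set U := fine (\esum_(i in setT) (outside 0 F (pos u) i)%:E).
set V := fine (\esum_(i in setT) (outside 0 F (neg u) i)%:E).
rewrite (_ : \sum_(i <- F) u i = \sum_(i <- F) pos u i - \sum_(i <- F) neg u
  i); last first.
  by rewrite -sumrB; apply: eq_bigr => i _; exact: posneg.
rewrite (_ : _ - _ = U - V); last by lra.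
have out0 f i : (forall i, 0 <= f i) -> (0 <= (outside 0 F f i)%:E)%E.
  by move=> f0; rewrite lee_fin /outside; case: ifP.
have U0 : 0 <= U by rewrite fine_ge0// esum_ge0// => i _; exact: out0.
have V0 : 0 <= V by rewrite fine_ge0// esum_ge0// => i _; exact: out0.
have UV : U + V <= e.
  rewrite -lee_fin EFinD; apply: le_trans F0e.
  apply: le_trans (esum_outside_le _ F0F) => //.
  rewrite /U /V !fineK.
  - rewrite -esumD; [|by move=> i _; exact: out0..].
    apply: le_esum => i _; rewrite /outside; case: ifP => _; first by rewrite adde0.
    by rewrite -EFinD lee_fin posDneg.
  - rewrite ge0_fin_numE ?esum_ge0// => [|i _]; last exact: out0.
    by apply: le_lt_trans noo; apply: le_esum => i _; rewrite lee_fin /outside;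
      case: ifP.
  - rewrite ge0_fin_numE ?esum_ge0// => [|i _]; last exact: out0.
    by apply: le_lt_trans poo; apply: le_esum => i _; rewrite lee_fin /outside;
      case: ifP.
by rewrite ler_norml; lra.
Qed.

Lemma real_sumE u : (\esum_(i in setT) (`|u i|)%:E < +oo)%E ->
  summability.sum (u : I -> R^o) =
  fine (\esum_(i in setT) (Num.max (u i) 0)%:E) -
  fine (\esum_(i in setT) (Num.max (- u i) 0)%:E).
Proof.
have FF : ProperFilter (@summability.totally I) := summability.totally_filter.
by move=> /real_sum_cvg; apply: cvg_lim.
Qed.

(** Convergence along finite sets forces absolute summability: the sums over two finite sets
    containing [F0] differ by at most 2, which bounds separately the positive and the negative terms
    outside [F0]. Without absolute summability the limit is thus the default value; knowing this
    makes unordered sums measurable also where they diverge. *)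
Lemma real_sum_dvg u : \esum_(i in setT) (`|u i|)%:E = +oo%E ->
  summability.sum (u : I -> R^o) = point.
Proof.
have FF : ProperFilter (@summability.totally I) := summability.totally_filter.
move=> uoo; apply: dvgP => /cvg_ex[/= l].
move=> /cvgrPdist_le/(_ _ ltr01)[F0 _ /= F0l].
suff: (\esum_(i in setT) (`|u i|)%:E <= (\sum_(i <- F0) `|u i| + 2 + 2)%:E)%E.
  by rewrite uoo leye_eq.
apply: esum_le_ub => F.
have part (P : pred I) : `|\sum_(i <- F | (i \notin F0) && P i) u i| <= 2.
  have h (G : {fset I}) : (F0 `<=` G)%fset -> `|l - \sum_(i <- G) u i| <= 1.
    by move=> /F0l; rewrite partial_sumE.
  have h0 := h F0 (fsubset_refl _).
  pose G := ([fset i in F | (i \notin F0) && P i])%fset.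
  have := h (F0 `|` G)%fset (fsubsetUl _ _).
  rewrite (_ : \sum_(i <- (F0 `|` G)%fset) u i =
    \sum_(i <- F0) u i + \sum_(i <- F | (i \notin F0) && P i) u i).
    by move: h0; rewrite !ler_norml; lra.
  rewrite [RHS]addrC [in RHS]big_fset_condE -/G addrC -big_cat.
  apply: perm_big; apply: uniq_perm; rewrite ?fset_uniq//.
    rewrite cat_uniq !fset_uniq andbT/=; apply/hasPn => i.
    by rewrite !inE /= => /andP[_ /andP[]].
  by move=> i; rewrite mem_cat inE.
have E : \sum_(i <- F | i \notin F0) `|u i| =
    \sum_(i <- F | (i \notin F0) && (0 <= u i)) u i -
    \sum_(i <- F | (i \notin F0) && (u i < 0)) u i.
  rewrite (bigID (fun i => 0 <= u i))/= -sumrN; congr (_ + _).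
    by apply: eq_bigr => i /andP[_ ?]; rewrite ger0_norm.
  by apply: eq_big => [i|i /andP[_]]; rewrite -ltNge// => ?; rewrite ltr0_norm.
rewrite sumEFin lee_fin (bigID (fun i => i \in F0))/= E.
have := part (fun i => 0 <= u i); have := part (fun i => u i < 0).
have : \sum_(i <- F | i \in F0) `|u i| <= \sum_(i <- F0) `|u i|.
  rewrite big_fset_condE/=; apply: ler_sum_fset => //.
  by apply/fsubsetP => i; rewrite !inE => /andP[].
rewrite !ler_norml; lra.
Qed.

End RealSums.

(** * Square-summable sequences over Z *)

Section ComplexSums.
Variable R : realType.
Local Notation C := R[i].
Local Notation cmod := (@Normc.normc R).
Local Open Scope complex_scope.
Implicit Types (u v w : int -> C) (F G : {fset int}).

Lemma csummableE u :
  csummable u = (\esum_(n in setT) (cmod (u n))%:E < +oo)%E.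
Proof.
rewrite /csummable /summable; congr (_ < _)%E.
by apply: eq_esum => n _; rewrite abse_EFin ger0_norm ?cmod_ge0.
Qed.

Lemma cmod_eq (z t : C) : (forall e : R, 0 < e -> cmod (z - t) <= e) -> z = t.
Proof.
move=> zt; apply/eqP; rewrite -subr_eq0; apply/eqP/Normc.eq0_normc.
apply/eqP; rewrite eq_le cmod_ge0 andbT; apply/ler_addgt0Pr => e e0.
by rewrite add0r zt.
Qed.

Lemma csum_approx u e : csummable u -> 0 < e ->
  exists F, forall G, (F `<=` G)%fset -> cmod (csum u - \sum_(n <- G) u n) <= e.
Proof.
rewrite csummableE => uoo e0.
have FF : ProperFilter (@summability.totally int) := summability.totally_filter.
have reoo : (\esum_(n in setT) (`|complex.Re (u n)|)%:E < +oo)%E.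
  by apply: le_lt_trans uoo; apply: le_esum => n _; rewrite lee_fin Re_le_cmod.
have imoo : (\esum_(n in setT) (`|complex.Im (u n)|)%:E < +oo)%E.
  by apply: le_lt_trans uoo; apply: le_esum => n _; rewrite lee_fin Im_le_cmod.
have e20 : 0 < e / 2 by rewrite divr_gt0.
have := real_sum_cvg reoo; rewrite -(real_sumE reoo).
move=> /cvgrPdist_le/(_ _ e20)[F1 _ /= F1e].
have := real_sum_cvg imoo; rewrite -(real_sumE imoo).
move=> /cvgrPdist_le/(_ _ e20)[F2 _ /= F2e].
exists (F1 `|` F2)%fset => G; rewrite fsubUset => /andP[/F1e + /F2e].
rewrite !partial_sumE => h1 h2.
apply: le_trans (cmod_le_ReIm _) _; rewrite cReB cImB sum_Re sum_Im.
by rewrite [leRHS]splitr lerD.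
Qed.

(** Laws of [csum] are derived from those of finite sums by this criterion; summability ensures that
    [csum u] is a limit and not a default value. *)
Lemma csum_unique u z : csummable u ->
  (forall e, 0 < e -> exists F, forall G, (F `<=` G)%fset ->
    cmod (z - \sum_(n <- G) u n) <= e) -> csum u = z.
Proof.
move=> su uz; apply: cmod_eq => e e0.
have e20 : 0 < e / 2 by rewrite divr_gt0.
have [F Fe] := csum_approx su e20; have [G Ge] := uz _ e20.
have := Fe _ (fsubsetUl F G); have := Ge _ (fsubsetUr F G) => h1 h2.
apply: le_trans (cmodB_le _ _ (\sum_(n <- (F `|` G)%fset) u n)) _.
by rewrite [leRHS]splitr lerD// cmodBC.
Qed.

Lemma csummableD u v : csummable u -> csummable v -> csummable (fun n => u n + v n).
Proof.
rewrite !csummableE => uoo voo.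
apply: le_lt_trans (lte_add_pinfty uoo voo); rewrite -esumD => [|n _|n _];
  rewrite ?lee_fin ?cmod_ge0//.
by apply: le_esum => n _; rewrite -EFinD lee_fin cmodD.
Qed.

Lemma csummableZ c u : csummable u -> csummable (fun n => c * u n).
Proof.
rewrite !csummableE => uoo; under eq_esum do rewrite Normc.normcM EFinM.
rewrite esumZ ?cmod_ge0// => [|n]; last by rewrite lee_fin cmod_ge0.
by rewrite lte_mul_pinfty// lee_fin cmod_ge0.
Qed.

Lemma csummableJ u : csummable u -> csummable (fun n => (u n)^*).
Proof. by rewrite !csummableE; under [X in _ -> (X < _)%E]eq_esum do rewrite cmodJ. Qed.

Lemma csumD u v : csummable u -> csummable v ->
  csum (fun n => u n + v n) = csum u + csum v.
Proof.
move=> su sv; apply: csum_unique; first exact: csummableD.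
move=> e e0; have e20 : 0 < e / 2 by rewrite divr_gt0.
have [F Fe] := csum_approx su e20; have [G Ge] := csum_approx sv e20.
exists (F `|` G)%fset => H; rewrite fsubUset => /andP[/Fe h1 /Ge h2].
rewrite big_split/= opprD addrACA; apply: le_trans (cmodD _ _) _.
by rewrite [leRHS]splitr lerD.
Qed.

Lemma csumZ c u : csummable u -> csum (fun n => c * u n) = c * csum u.
Proof.
move=> su; apply: csum_unique; first exact: csummableZ.
move=> e e0; have c0 : 0 < cmod c + 1 by rewrite ltr_wpDl ?cmod_ge0.
have [F Fe] := csum_approx su (divr_gt0 e0 c0).
exists F => H /Fe h; rewrite -mulr_sumr -mulrBr Normc.normcM.
apply: le_trans (_ : (cmod c + 1) * (e / (cmod c + 1)) <= _).
  by rewrite ler_pM ?cmod_ge0// lerDl.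
by rewrite mulrCA mulfV ?gt_eqF// mulr1.
Qed.

Lemma csumJ u : csummable u -> csum (fun n => (u n)^*) = (csum u)^*.
Proof.
move=> su; apply: csum_unique; first exact: csummableJ.
move=> e e0; have [F Fe] := csum_approx su e0; exists F => H /Fe h.
by rewrite -(rmorph_sum (@conjc R)) -(rmorphB (@conjc R)) cmodJ.
Qed.

Lemma esumN (f : int -> \bar R) :
  \esum_(n in setT) f (- n) = \esum_(n in setT) f n.
Proof.
symmetry; apply: (reindex_esum setT setT (fun n : int => - n)); split => //.
Qed.

Lemma esum_shift (f : int -> \bar R) (m : int) :
  \esum_(n in setT) f (m + n) = \esum_(n in setT) f n.
Proof.
symmetry; apply: (reindex_esum setT setT (fun n : int => m + n)); split => //.
Qed.

Lemma csumN u : csummable u -> csum (fun n => u (- n)) = csum u.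
Proof.
move=> su; apply: csum_unique.
  by move: su; rewrite !csummableE (esumN (fun n => (cmod (u n))%:E)).
move=> e e0; have [F Fe] := csum_approx su e0.
exists [fset (- n)%R | n in F]%fset => G FG.
have := Fe [fset (- n)%R | n in G]%fset.
rewrite big_imfset/=; last by move=> ? ? _ _ /oppr_inj.
apply; apply/fsubsetP => n nF; apply/imfsetP; exists (- n); rewrite ?opprK//=.
by move/fsubsetP : FG; apply; apply/imfsetP; exists n.
Qed.

Lemma csummable_finsupp u F : (forall n, n \notin F -> u n = 0) -> csummable u.
Proof.
move=> uF; rewrite csummableE (@esum_finsupp _ _ _ F).
- by rewrite sumEFin ltry.
- by move=> n; rewrite lee_fin cmod_ge0.
- by move=> n /uF ->; rewrite cmod0.
Qed.

Lemma csum_finsupp u F : (forall n, n \notin F -> u n = 0) ->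
  csum u = \sum_(n <- F) u n.
Proof.
move=> uF; apply: csum_unique; first exact: csummable_finsupp uF.
move=> e e0; exists F => G FG; rewrite (big_fset_incl _ FG).
  by rewrite subrr cmod0 ltW.
by move=> n _; exact: uF.
Qed.

Lemma csum_le u : csummable u ->
  ((cmod (csum u))%:E <= \esum_(n in setT) (cmod (u n))%:E)%E.
Proof.
move=> su; apply/lee_addgt0Pr => e e0; have [F /(_ F (fsubset_refl F)) Fe] :=
  csum_approx su e0.
apply: le_trans (_ : ((\sum_(n <- F) cmod (u n))%:E + e%:E <= _)%E).
  rewrite -EFinD lee_fin -[csum u](subrK (\sum_(n <- F) u n)).
  by apply: le_trans (cmodD _ _) _; rewrite addrC lerD// cmod_sum.
by rewrite leeD2r// -sumEFin fsum_le_esum// => n; rewrite lee_fin cmod_ge0.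
Qed.

Lemma csummable_le u v : csummable v -> (forall n, cmod (u n) <= cmod (v n)) ->
  csummable u.
Proof.
rewrite !csummableE => voo uv; apply: le_lt_trans voo.
by apply: le_esum => n _; rewrite lee_fin.
Qed.

Lemma csum_outside u F : csummable u ->
  csum u = \sum_(n <- F) u n + csum (outside 0 F u).
Proof.
move=> su; pose v n := if n \in F then u n else 0.
have vF n : n \notin F -> v n = 0 by rewrite /v => /negbTE ->.
have -> : \sum_(n <- F) u n = csum v.
  rewrite (csum_finsupp vF); rewrite !big_seq; apply: eq_bigr => n nF.
  by rewrite /v nF.
rewrite -csumD.
- by congr csum; apply/funext => n; rewrite /v /outside; case: ifP;
  rewrite ?addr0 ?add0r.
- exact: csummable_finsupp vF.
- by apply: csummable_le su _ => n; rewrite /outside; case: ifP;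
  rewrite ?cmod0 ?cmod_ge0.
Qed.

(** The integers from [- N] to [N], listed as in [ell2s_dom]. The boxes form a sequence that is
    cofinal among the finite sets of integers, which suits null sets and sequential limits. *)
Definition box (N : nat) : {fset int} :=
  [fset n in [seq k%:Z - N%:Z | k <- iota 0 N.*2.+1]]%fset.

Lemma in_box (N : nat) (n : int) : (n \in box N) = (`|n| <= N)%N.
Proof.
rewrite in_fset.
apply/mapP/idP => [[k]|nN].
  by rewrite mem_iota => /andP[_ k2N] ->; lia.
by exists (absz (n + N%:Z)); [rewrite mem_iota; lia|lia].
Qed.

Lemma sum_box (V : nmodType) (f : int -> V) (N : nat) :
  \sum_(k < N.*2.+1) f (k%:Z - N%:Z) = \sum_(n <- box N) f n.
Proof.
rewrite -(big_mkord predT (fun k => f (k%:Z - N%:Z))) /index_iota subn0.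
rewrite -(big_map (fun k : nat => k%:Z - N%:Z) predT f).
apply: perm_big; apply: uniq_perm; rewrite ?fset_uniq//.
  by rewrite map_inj_uniq ?iota_uniq// => i j; lia.
by move=> n; rewrite in_fset.
Qed.

Lemma sub_box_ex F : exists N, forall M, (N <= M)%N -> (F `<=` box M)%fset.
Proof.
exists (\max_(n <- F) `|n|)%N => M NM; apply/fsubsetP => n nF.
rewrite in_box; apply: leq_trans NM.
exact: (@leq_bigmax_seq _ (enum_fset F) predT (fun n : int => `|n|%N)).
Qed.

Lemma esum_box (f : int -> \bar R) : (forall n, 0 <= f n)%E ->
  (fun N => \sum_(k < N.*2.+1) f (k%:Z - N%:Z)%R)%E @ \oo -->
  \esum_(n in setT) f n.
Proof.
move=> f0.
have nd : {homo (fun N => \sum_(k < N.*2.+1) f (k%:Z - N%:Z)%R)%E :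
    n m / (n <= m)%N >-> (n <= m)%E}.
  move=> n m nm; rewrite !sum_box; apply: lee_sum_fset => //.
  by apply/fsubsetP => i; rewrite !in_box => /leq_trans; apply.
have := ereal_nondecreasing_cvgn nd.
set S := ereal_sup _; suff -> : S = \esum_(n in setT) f n by [].
apply/eqP; rewrite eq_le; apply/andP; split.
  by apply: ge_ereal_sup => _ [N _ <-]; rewrite sum_box fsum_le_esum.
apply: esum_le_ub => F; have [N /(_ N (leqnn N)) FN] := sub_box_ex F.
apply: le_trans (lee_sum_fset f0 FN) _; rewrite -sum_box.
by apply: ereal_sup_ubound; exists N.
Qed.

(** The squared norm, in the extended reals so that it makes sense before summability is known. *)
Definition l2 v : \bar R := \esum_(n in setT) ((cmod (v n)) ^+ 2)%:E.
Definition ip v w : C := csum (fun n => v n * (w n)^*).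

Lemma sqr_cmod_ge0 z : (0 <= ((cmod z) ^+ 2)%:E)%E.
Proof. by rewrite lee_fin sqr_ge0. Qed.
Local Hint Resolve sqr_cmod_ge0 : core.

Lemma l2_ge0 v : (0 <= l2 v)%E. Proof. exact: esum_ge0. Qed.

Lemma l2_coord v n : (((cmod (v n)) ^+ 2)%:E <= l2 v)%E.
Proof.
apply: le_trans (fsum_le_esum [fset n]%fset _) => //.
by rewrite big_seq_fset1.
Qed.

Lemma l2_eq0 v n : l2 v = 0%E -> v n = 0.
Proof.
move=> v0; have := l2_coord v n; rewrite v0 lee_fin => h.
have : cmod (v n) ^+ 2 == 0 by rewrite eq_le h sqr_ge0.
by rewrite sqrf_eq0 => /eqP/Normc.eq0_normc.
Qed.

Lemma l2_outside v F :
  l2 v = ((\sum_(n <- F) (cmod (v n)) ^+ 2)%:E + l2 (outside 0%R F v))%E.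
Proof.
rewrite /l2 (esum_outside F)// sumEFin; congr (_ + _)%E.
by apply: eq_esum => n _; rewrite /outside; case: ifP => // _; rewrite cmod0 expr0n.
Qed.

Lemma l2_le v w : (forall n, cmod (v n) <= cmod (w n)) -> (l2 v <= l2 w)%E.
Proof.
move=> vw; apply: le_esum => n _.
by rewrite lee_fin ler_pXn2r// nnegrE cmod_ge0.
Qed.

Lemma l2_outside_le v F G : (F `<=` G)%fset ->
  (l2 (outside 0%R G v) <= l2 (outside 0%R F v))%E.
Proof.
move=> /fsubsetP FG; apply: l2_le => n; rewrite /outside.
by case: ifPn => nG; case: ifPn => // nF; rewrite ?cmod0 ?cmod_ge0//; rewrite FG in nG.
Qed.

Lemma l2_tail v e : (l2 v < +oo)%E -> 0 < e ->
  exists F, (l2 (outside 0%R F v) <= e%:E)%E.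
Proof.
move=> voo e0; have [//|F Fe] := @esum_tail R _ (fun n =>
  ((cmod (v n)) ^+ 2)%:E) e _ voo e0.
exists F; apply: le_trans Fe; apply: le_esum => n _; rewrite /outside.
by case: ifP => // _; rewrite cmod0 expr0n.
Qed.

Lemma l2D v w : (l2 (fun n => v n + w n)%R <= 2%:E * l2 v + 2%:E * l2 w)%E.
Proof.
rewrite -!esumZ// -esumD; [|by move=> n _; rewrite mule_ge0..].
by apply: le_esum => n _; rewrite -!EFinM -EFinD lee_fin cmodD_sqr.
Qed.

Lemma l2Z c v : l2 (fun n => c * v n)%R = (((cmod c) ^+ 2)%:E * l2 v)%E.
Proof.
rewrite -esumZ ?sqr_ge0//; apply: eq_esum => n _.
by rewrite Normc.normcM exprMn EFinM.
Qed.

Lemma l2N v : l2 (fun n => v (- n)) = l2 v.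
Proof. exact: (esumN (fun n => ((cmod (v n)) ^+ 2)%:E)). Qed.

Lemma l2_finsupp v F : (forall n, n \notin F -> v n = 0) ->
  l2 v = (\sum_(n <- F) (cmod (v n)) ^+ 2)%:E.
Proof.
move=> vF; rewrite /l2 (@esum_finsupp _ _ _ F)// ?sumEFin// => n /vF ->.
by rewrite cmod0 expr0n.
Qed.

(** Bounding the sum of the moduli yields both the summability of the products and the bound on
    [ip]. The norms enter through upper bounds [p] and [q], the form in which they are known almost
    everywhere. *)
Lemma cauchy_schwarz v w (p q : R) : 0 <= p -> 0 <= q ->
  (l2 v <= (p ^+ 2)%:E)%E -> (l2 w <= (q ^+ 2)%:E)%E ->
  (\esum_(n in setT) (cmod (v n * (w n)^*))%:E <= (p * q)%:E)%E.
Proof.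
move=> p0 q0 vp wq.
(* The weights [q / p] and [p / q] used below require both bounds to be nonzero. *)
have vanish t s (x : R) : (l2 t <= (x ^+ 2)%:E)%E -> x = 0 ->
    (\esum_(n in setT) (cmod (t n * s n))%:E <= 0)%E.
  move=> tx x0; rewrite esum1// => n _; rewrite (l2_eq0 (v := t)) ?mul0r ?cmod0//.
  by apply/eqP; rewrite eq_le l2_ge0 andbT; move: tx; rewrite x0 expr0n.
have [pE|pn0] := eqVneq p 0.
  by rewrite pE mul0r; exact: vanish vp pE.
have [qE|qn0] := eqVneq q 0.
  rewrite qE mulr0; apply: le_trans (vanish _ (fun n => (v n)^*) _ wq qE).
  by apply: le_esum => n _; rewrite lee_fin !Normc.normcM !cmodJ mulrC.
have pp : 0 < p by rewrite lt_neqAle eq_sym pn0.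
have qp : 0 < q by rewrite lt_neqAle eq_sym qn0.
have pq0 : 0 <= q / p / 2 by rewrite !divr_ge0.
have qp0 : 0 <= p / q / 2 by rewrite !divr_ge0.
apply: (@le_trans _ _ ((q / p / 2)%:E * l2 v + (p / q / 2)%:E * l2 w)%E).
  rewrite -!esumZ// -esumD; [|by move=> n _; rewrite mule_ge0..].
  apply: le_esum => n _; rewrite -!EFinM -EFinD lee_fin Normc.normcM cmodJ.
  (* AM-GM: [x y <= (q / p x ^ 2 + p / q y ^ 2) / 2] *)
  set x := cmod (v n); set y := cmod (w n).
  rewrite -subr_ge0 [X in 0 <= X](_ : _ = (q * x - p * y) ^+ 2 / (2 * p * q)).
    by rewrite divr_ge0 ?sqr_ge0 ?mulr_ge0.
  by field; rewrite pn0 qn0.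
apply: (@le_trans _ _ ((q / p / 2)%:E * (p ^+ 2)%:E + (p / q / 2)%:E * (q ^+ 2)%:E)%E).
  by rewrite leeD// lee_wpmul2l.
rewrite -!EFinM -EFinD lee_fin le_eqVlt; apply/orP; left; apply/eqP.
by field; rewrite pn0 qn0.
Qed.

Lemma l2_sqr_ub v : (l2 v < +oo)%E ->
  exists2 p : R, 0 <= p & l2 v = (p ^+ 2)%:E.
Proof.
move=> voo; have vf : l2 v \is a fin_num by rewrite ge0_fin_numE ?l2_ge0.
exists (Num.sqrt (fine (l2 v))); first exact: sqrtr_ge0.
by rewrite sqr_sqrtr ?fine_ge0 ?l2_ge0// fineK.
Qed.

Lemma ip_csummable v w : (l2 v < +oo)%E -> (l2 w < +oo)%E ->
  csummable (fun n => v n * (w n)^*).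
Proof.
move=> /l2_sqr_ub[p p0 vp] /l2_sqr_ub[q q0 wq]; rewrite csummableE.
by apply: le_lt_trans (cauchy_schwarz p0 q0 _ _) _; rewrite ?vp ?wq ?ltry.
Qed.

Lemma cmod_ip_le v w (p q : R) : 0 <= p -> 0 <= q ->
  (l2 v <= (p ^+ 2)%:E)%E -> (l2 w <= (q ^+ 2)%:E)%E -> cmod (ip v w) <= p * q.
Proof.
move=> p0 q0 vp wq; rewrite -lee_fin; apply: le_trans (cauchy_schwarz p0 q0 vp wq).
apply: csum_le; apply: ip_csummable; apply: le_lt_trans;
  [exact: vp|exact: ltry|exact: wq|exact: ltry].
Qed.

Lemma ip_self v : (l2 v < +oo)%E -> ip v v = (fine (l2 v))%:C.
Proof.
move=> voo; apply: csum_unique; first exact: ip_csummable.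
move=> e e0; have [F Fe] := l2_tail voo e0; exists F => G FG.
have := le_trans (l2_outside_le v FG) Fe.
have vf : l2 v \is a fin_num by rewrite ge0_fin_numE ?l2_ge0.
rewrite (eq_bigr (fun n => (cmod (v n) ^+ 2)%:C)); last by move=> n _; rewrite mulcJ.
rewrite -(rmorph_sum (real_complex R)) -(rmorphB (real_complex R)).
have Gfin : l2 (outside 0 G v) \is a fin_num.
  rewrite ge0_fin_numE ?l2_ge0//; apply: le_lt_trans voo.
  by rewrite (l2_outside v G) leeDr// lee_fin sumr_ge0// => n _; exact: sqr_ge0.
rewrite (_ : _ - _ = fine (l2 (outside 0 G v))); last first.
  by rewrite (l2_outside v G) fineD// addrAC subrr add0r.
by rewrite cmod_real ?fine_ge0 ?l2_ge0// -lee_fin fineK.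
Qed.

Lemma ipDl v v' w : (l2 v < +oo)%E -> (l2 v' < +oo)%E -> (l2 w < +oo)%E ->
  ip (fun n => v n + v' n) w = ip v w + ip v' w.
Proof.
move=> voo v'oo woo; rewrite /ip -csumD; [|exact: ip_csummable..].
by congr csum; apply/funext => n; rewrite mulrDl.
Qed.

Lemma ipZl c v w : (l2 v < +oo)%E -> (l2 w < +oo)%E ->
  ip (fun n => c * v n) w = c * ip v w.
Proof.
move=> voo woo; rewrite /ip -csumZ; last exact: ip_csummable.
by congr csum; apply/funext => n; rewrite mulrA.
Qed.

Lemma ipC v w : (l2 v < +oo)%E -> (l2 w < +oo)%E -> ip w v = (ip v w)^*.
Proof.
move=> voo woo; rewrite /ip -csumJ; last exact: ip_csummable.
by congr csum; apply/funext => n; rewrite conjcM conjCK mulrC.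
Qed.

Lemma ipN v w : (l2 v < +oo)%E -> (l2 w < +oo)%E ->
  ip (fun n => v (- n)) (fun n => w (- n)) = ip v w.
Proof. by move=> voo woo; apply: (csumN (u := fun n => v n * (w n)^*));
  exact: ip_csummable. Qed.

End ComplexSums.

(** * Measurability and translations *)

Section Measurability.
Variable R : realType.
Local Notation C := R[i].
Local Notation cmod := (@Normc.normc R).
Local Notation mu := (@lebesgue_measure R).
Local Open Scope complex_scope.
Implicit Types (D : set R) (f g : R -> C).

Lemma cmeasurable_cst D (c : C) : cmeasurable D (fun=> c).
Proof. by split; exact: measurable_cst. Qed.

Lemma cmeasurableD D f g : cmeasurable D f -> cmeasurable D g ->
  cmeasurable D (fun x => f x + g x).
Proof.
move=> [fr fi] [gr gi]; split.
  by under eq_fun do rewrite cReD; exact: measurable_funD.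
by under eq_fun do rewrite cImD; exact: measurable_funD.
Qed.

Lemma cmeasurableM D f g : cmeasurable D f -> cmeasurable D g ->
  cmeasurable D (fun x => f x * g x).
Proof.
move=> [fr fi] [gr gi]; split.
  by under eq_fun do rewrite cReM; apply: measurable_funB; exact: measurable_funM.
by under eq_fun do rewrite cImM; apply: measurable_funD; exact: measurable_funM.
Qed.

Lemma cmeasurableZ D (c : C) f : cmeasurable D f -> cmeasurable D (fun x => c * f x).
Proof. exact/cmeasurableM/cmeasurable_cst. Qed.

Lemma cmeasurableJ D f : cmeasurable D f -> cmeasurable D (fun x => (f x)^*).
Proof.
move=> [fr fi]; split; first by under eq_fun do rewrite cReJ.
by under eq_fun do rewrite cImJ; exact: measurable_funN.
Qed.

Lemma cmeasurable_real D (f : R -> R) : measurable_fun D f ->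
  cmeasurable D (fun x => (f x)%:C).
Proof. by move=> mf; split => //=; exact: measurable_cst. Qed.

Lemma cmeasurableS D D' f : measurable D' -> D `<=` D' ->
  cmeasurable D' f -> cmeasurable D f.
Proof. by move=> mD DD' [fr fi]; split; exact: measurable_funS DD' _. Qed.

Lemma measurable_sqr_cmod D f : cmeasurable D f ->
  measurable_fun D (fun x => cmod (f x) ^+ 2).
Proof.
move=> [fr fi]; under eq_fun do rewrite sqr_cmod.
by apply: measurable_funD; exact: measurable_funX.
Qed.

Lemma measurable_sqrt D (f : R -> R) : measurable_fun D f ->
  measurable_fun D (fun x => Num.sqrt (f x)).
Proof. by move=> mf; apply: measurableT_comp mf;
  apply: continuous_measurable_fun; exact: sqrt_continuous. Qed.

(** Along the boxes, the unordered sum is the limit of a sequence of measurable functions. *)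
Lemma measurable_esum D (h : int -> R -> \bar R) : (forall n x, 0 <= h n x)%E ->
  (forall n, measurable_fun D (h n)) ->
  measurable_fun D (fun x => \esum_(n in setT) h n x).
Proof.
move=> h0 mh; apply: (emeasurable_fun_cvg
    (fun N => fun x => \sum_(k < N.*2.+1) h (k%:Z - N%:Z)%R x)%E) => [N|x _].
  by apply: emeasurable_sum => k; exact: mh.
exact: (esum_box (f := h^~ x)).
Qed.

(** The set where the family is absolutely summable is measurable; on it the sum is a difference of
    two sums of nonnegative terms, and off it the constant [point]. *)
Lemma measurable_real_sum D (h : int -> R -> R) : measurable D ->
  (forall n, measurable_fun D (h n)) ->
  measurable_fun D (fun x => summability.sum (fun n => h n x : R^o)).
Proof.
move=> mD mh; pose S x := \esum_(n in setT) (`|h n x|)%:E.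
have mS : measurable_fun D S.
  apply: measurable_esum => [n x|n]; first by rewrite lee_fin.
  by apply/measurable_EFinP; exact: measurableT_comp.
pose p x := fine (\esum_(n in setT) (Num.max (h n x) 0)%:E).
pose q x := fine (\esum_(n in setT) (Num.max (- h n x) 0)%:E).
rewrite (_ : (fun x => _) =
    fun x => if (S x < +oo)%E then p x - q x else (point : R)); last first.
  apply/funext => x; case: ifPn => [/real_sumE -> //|].
  by rewrite -leNgt leye_eq => /eqP/real_sum_dvg.
have mpos (k : int -> R -> R) : (forall n, measurable_fun D (k n)) ->
    measurable_fun D (fun x => fine (\esum_(n in setT) (Num.max (k n x) 0)%:E)).
  move=> mk; apply: (measurableT_comp (fine_measurable measurableT)).
  apply: measurable_esum => [n x|n]; first by rewrite lee_fin le_max lexx orbT.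
  by apply/measurable_EFinP; apply: measurable_maxr => //; exact: measurable_cst.
apply: measurable_fun_if => //.
- by apply: measurable_fun_lte => //; exact: measurable_cst.
- apply: (measurable_funS mD); first exact: subIsetl.
  by apply: measurable_funB; apply: mpos => // n; exact: measurable_funN.
Qed.

Lemma cmeasurable_csum D (h : int -> R -> C) : measurable D ->
  (forall n, cmeasurable D (h n)) -> cmeasurable D (fun x => csum (fun n => h n x)).
Proof.
move=> mD mh; split => /=.
  by apply: (measurable_real_sum (h := fun n x => complex.Re (h n x))) => // n;
    case: (mh n).
by apply: (measurable_real_sum (h := fun n x => complex.Im (h n x))) => // n;
  case: (mh n).
Qed.

Lemma measurable_l2 D (h : int -> R -> C) : (forall n, cmeasurable D (h n)) ->
  measurable_fun D (fun x => l2 (fun n => h n x)).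
Proof.
move=> mh; apply: measurable_esum => [n x|n]; first by rewrite lee_fin sqr_ge0.
by apply/measurable_EFinP; exact: measurable_sqr_cmod.
Qed.

Lemma measurable_shift D (c : R) (f : R -> R) : measurable D ->
  measurable_fun D f -> measurable_fun [set x | D (x + c)] (fun x => f (x + c)).
Proof.
move=> mD mf; have ms : measurable_fun setT (fun x : R => x + c).
  by apply: measurable_funD => //; exact: measurable_cst.
apply: (measurable_comp mD) => //; first by move=> _ [x Dx <-].
exact: measurable_funTS.
Qed.

Lemma cmeasurable_shift D (c : R) f : measurable D -> cmeasurable D f ->
  cmeasurable [set x | D (x + c)] (fun x => f (x + c)).
Proof.
move=> mD [fr fi]; split.
  exact: (@measurable_shift _ _ (fun x => complex.Re (f x))).
exact: (@measurable_shift _ _ (fun x => complex.Im (f x))).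
Qed.

Lemma int_count_bigcup (T : Type) (E : int -> set T) :
  \bigcup_n E n = \bigcup_(k : nat) (if @choice.unpickle int k is Some n then E
    n else set0).
Proof.
apply/seteqP; split => [x [n _ Enx]|x [k _]].
  by exists (choice.pickle n) => //; rewrite choice.pickleK.
by case: choice.unpickle => // n Enx; exists n.
Qed.

Lemma cmeasurable_bigcup (E : int -> set R) f : (forall n, measurable (E n)) ->
  (forall n, cmeasurable (E n) f) -> cmeasurable (\bigcup_n E n) f.
Proof.
move=> mE mf; rewrite int_count_bigcup.
have mE' (k : nat) : measurable (if @choice.unpickle int k is Some n then E n
  else set0).
  by case: choice.unpickle.
split; apply/measurable_fun_bigcup => // k;
  by case: choice.unpickle => [n|]; [case: (mf n)|exact: measurable_fun_set0].
Qed.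

(** Both measures agree on the intervals []b, d]], which determine Lebesgue measure. *)
Lemma lebesgue_measure_shift (c : R) (A : set R) : measurable A ->
  pushforward mu (fun x => x + c : measurableTypeR R) A = mu A.
Proof.
move=> mA; have ms : measurable_fun setT (fun x : measurableTypeR R =>
  x + c : measurableTypeR R).
  by apply: measurable_funD => //; exact: measurable_cst.
apply/esym/lebesgue_measure_unique => //= _ [[b d]] _ <-.
rewrite /pushforward (_ : _ @^-1` _ = `]b - c, d - c]%classic); last first.
  by apply/seteqP; split => x /=; rewrite !in_itv/= ltrBlDr lerBrDr.
rewrite !lebesgue_measure_itv/= !lte_fin ltrD2r.
by case: ifP => // _; rewrite -!EFinB; congr (_%:E); ring.
Qed.

Lemma ae_shift (c : R) (P : R -> Prop) :
  (\forall x \ae mu, P x) -> \forall x \ae mu, P (x + c).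
Proof.
move=> [N [mN N0 PN]]; exists [set x | N (x + c)]; split.
- rewrite -[X in measurable X]setTI.
  have ms : measurable_fun setT (fun x : R => x + c).
    by apply: measurable_funD => //; exact: measurable_cst.
  exact: ms.
- by rewrite -N0 -[RHS](lebesgue_measure_shift c).
- by move=> x /= Px; exact: PN.
Qed.

#[export] Instance ae_lebesgue_filter : Filter (almost_everywhere mu).
Proof. exact: ae_filter_ringOfSetsType. Qed.

Lemma ae_int (P : int -> R -> Prop) :
  (forall n, \forall x \ae mu, P n x) -> \forall x \ae mu, forall n, P n x.
Proof.
move=> aeP; have : \forall x \ae mu, forall k : nat,
    if @choice.unpickle int k is Some n then P n x else True.
  by apply: ae_foralln => k; case: choice.unpickle => [n|]; [exact: aeP|exact: nearW].
by apply: filterS => x Px n; have := Px (choice.pickle n); rewrite choice.pickleK.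
Qed.

End Measurability.

(** * Essential suprema on [0,a] and fibres *)

Section Interval.
Variables (R : realType) (a : R).
Hypothesis a_gt0 : 0 < a.
Local Notation C := R[i].
Local Notation cmod := (@Normc.normc R).
Local Notation mu := (@lebesgue_measure R).
Local Open Scope complex_scope.
Implicit Types (P Q : R -> Prop) (f g h : R -> C).

(** For [P] an equality of values this is convertible to the relation [aeqv] of [Linf a], so the
    lemmas below apply directly to equalities of coefficients. *)
Definition ae_itv P := \forall x \ae mu, `[0, a]%classic x -> P x.

Let mitv : measurable (`[0, a]%classic : set R). Proof. exact: measurable_itv. Qed.

Lemma ae_itvW P : (forall x, P x) -> ae_itv P.
Proof. by move=> aP; apply: aeW => x _; exact: aP. Qed.

(** The endpoint [a] is negligible. Dropping it reconciles the closed interval of the definitions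
    with [0,a[, on which [Num.floor] computes fibres exactly. *)
Lemma ae_itvS P Q : (forall x, 0 <= x < a -> P x -> Q x) -> ae_itv P -> ae_itv Q.
Proof.
move=> PQ aP; have na : \forall x \ae mu, x <> a.
  exists [set a]; split; [exact: measurable_set1|exact: lebesgue_measure_set1|].
  by move=> x /= /contrapT.
move: aP na; rewrite /ae_itv; apply: filterS2 => x Px xa x0a; apply: PQ (Px x0a).
move: x0a; rewrite /= in_itv/= => /andP[-> xlea] /=.
by rewrite lt_neqAle xlea andbT; apply/eqP.
Qed.

Lemma ae_itvI P Q : ae_itv P -> ae_itv Q -> ae_itv (fun x => P x /\ Q x).
Proof. by rewrite /ae_itv; apply: filterS2 => x Px Qx ?; split; auto. Qed.

Lemma ae_itvS2 P Q S : (forall x, 0 <= x < a -> P x -> Q x -> S x) ->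
  ae_itv P -> ae_itv Q -> ae_itv S.
Proof.
move=> PQS aP aQ; have := ae_itvI aP aQ.
by apply: ae_itvS => x x0a [Px Qx]; exact: PQS.
Qed.

Lemma ae_itvS3 P Q S T : (forall x, 0 <= x < a -> P x -> Q x -> S x -> T x) ->
  ae_itv P -> ae_itv Q -> ae_itv S -> ae_itv T.
Proof.
move=> PQST aP aQ aS; have := ae_itvI aP (ae_itvI aQ aS).
by apply: ae_itvS => x x0a [Px [Qx Sx]]; exact: PQST.
Qed.

Lemma ae_itv_nat (P : nat -> R -> Prop) :
  (forall n, ae_itv (P n)) -> ae_itv (fun x => forall n, P n x).
Proof. by move=> aP; have := ae_foralln aP; rewrite /ae_itv;
  apply: filterS => x Px ? n; exact: Px. Qed.

Lemma ae_itv_int (P : int -> R -> Prop) :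
  (forall n, ae_itv (P n)) -> ae_itv (fun x => forall n, P n x).
Proof. by move=> aP; have := ae_int aP; rewrite /ae_itv;
  apply: filterS => x Px ? n; exact: Px. Qed.

Let mua : (0 < mrestr mu mitv setT)%E.
Proof.
by rewrite /mrestr setTI lebesgue_measure_itv/= lte_fin a_gt0 sube0 lte_fin.
Qed.

(** A set is null for the restricted measure when its trace on [0,a] is null, so an exceptional set
    can be cut down to [0,a] or enlarged by the complement. *)
Lemma ae_mrestrP P : (\forall x \ae mrestr mu mitv, P x) <-> ae_itv P.
Proof.
split=> [[N [mN N0 PN]]|[N [mN N0 PN]]].
  exists (N `&` `[0, a]%classic); split => //; first exact: measurableI.
  by move=> x /= /not_implyP[x0a Px]; split => //; exact: PN.
exists (N `|` ~` `[0, a]%classic); split.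
- by apply: measurableU => //; exact: measurableC.
- rewrite /= /mrestr setIUl setICl setU0; apply/eqP; rewrite -measure_le0 -N0.
  by apply: le_measure; rewrite ?inE//; exact: measurableI.
- move=> x /= Px; have [x0a|nx0a] := pselect (`[0, a]%classic x); last by right.
  by left; apply: PN => /= /(_ x0a).
Qed.

Lemma esssup_le (f : R -> \bar R) y :
  (esssup a f <= y)%E <-> ae_itv (fun x => (f x <= y)%E).
Proof.
rewrite /esssup -ae_mrestrP.
(* The restricted measure depends on a proof that the interval is measurable, and [mitv] is another
   such proof. *)
have -> : measurable_itv `[0, a] = mitv by exact: Prop_irrelevance.
by split => /ess_supP.
Qed.

Lemma esssup_ge0 (f : R -> \bar R) : (forall x, 0 <= f x)%E -> (0 <= esssup a f)%E.
Proof.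
move=> f0; apply: ess_sup_gee; last exact: nearW.
have -> : measurable_itv `[0, a] = mitv by exact: Prop_irrelevance.
exact: mua.
Qed.

Lemma eq_esssup (f g : R -> \bar R) : ae_itv (fun x => f x = g x) ->
  esssup a f = esssup a g.
Proof.
move=> fg; apply/eqP; rewrite eq_le; apply/andP; split; apply/esssup_le.
  have : ae_itv (fun x => (g x <= esssup a g)%E) by exact/esssup_le.
  by move: fg; apply: ae_itvS2 => x _ ->.
have : ae_itv (fun x => (f x <= esssup a f)%E) by exact/esssup_le.
by move: fg; apply: ae_itvS2 => x _ <-.
Qed.

Local Notation A := (Linf a).
Local Notation adomA := (@adom R A).
Local Notation anormA := (@anorm R A).

Lemma anorm_ge0 h : 0 <= anormA h.
Proof. by apply: fine_ge0; apply: esssup_ge0 => x; rewrite lee_fin cmod_ge0. Qed.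

Lemma anorm_le h (M : R) : ae_itv (fun x => cmod (h x) <= M) -> anormA h <= M.
Proof.
move=> hM; have : (esssup a (fun x => (cmod (h x))%:E) <= M%:E)%E.
  by apply/esssup_le; apply: ae_itvS hM => x _; rewrite lee_fin.
have : (0 <= esssup a (fun x => (cmod (h x))%:E))%E.
  by apply: esssup_ge0 => x; rewrite lee_fin cmod_ge0.
by rewrite /anorm/=; case: esssup => [r| |] //=; rewrite lee_fin.
Qed.

(** Membership of [h] matters: [fine] sends an infinite essential supremum to 0. *)
Lemma anorm_ub h : adomA h -> ae_itv (fun x => cmod (h x) <= anormA h).
Proof.
move=> [_ hoo]; have : ae_itv (fun x => ((cmod (h x))%:E <= esssup a (fun x =>
  (cmod (h x))%:E))%E).
  exact/esssup_le.
apply: ae_itvS => x _; rewrite -lee_fin /anorm/= fineK// ge0_fin_numE//.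
by apply: esssup_ge0 => y; rewrite lee_fin cmod_ge0.
Qed.

Lemma adomP h : adomA h <->
  cmeasurable `[0, a] h /\ exists M, ae_itv (fun x => cmod (h x) <= M).
Proof.
split=> [dh|[mh [M hM]]].
  by split; [case: dh|exists (anormA h); exact: anorm_ub].
split => //; apply: (@le_lt_trans _ _ M%:E); last exact: ltry.
by apply/esssup_le; apply: ae_itvS hM => x _; rewrite lee_fin.
Qed.

Lemma eq_anorm h k : @aeqv R A h k -> anormA h = anormA k.
Proof. by move=> hk; rewrite /anorm/=; congr fine; apply: eq_esssup;
  apply: ae_itvS hk => x _ ->. Qed.

Lemma adomD h k : adomA h -> adomA k -> adomA (fun x => h x + k x).
Proof.
move=> /adomP[mh [M hM]] /adomP[mk [N kN]]; apply/adomP; split.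
  exact: cmeasurableD.
exists (M + N); move: hM kN; apply: ae_itvS2 => x _ hM kN.
by apply: le_trans (cmodD _ _) _; rewrite lerD.
Qed.

Lemma adomM h k : adomA h -> adomA k -> adomA (fun x => h x * k x).
Proof.
move=> /adomP[mh [M hM]] /adomP[mk [N kN]]; apply/adomP; split.
  exact: cmeasurableM.
exists (M * N); move: hM kN; apply: ae_itvS2 => x _ hM kN.
by rewrite Normc.normcM ler_pM ?cmod_ge0.
Qed.

Lemma adomJ h : adomA h -> adomA (fun x => (h x)^*).
Proof.
move=> /adomP[mh [M hM]]; apply/adomP; split; first exact: cmeasurableJ.
by exists M; apply: ae_itvS hM => x _; rewrite cmodJ.
Qed.

Lemma adom_cst (c : C) : adomA (fun=> c).
Proof.
by apply/adomP; split; [exact: cmeasurable_cst|exists (cmod c); exact: ae_itvW].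
Qed.

Lemma adomZ (c : C) h : adomA h -> adomA (fun x => c * h x).
Proof. exact/adomM/adom_cst. Qed.

Lemma adom_sum (I : Type) (r : seq I) (h : I -> R -> C) : (forall i, adomA (h i)) ->
  adomA (fun x => \sum_(i <- r) h i x).
Proof.
move=> dh; elim: r => [|i r IH].
  by under eq_fun do rewrite big_nil; exact: adom_cst.
by under eq_fun do rewrite big_cons; exact: adomD.
Qed.

Lemma aeqv_refl h : @aeqv R A h h. Proof. exact: ae_itvW. Qed.

Lemma aeqv_sym h k : @aeqv R A h k -> @aeqv R A k h.
Proof. by apply: ae_itvS => x _ ->. Qed.

Lemma aeqv_trans h k l : @aeqv R A h k -> @aeqv R A k l -> @aeqv R A h l.
Proof. by apply: ae_itvS2 => x _ -> ->. Qed.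

(** Indexed as in [La_terms], in the order opposite to that of [piece]. *)
Definition fib f x : int -> C := fun n => f (x - n%:~R * a).

Lemma floor_shift (x : R) (n : int) : 0 <= x < a ->
  Num.floor ((x - n%:~R * a) / a) = - n.
Proof.
move=> /andP[x0 xa]; apply: floor_def; rewrite mulrBl mulfK ?gt_eqF//.
have : 0 <= x / a by rewrite divr_ge0// ltW.
have : x / a < 1 by rewrite ltr_pdivrMr// mul1r.
by rewrite intrD intrN; lra.
Qed.

Lemma fib_Uadj (b : int -> R -> C) x n : 0 <= x < a ->
  fib (@Uadj R a b) x n = b (- n) x.
Proof.
move=> x0a; rewrite /fib /Uadj floor_shift// /translate intrN mulNr opprK.
by rewrite subrK.
Qed.

Lemma floor_itv (y : R) (n := Num.floor (y / a)) : 0 <= y - n%:~R * a < a.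
Proof.
have := floor_le_tmp (y / a); have := lt_succ_floor (y / a); rewrite -/n.
rewrite ler_pdivlMr// ltr_pdivrMr// intrD mulrDl mul1r => h1 h2.
by apply/andP; split; lra.
Qed.

(** Translation invariance along the countable group of multiples of [a]. For the converse,
    [Num.floor (y / a)] moves any [y] into [0,a[, and [y] lies on the fibre of the point reached. *)
Lemma ae_fib (P : R -> Prop) :
  (\forall y \ae mu, P y) <-> ae_itv (fun x => forall n : int, P (x - n%:~R * a)).
Proof.
split=> aP.
  by apply: ae_itv_int => n; have := ae_shift (- (n%:~R * a)) aP;
    rewrite /ae_itv; apply: filterS.
have : \forall y \ae mu, forall n : int, `[0, a]%classic (y + n%:~R * a) ->
    forall m : int, P (y + n%:~R * a - m%:~R * a).
  apply: ae_int => n.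
  exact: (@ae_shift R _ (fun x => `[0, a]%classic x ->
    forall m : int, P (x - m%:~R * a)) aP).
apply: filterS => y Py; have /andP[y0 ya] := floor_itv y.
have := Py (- Num.floor (y / a)); rewrite intrN mulNr => /(_ _ (- Num.floor (y / a))).
rewrite intrN mulNr opprK subrK; apply.
by rewrite /= in_itv/= y0 ltW.
Qed.

Lemma ae_eq_fib f g :
  (f = g %[ae mu]) <-> ae_itv (fun x => fib f x = fib g x).
Proof.
split=> fg.
  have : \forall y \ae mu, f y = g y by apply: filterS fg => y; exact.
  by move=> /ae_fib; apply: ae_itvS => x _ fgx; apply/funext => n; exact: fgx.
have : \forall y \ae mu, f y = g y.
  by apply/ae_fib; apply: ae_itvS fg => x _ fgx n; have := congr1 (@^~ n) fgx.
by apply: filterS.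
Qed.

Lemma cmeasurable_fib f n : cmeasurable setT f -> cmeasurable setT (fun x => fib f x n).
Proof. exact: (@cmeasurable_shift R setT (- (n%:~R * a)) f measurableT). Qed.

(** The countably many half-open cells [E n] cover the line, and on each of them [Uadj b] is a
    translate of [b n]. *)
Lemma cmeasurable_Uadj (b : int -> R -> C) : (forall n, cmeasurable `[0, a] (b n)) ->
  cmeasurable setT (@Uadj R a b).
Proof.
move=> mb; pose E (n : int) : set R := [set y | `[0, a[%classic (y + - (n%:~R * a))].
have mE n : measurable (E n).
  rewrite -[X in measurable X]setTI.
  have ms : measurable_fun setT (fun x : R => x + - (n%:~R * a)).
    by apply: measurable_funD => //; exact: measurable_cst.
  by apply: ms => //; exact: measurable_itv.
rewrite (_ : setT = \bigcup_n E n); last first.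
  apply/seteqP; split => // y _; exists (Num.floor (y / a)) => //.
  by rewrite /E/= in_itv/=; exact: floor_itv.
apply: cmeasurable_bigcup => // n.
have : cmeasurable (E n) (fun y => b n (y + - (n%:~R * a))).
  apply: cmeasurable_shift; first exact: measurable_itv.
  apply: cmeasurableS (mb n); first exact: measurable_itv.
  by apply: subset_itvl; rewrite bnd_simp.
have eqE (y : R) : y \in E n -> @Uadj R a b y = b n (y + - (n%:~R * a)).
  rewrite inE /E/= in_itv/= => y0a; rewrite /Uadj /translate.
  have := floor_shift (- n) y0a; rewrite intrN mulNr opprK subrK opprK => ->.
  by [].
by move=> [mr mi]; split; [apply: eq_measurable_fun mr|apply: eq_measurable_fun
  mi] => y /eqE ->.
Qed.

(** Periodic extension is [Uadj] of a constant sequence: both reduce the point modulo [a] in the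
    same way. *)
Lemma fib_perext h f x n : 0 <= x < a ->
  fib (fun y => perext a h y * f y) x n = h x * fib f x n.
Proof. by move=> x0a; congr (_ * _); exact: (fib_Uadj (fun=> h)). Qed.

Lemma pieceE f n x : 0 <= x < a -> piece a f n x = fib f x (- n).
Proof.
move=> /andP[x0 xa]; rewrite /piece /translate /fib intrN mulNr indicE mem_set ?mulr1//.
by rewrite /= in_itv/= x0 ltW.
Qed.

Lemma cmeasurable_piece f n : cmeasurable setT f -> cmeasurable `[0, a] (piece a f n).
Proof.
move=> mf; apply: (@cmeasurableS _ _ setT) => //; apply: cmeasurableM.
  have := cmeasurable_fib (- n) mf; rewrite /fib /piece /translate.
  by under eq_fun do rewrite intrN mulNr.
by apply: cmeasurable_real; exact: measurable_indic.
Qed.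

Lemma fib_Uadj_piece f x : 0 <= x < a -> fib (@Uadj R a (piece a f)) x = fib f x.
Proof.
by move=> x0a; apply/funext => n; rewrite fib_Uadj// pieceE// opprK.
Qed.

End Interval.

(** * The module [La a] *)

Section PeriodicModule.
Variables (R : realType) (a : R).
Hypothesis a_gt0 : 0 < a.
Local Notation C := R[i].
Local Notation cmod := (@Normc.normc R).
Local Notation mu := (@lebesgue_measure R).
Local Open Scope complex_scope.
Local Notation A := (Linf a).
Local Notation adomA := (@adom R A).
Local Notation anormA := (@anorm R A).
Local Notation E := (La a).
Local Notation domE := (@mdom R A E).
Local Notation normE := (@mnorm R A E).
Local Notation ipE := (@mip R A E).
Local Notation actE := (@mact R A E).
Local Notation fib := (fib a).
Local Notation ae_itv := (ae_itv a).
Implicit Types (f g k : R -> C) (h : R -> C).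

Lemma fibD f g x : fib ((f : mcar E) + (g : mcar E)) x = fun n => fib f x n + fib g x n.
Proof. by []. Qed.

Lemma fibB f g x : fib ((f : mcar E) - (g : mcar E)) x = fun n => fib f x n - fib g x n.
Proof. by []. Qed.

Lemma fibZ (c : C) f x : fib (c *: (f : mcar E)) x = fun n => c * fib f x n.
Proof. by []. Qed.

Lemma fib_act h f x : 0 <= x < a -> fib (actE h f) x = fun n => h x * fib f x n.
Proof. by move=> x0a; apply/funext => n; exact: fib_perext. Qed.

Lemma ipE_fib f g x : ipE f g x = ip (fib f x) (fib g x).
Proof. by []. Qed.

Lemma La_domP f : domE f <->
  cmeasurable setT f /\ exists M : R, ae_itv (fun x => (l2 (fib f x) <= M%:E)%E).
Proof.
split=> [[mf foo]|[mf [M fM]]]; split => //.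
  exists (fine (La_norm2 a f)); rewrite fineK; first exact/esssup_le.
  by rewrite ge0_fin_numE// esssup_ge0// => x; exact: l2_ge0.
by apply: (@le_lt_trans _ _ M%:E); [exact/esssup_le|exact: ltry].
Qed.

Lemma dom_lty f : domE f -> ae_itv (fun x => (l2 (fib f x) < +oo)%E).
Proof.
move=> /La_domP[_ [M fM]]; apply: ae_itvS fM => x _ /le_lt_trans; apply.
exact: ltry.
Qed.

Lemma cmeasurable_ipE f g : cmeasurable setT f -> cmeasurable setT g ->
  cmeasurable setT (ipE f g).
Proof.
move=> mf mg; apply: (cmeasurable_csum (h := fun n x =>
  fib f x n * (fib g x n)^*)) => // n.
apply: cmeasurableM; first exact: cmeasurable_fib.
exact/cmeasurableJ/cmeasurable_fib.
Qed.

Lemma ipE_self f : domE f ->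
  ae_itv (fun x => ipE f f x = (fine (l2 (fib f x)))%:C).
Proof. by move=> /dom_lty; apply: ae_itvS => x _ /ip_self. Qed.

Lemma normE_ge0 f : 0 <= normE f. Proof. exact: sqrtr_ge0. Qed.

Lemma normE_sqr f : normE f ^+ 2 = anormA (ipE f f).
Proof. by rewrite sqr_sqrtr// anorm_ge0. Qed.

Lemma adom_ipE f g : domE f -> domE g -> adomA (ipE f g).
Proof.
move=> /La_domP[mf [M fM]] /La_domP[mg [N gN]]; apply/(adomP a_gt0); split.
  by apply: cmeasurableS (cmeasurable_ipE mf mg).
exists (Num.sqrt M * Num.sqrt N); move: fM gN; apply: ae_itvS2 => x _ fM gN.
have M0 : 0 <= M by rewrite -lee_fin; apply: le_trans (l2_ge0 _) fM.
have N0 : 0 <= N by rewrite -lee_fin; apply: le_trans (l2_ge0 _) gN.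
by apply: cmod_ip_le; rewrite ?sqrtr_ge0 ?sqr_sqrtr.
Qed.

(** Together with [normE_le], this says that the module norm is the least almost everywhere bound of
    the norms of the fibres; later norm estimates go through this pair. *)
Lemma normE_ub f : domE f -> ae_itv (fun x => (l2 (fib f x) <= (normE f ^+ 2)%:E)%E).
Proof.
move=> df; move: (dom_lty df) (ipE_self df) (anorm_ub a_gt0 (adom_ipE df df)).
apply: ae_itvS3 => x _ foo; rewrite -normE_sqr => ->.
rewrite cmod_real ?fine_ge0 ?l2_ge0// -lee_fin fineK//.
by rewrite ge0_fin_numE ?l2_ge0.
Qed.

Lemma normE_le f (M : R) : 0 <= M ->
  ae_itv (fun x => (l2 (fib f x) <= (M ^+ 2)%:E)%E) -> normE f <= M.
Proof.
move=> M0 fM; rewrite -(@ler_pXn2r _ 2)// ?nnegrE ?normE_ge0// normE_sqr.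
apply: (anorm_le a_gt0); apply: ae_itvS fM => x _ fM.
have foo : (l2 (fib f x) < +oo)%E by apply: le_lt_trans fM _; exact: ltry.
rewrite ipE_fib ip_self// cmod_real ?fine_ge0 ?l2_ge0// -lee_fin fineK//.
by rewrite ge0_fin_numE ?l2_ge0.
Qed.

Lemma normE_La_norm2 f : domE f -> (normE f ^+ 2)%:E = La_norm2 a f.
Proof.
move=> df; apply/eqP; rewrite eq_le; apply/andP; split; last first.
  by apply/esssup_le; exact: normE_ub.
have Lf : La_norm2 a f \is a fin_num.
  rewrite ge0_fin_numE; first by case: df.
  by apply: (esssup_ge0 a_gt0) => x; exact: l2_ge0.
have L0 : 0 <= fine (La_norm2 a f).
  by apply: fine_ge0; apply: (esssup_ge0 a_gt0) => x; exact: l2_ge0.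
rewrite -(fineK Lf) lee_fin -(sqr_sqrtr L0) ler_pXn2r// ?nnegrE ?normE_ge0 ?sqrtr_ge0//.
apply: normE_le; rewrite ?sqrtr_ge0// sqr_sqrtr// fineK//.
exact/esssup_le.
Qed.

Lemma dom_fib_eq f g : cmeasurable setT g ->
  ae_itv (fun x => fib g x = fib f x) -> domE f -> domE g.
Proof.
move=> mg gf /La_domP[_ [M fM]]; apply/La_domP; split => //.
by exists M; move: gf fM; apply: ae_itvS2 => x _ ->.
Qed.

Lemma domD f g : domE f -> domE g -> domE ((f : mcar E) + g).
Proof.
move=> /La_domP[mf [M fM]] /La_domP[mg [N gN]]; apply/La_domP; split.
  exact: cmeasurableD.
exists (2 * M + 2 * N); move: fM gN; apply: ae_itvS2 => x _ fM gN.
rewrite fibD; apply: le_trans (l2D _ _) _.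
rewrite [leRHS](EFinD (2 * M)) (EFinM 2 M) (EFinM 2 N).
by rewrite leeD// lee_wpmul2l.
Qed.

Lemma domZ (c : C) f : domE f -> domE (c *: (f : mcar E)).
Proof.
move=> /La_domP[mf [M fM]]; apply/La_domP; split; first exact: cmeasurableZ.
exists (cmod c ^+ 2 * M); apply: ae_itvS fM => x _ fM.
by rewrite fibZ l2Z (EFinM _ M) lee_wpmul2l// lee_fin sqr_ge0.
Qed.

Lemma domB f g : domE f -> domE g -> domE ((f : mcar E) - g).
Proof. by move=> df dg; rewrite -scaleN1r; apply: domD => //; exact: domZ. Qed.

Lemma dom0 : domE (0 : mcar E).
Proof.
apply/La_domP; split; first exact: cmeasurable_cst.
by exists 0; apply: ae_itvW => x; rewrite (l2_finsupp (F := fset0)) ?big_seq_fset0.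
Qed.

Lemma cmeasurable_perext h : cmeasurable `[0, a] h -> cmeasurable setT (perext a h).
Proof. by move=> mh; apply: (@cmeasurable_Uadj R a a_gt0 (fun=> h)). Qed.

Lemma domA h f : adomA h -> domE f -> domE (actE h f).
Proof.
move=> /(adomP a_gt0)[mh [M hM]] /La_domP[mf [N fN]]; apply/La_domP; split.
  by apply: cmeasurableM => //; exact: cmeasurable_perext.
exists (M ^+ 2 * N); move: hM fN; apply: ae_itvS2 => x x0a hM fN.
rewrite fib_act// l2Z (EFinM _ N); apply: (@le_trans _ _ ((cmod (h x) ^+ 2)%:E
  * N%:E)%E).
  by rewrite lee_wpmul2l// lee_fin sqr_ge0.
rewrite -!EFinM lee_fin ler_wpM2r//.
  by rewrite -lee_fin; apply: le_trans (l2_ge0 _) fN.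
by rewrite ler_pXn2r// nnegrE ?cmod_ge0// (le_trans (cmod_ge0 _) hM).
Qed.

Lemma La_closed : mclosed domE.
Proof. split; [exact: dom0|exact: domD|exact: domZ|exact: domA]. Qed.

Lemma meqvE f g : @meqv R A E f g <-> ae_itv (fun x => fib f x = fib g x).
Proof. exact: ae_eq_fib. Qed.

Lemma La_setoid : msetoid E.
Proof.
split.
- by move=> f _; apply/meqvE; exact: ae_itvW.
- by move=> f g _ _ /meqvE fg; apply/meqvE; apply: ae_itvS fg => x _ ->.
- move=> f g k _ _ _ /meqvE fg /meqvE gk; apply/meqvE.
  by move: fg gk; apply: ae_itvS2 => x _ -> ->.
Qed.

Lemma La_compat : mcompat E.
Proof.
split.
- move=> f f' g g' _ _ _ _ /meqvE ff' /meqvE gg'; apply/meqvE.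
  by move: ff' gg'; apply: ae_itvS2 => x _ ff' gg'; rewrite !fibD ff' gg'.
- move=> c f f' _ _ /meqvE ff'; apply/meqvE.
  by apply: ae_itvS ff' => x _ ff'; rewrite !fibZ ff'.
- move=> h h' f f' _ _ _ _ hh' /meqvE ff'; apply/meqvE.
  by move: hh' ff'; apply: ae_itvS2 => x x0a hh' ff'; rewrite !fib_act// hh' ff'.
- move=> f f' g g' _ _ _ _ /meqvE ff' /meqvE gg'.
  by move: ff' gg'; apply: ae_itvS2 => x _ ff' gg'; rewrite !ipE_fib ff' gg'.
Qed.

(** Periodic extension is precomposition with a fixed map, so it commutes with pointwise operations
    and the axioms hold at every point. *)
Lemma La_action : maction E.
Proof.
split; [|split; [|split; [|split; [|split]]]] => *;
  apply: aeW => x _ /=; rewrite /perext/=.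
- exact: mulrDr.
- exact: mulrDl.
- by rewrite mulrA.
- by rewrite mul1r.
- exact: (esym (mulrA _ _ _)).
- exact: mulrCA.
Qed.

Lemma dom_lty2 f g : domE f -> domE g ->
  ae_itv (fun x => (l2 (fib f x) < +oo)%E /\ (l2 (fib g x) < +oo)%E).
Proof. by move=> df dg; apply: ae_itvI; exact: dom_lty. Qed.

Lemma ipEDl f g k : domE f -> domE g -> domE k ->
  ae_itv (fun x => ipE ((f : mcar E) + g) k x = ipE f k x + ipE g k x).
Proof.
move=> df dg dk; move: (dom_lty2 df dg) (dom_lty dk); apply: ae_itvS2.
by move=> x _ [foo goo] koo; exact: ipDl.
Qed.

Lemma ipEZl (c : C) f g : domE f -> domE g ->
  ae_itv (fun x => ipE (c *: (f : mcar E)) g x = c * ipE f g x).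
Proof.
move=> df dg; apply: ae_itvS (dom_lty2 df dg) => x _ [foo goo]; exact: ipZl.
Qed.

Lemma ipEAl h f g : domE f -> domE g ->
  ae_itv (fun x => ipE (actE h f) g x = h x * ipE f g x).
Proof.
move=> df dg; apply: ae_itvS (dom_lty2 df dg) => x x0a [foo goo].
by rewrite ipE_fib fib_act// ipZl.
Qed.

Lemma ipEC f g : domE f -> domE g -> ae_itv (fun x => ipE g f x = (ipE f g x)^*).
Proof.
by move=> df dg; apply: ae_itvS (dom_lty2 df dg) => x _ [foo goo]; exact: ipC.
Qed.

Lemma La_inner : minner E.
Proof.
split; [|split; [|split; [|split; [|split; [|split]]]]].
- exact: adom_ipE.
- exact: ipEDl.
- exact: ipEZl.
- by move=> h f g _; exact: ipEAl.
- exact: ipEC.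
(* The pointwise square root of [<f, f>] is real valued, hence self-adjoint, and [normE f] bounds
   it. *)
- move=> f df; exists (fun x => (Num.sqrt (complex.Re (ipE f f x)))%:C).
    apply/(adomP a_gt0); split.
      apply: cmeasurable_real; apply: measurable_sqrt.
      by case: (adom_ipE df df) => -[].
    exists (normE f); move: (normE_ub df) (ipE_self df); apply: ae_itvS2 => x _ fx ->.
    rewrite cmod_real ?sqrtr_ge0//= -(@ler_pXn2r _ 2)// ?nnegrE ?normE_ge0 ?sqrtr_ge0//.
    rewrite sqr_sqrtr ?fine_ge0 ?l2_ge0// -lee_fin fineK//.
    by rewrite ge0_fin_numE ?l2_ge0//; apply: le_lt_trans fx _; exact: ltry.
  move: (ipE_self df); apply: ae_itvS => x _ fE; rewrite fE.
  apply/esym; apply: etrans (mulcJ _) _; rewrite fE cmod_real ?sqrtr_ge0//.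
  by rewrite sqr_sqrtr//= fine_ge0// l2_ge0.
(* Finiteness of [l2] almost everywhere matters here, as [fine] also sends [+oo] to 0. *)
- move=> f df f0; apply/meqvE.
  have : ae_itv (fun x => ipE f f x = 0) by exact: f0.
  move: (dom_lty df); apply: ae_itvS2 => x _ foo; rewrite ipE_fib ip_self// => -[l20].
  have l2E : l2 (fib f x) = 0%E.
    by rewrite -[LHS]fineK ?l20// ge0_fin_numE ?l2_ge0.
  by apply/funext => n; rewrite (l2_eq0 n l2E).
Qed.

End PeriodicModule.

(** * Closed submodules of Hilbert modules *)

Section SubmoduleRestriction.
Variables (R : realType) (A : opalg R).

Lemma hilbert_restrict (E : premodule A) (S : set (mcar E)) :
  hilbert_module E -> closed_submodule S -> hilbert_module (@Defs.restrict R A E S).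
Proof.
move=> [[sr ss st] [_ [[cD cZ cA ci] [[a1 [a2 [a3 [a4 [a5 a6]]]]]
  [[i1 [i2 [i3 [i4 [i5 [i6 i7]]]]]] cplt]]]]] [SE clS Slim].
have {}SE x : S x -> mdom x by exact: SE.
split; first by split=> /=; eauto.
split; first exact: clS.
split.
  split=> *; [apply: cD|apply: cZ|apply: cA|apply: ci] => //; exact: SE.
split.
  split; [|split; [|split; [|split; [|split]]]] => *;
    [apply: a1|apply: a2|apply: a3|apply: a4|apply: a5|apply: a6] => //; exact: SE.
split.
  split; [|split; [|split; [|split; [|split; [|split]]]]] => *;
    [apply: i1|apply: i2|apply: i3|apply: i4|apply: i5|apply: i6|apply: i7] =>
      //; exact: SE.
move=> u Su /(cplt _ (fun n => SE _ (Su n)))[x Ex ux].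
by exists x => //; exact: Slim Ex ux.
Qed.

End SubmoduleRestriction.

(** * Completeness of [La a] and a criterion for norm convergence *)

Section Completeness.
Variables (R : realType) (a : R).
Hypothesis a_gt0 : 0 < a.
Local Notation C := R[i].
Local Notation cmod := (@Normc.normc R).
Local Open Scope complex_scope.
Local Notation A := (Linf a).
Local Notation adomA := (@adom R A).
Local Notation anormA := (@anorm R A).
Local Notation E := (La a).
Local Notation domE := (@mdom R A E).
Local Notation normE := (@mnorm R A E).
Local Notation ipE := (@mip R A E).
Local Notation actE := (@mact R A E).
Local Notation fib := (fib a).
Local Notation ae_itv := (ae_itv a).
Implicit Types (f g k : R -> C) (h : R -> C).

(** The limit is named as an upper limit so that, applied at every point, it defines a measurable
    function even where the sequence fails to be Cauchy. *)
Lemma cauchy_cvg_limn_esup (v : nat -> R) :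
  (forall e, 0 < e -> exists N, forall m n, (N <= m)%N -> (N <= n)%N ->
    `|v m - v n| <= e) ->
  v @ \oo --> fine (limn_esup (fun n => (v n)%:E)).
Proof.
move=> cv; have : cvgn v.
  apply: cauchy_cvg; apply/cauchyP => e e0.
  have [|N Nv] := cv (e / 2); first by rewrite divr_gt0.
  exists (v N); exists N => // n /= Nn; rewrite /ball/=.
  by apply: le_lt_trans (Nv _ _ _ _) _ => //; rewrite gtr_pMr// invf_lt1// ltr1n.
move=> /cvg_ex[l vl]; have : (fun n => (v n)%:E) @ \oo --> l%:E by apply:
  cvg_EFin => //; exact: nearW.
by move=> /cvg_limn_einf_sup[_ ->].
Qed.

(** Finite sums pass to the coordinatewise limit; the supremum over finite sets is taken
    afterwards. *)
Lemma l2_lim (v : nat -> int -> C) (w : int -> C) (M : R) :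
  (forall n, (fun i => complex.Re (v i n)) @ \oo --> complex.Re (w n)) ->
  (forall n, (fun i => complex.Im (v i n)) @ \oo --> complex.Im (w n)) ->
  (\forall i \near \oo, (l2 (v i) <= M%:E)%E) -> (l2 w <= M%:E)%E.
Proof.
move=> vr vi vM; apply: esum_le_ub => F; rewrite sumEFin lee_fin.
have cv : (fun i => \sum_(n <- F) cmod (v i n) ^+ 2) @ \oo --> \sum_(n <- F)
  cmod (w n) ^+ 2.
  elim: (enum_fset F) => [|n s IH].
    by rewrite big_nil; under eq_fun do rewrite big_nil; exact: cvg_cst.
  rewrite big_cons; under eq_fun do rewrite big_cons; apply: cvgD => //.
  rewrite sqr_cmod; under eq_fun do rewrite sqr_cmod.
  by apply: cvgD; apply: cvgM.
rewrite -(cvg_lim _ cv)//; apply: limr_le; first by apply/cvg_ex; eexists; exact: cv.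
apply: filterS vM => i vM; rewrite -lee_fin -sumEFin; apply: le_trans vM.
by apply: fsum_le_esum => n; rewrite lee_fin sqr_ge0.
Qed.

(** On the fibres where the countably many bounds of [uub] hold, every coordinate is Cauchy, and the
    Cauchy bound passes to the limit in its second index. Membership of the limit [f] follows from
    that of [u N] and of [u N - f]. *)
Lemma La_complete : mcomplete E.
Proof.
move=> u du cu.
pose dif m n : mcar E := u m - u n.
have duB m n : domE (dif m n) by exact: domB.
pose f y := fine (limn_esup (fun n => (complex.Re (u n y))%:E)) +i*
            fine (limn_esup (fun n => (complex.Im (u n y))%:E)).
have mf : cmeasurable setT f.
  split => /=; apply: (measurableT_comp (fine_measurable measurableT));
    apply: measurable_fun_limn_esup => n; apply/measurable_EFinP;
    by case: (du n) => -[].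
have uub : ae_itv (fun x => forall m n,
    (l2 (fib (dif m n) x) <= (normE (dif m n) ^+ 2)%:E)%E).
  by apply: ae_itv_nat => m; apply: ae_itv_nat => n; exact: normE_ub.
have limf x : (forall m n,
    (l2 (fib (dif m n) x) <= (normE (dif m n) ^+ 2)%:E)%E) ->
    forall k : int,
      ((fun n => complex.Re (fib (u n) x k)) @ \oo --> complex.Re (fib f x k)) /\
      ((fun n => complex.Im (fib (u n) x k)) @ \oo --> complex.Im (fib f x k)).
  move=> ux k.
  have cx m n : cmod (fib (u m) x k - fib (u n) x k) <= normE (dif m n).
    rewrite -(@ler_pXn2r _ 2)// ?nnegrE ?cmod_ge0 ?normE_ge0// -lee_fin.
    by apply: le_trans (ux m n); exact: (l2_coord (fib (dif m n) x)).
  split; apply: cauchy_cvg_limn_esup => e e0; have [N uN] := cu _ e0;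
      exists N => m n Nm Nn; apply: le_trans (ltW (uN _ _ Nm Nn));
      apply: le_trans (cx m n).
    by apply: le_trans (Re_le_cmod _); rewrite cReB.
  by apply: le_trans (Im_le_cmod _); rewrite cImB.
pose difl n : mcar E := (u n : mcar E) - f.
have uf e : 0 < e -> exists N, forall n, (N <= n)%N ->
    ae_itv (fun x => (l2 (fib (difl n) x) <= (e ^+ 2)%:E)%E).
  move=> e0; have [N uN] := cu _ e0; exists N => n Nn.
  apply: ae_itvS uub => x _ ux.
  apply: (@l2_lim (fun i => fib (dif n i) x)).
  - move=> k; have [fr _] := limf _ ux k; rewrite [fib _ x]fibB cReB.
    under eq_fun do rewrite [fib _ x]fibB cReB.
    by apply: cvgB => //; exact: cvg_cst.
  - move=> k; have [_ fi] := limf _ ux k; rewrite [fib _ x]fibB cImB.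
    under eq_fun do rewrite [fib _ x]fibB cImB.
    by apply: cvgB => //; exact: cvg_cst.
  - exists N => // i /= Ni; apply: le_trans (ux n i) _; rewrite lee_fin.
    by rewrite ler_pXn2r// ?nnegrE ?normE_ge0 ?ltW// uN.
have df : domE f.
  have [N /(_ N (leqnn N)) fN] := uf _ ltr01.
  have dfN : domE ((u N : mcar E) - f).
    apply/(La_domP a_gt0); split; last by exists (1 ^+ 2).
    have /(La_domP a_gt0)[mu _] := du N.
    by apply: cmeasurableD => //; rewrite -[- _]scaleN1r; exact: cmeasurableZ.
  have -> : (f : mcar E) = (u N : mcar E) - ((u N : mcar E) - f) by rewrite subKr.
  exact: domB.
exists f => //; apply/cvgrPdist_le => e e0; have [N Ne] := uf _ e0.
exists N => // n /= Nn; rewrite sub0r normrN ger0_norm ?normE_ge0//.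
by apply: (normE_le a_gt0) (Ne _ Nn); exact: ltW.
Qed.

Lemma La_hilbert : hilbert_module E.
Proof.
split; [exact: La_setoid|split; [exact: La_closed|split]]; first exact: La_compat.
split; [exact: La_action|split]; [exact: La_inner|exact: La_complete].
Qed.

(** Convergence in the norm of [Linf a] is convergence uniform off a null set, so for nonnegative
    terms it amounts to tails that are small uniformly in the point. The converse takes
    [fine (l2 _)] as the sum, the errors being the tails. *)
Lemma norm_sum_sqrP (b : int -> R -> C) : (forall n, cmeasurable `[0, a] (b n)) ->
  (exists s, @norm_sum R A (fun n x => (cmod (b n x) ^+ 2)%:C) s) <->
  (exists M : R, ae_itv (fun x => (l2 (b^~ x) <= M%:E)%E)) /\
  (forall e, 0 < e -> exists F,
     ae_itv (fun x => (l2 (outside 0%R F (b^~ x)) <= e%:E)%E)).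
Proof.
move=> mb.
have psE F x : (summability.partial_sum (fun n x =>
  (cmod (b n x) ^+ 2)%:C : C^o) F : R -> C^o) x =
    (\sum_(n <- F) cmod (b n x) ^+ 2)%:C.
  rewrite partial_sumE fct_sumE/=.
  by rewrite (rmorph_sum (real_complex R)).
have FF : ProperFilter (@summability.totally int) := summability.totally_filter.
split=> [[s [db ds bs]]|[[M bM] btail]].
- have key e : 0 < e -> exists F, ae_itv (fun x =>
      (l2 (outside 0%R F (b^~ x)) <= e%:E)%E /\
      cmod ((\sum_(n <- F) cmod (b n x) ^+ 2)%:C - s x) <= e).
    move=> e0; have e20 : 0 < e / 2 by rewrite divr_gt0.
    move/cvgrPdist_le : bs => /(_ _ e20)[F _ /= Fe].
    have Fae G : (F `<=` G)%fset ->
        ae_itv (fun x => cmod ((\sum_(n <- G) cmod (b n x) ^+ 2)%:C - s x) <= e / 2).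
      move=> FG; have := Fe _ FG; rewrite sub0r normrN ger0_norm ?anorm_ge0// => sGe.
      have dG : adomA ((summability.partial_sum (fun n x =>
        (cmod (b n x) ^+ 2)%:C : C^o) G : acar A) - s).
        rewrite partial_sumE; apply: (adomD a_gt0); last first.
          by rewrite -scaleN1r; exact: (adomZ a_gt0).
        have -> : (\sum_(n <- G) (fun x => (cmod (b n x) ^+ 2)%:C : C^o))%R =
            fun x => \sum_(n <- G) (cmod (b n x) ^+ 2)%:C by apply/funext => x;
              rewrite fct_sumE.
        exact: (adom_sum a_gt0).
      have := anorm_ub a_gt0 dG; apply: ae_itvS => x _ /le_trans-/(_ _ sGe).
      by rewrite -psE.
    (* Only the unions of [F] with boxes are used, so that a single null set is removed; they
       eventually contain any finite set. *)
    exists F; have := ae_itv_nat (fun N => Fae (F `|` box N)%fset (fsubsetUl _ _)).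
    move: (Fae _ (fsubset_refl F)); apply: ae_itvS2 => x _ h1 hN.
    split; last by apply: le_trans h1 _; rewrite ler_piMr ?invf_le1 ?ler1n// ltW.
    apply: esum_le_ub => G.
    have [N /(_ N (leqnn N)) /fsubsetP GN] := sub_box_ex G.
    (* Both partial sums are within [e / 2] of [s x], so the increment is at most [e]; it dominates
       the sum of the terms of [G] outside [F]. *)
    have : \sum_(n <- (F `|` box N)%fset) cmod (b n x) ^+ 2 - \sum_(n <- F)
      cmod (b n x) ^+ 2 <= e.
      apply: le_trans (ler_norm _) _.
      have := le_trans (cmodB_le _ _ (s x)) (lerD (hN N) _).
      move=> /(_ (\sum_(n <- F) cmod (b n x) ^+ 2)%:C (e / 2)).
      rewrite cmodBC in h1; move=> /(_ h1); rewrite -splitr -(rmorphB (real_complex R)).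
      by rewrite cmod_realE.
    rewrite -lee_fin; apply: le_trans; rewrite sumEFin lee_fin.
    rewrite (bigID (fun n => n \in F))/= big1 ?add0r; last first.
      by move=> n nF; rewrite /outside nF cmod0 expr0n.
    rewrite lerBrDl.
    rewrite [leLHS](_ : _ = \sum_(n <- (F `|` [fset n in G | n \notin F])%fset)
      cmod (b n x) ^+ 2).
      apply: ler_sum_fset => [n|]; first exact: sqr_ge0.
      apply/fsubsetP => n /fsetUP[nF|nG]; apply/fsetUP; [by left|right].
      by apply: GN; move: nG; rewrite !inE => /andP[].
    rewrite [X in _ + X = _](eq_bigr (fun n => cmod (b n x) ^+ 2)); last first.
      by move=> n nF; rewrite /outside (negbTE nF).
    rewrite [X in _ + X = _]big_fset_condE -big_cat; apply: perm_big;
      rewrite perm_sym; apply: uniq_perm; rewrite ?fset_uniq//.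
      rewrite cat_uniq !fset_uniq andbT/=; apply/hasPn => i.
      by rewrite !inE /= => /andP[].
    by move=> i; rewrite mem_cat inE.
  split; last by move=> e /key[F Fe]; exists F; apply: ae_itvS Fe => x _ [].
  have [F Fe] := key _ ltr01.
  (* [M] bounds [s], one unit accounts for the distance from [s] to the sum over [F], the other for
     the tail. *)
  have /(adomP a_gt0)[_ [M sM]] := ds; exists (M + 1 + 1).
  move: Fe sM; apply: ae_itvS2 => x _ [h1 h2] sM.
  rewrite (l2_outside _ F) [leRHS](EFinD (M + 1)); apply: leeD => //.
  rewrite lee_fin; apply: le_trans (ler_norm _) _.
  rewrite -cmod_realE -[X in cmod X](subrK (s x)); apply: le_trans (cmodD _ _) _.
  by rewrite addrC lerD.
- have dterm n : adomA (fun x => (cmod (b n x) ^+ 2)%:C).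
    apply/(adomP a_gt0); split; first by apply: cmeasurable_real;
      exact: measurable_sqr_cmod.
    exists M; apply: ae_itvS bM => x _ bM.
    rewrite cmod_real ?sqr_ge0// -lee_fin; apply: le_trans bM.
    exact: (l2_coord (b^~ x)).
  exists (fun x => (fine (l2 (b^~ x)))%:C); split => //.
    apply/(adomP a_gt0); split.
      apply: cmeasurable_real; apply: (measurableT_comp (fine_measurable measurableT)).
      exact: measurable_l2.
    exists M; apply: ae_itvS bM => x _ bM.
    rewrite cmod_real ?fine_ge0 ?l2_ge0// -lee_fin fineK//.
    by rewrite ge0_fin_numE ?l2_ge0//; apply: le_lt_trans bM _; exact: ltry.
  apply/cvgrPdist_le => e e0; have [F Fe] := btail _ e0.
  apply: (totally_sub (F := F)) => G FG; rewrite sub0r normrN ger0_norm ?anorm_ge0//.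
  apply: (anorm_le a_gt0); move: Fe bM; apply: ae_itvS2 => x _ Fe bM.
  rewrite -[X in cmod X]/((summability.partial_sum (fun n x =>
    (cmod (b n x) ^+ 2)%:C : C^o) G : R -> C^o) x - (fine (l2 (b^~ x)))%:C).
  rewrite psE cmodBC -(rmorphB (real_complex R)).
  have l2fin : l2 (outside 0 G (b^~ x)) \is a fin_num.
    rewrite ge0_fin_numE ?l2_ge0//; apply: le_lt_trans (l2_outside_le _ FG) _.
    by apply: le_lt_trans Fe _; exact: ltry.
  rewrite (l2_outside _ G) fineD// addrAC subrr add0r cmod_real ?fine_ge0 ?l2_ge0//.
  by rewrite -lee_fin fineK//; apply: le_trans (l2_outside_le _ FG) Fe.
Qed.

End Completeness.

(** * Norm convergent sums and the submodule [Xa a] *)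

Section SequenceModules.
Variables (R : realType) (a : R).
Hypothesis a_gt0 : 0 < a.
Local Notation C := R[i].
Local Notation cmod := (@Normc.normc R).
Local Open Scope complex_scope.
Local Notation A := (Linf a).
Local Notation adomA := (@adom R A).
Local Notation anormA := (@anorm R A).
Local Notation E := (La a).
Local Notation domE := (@mdom R A E).
Local Notation normE := (@mnorm R A E).
Local Notation actE := (@mact R A E).
Local Notation fib := (fib a).
Local Notation ae_itv := (ae_itv a).
Implicit Types (f g k : R -> C) (h : R -> C) (b u v : int -> R -> C).

(** The finite set is chosen before the point. This uniformity is what separates [Xa a] from [La a],
    where tails vanish only pointwise almost everywhere. *)
Definition tail_small (v : R -> int -> C) := forall e, 0 < e ->
  exists F, ae_itv (fun x => (l2 (outside 0%R F (v x)) <= e%:E)%E).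

Lemma l2_outsideN (w : int -> C) F :
  l2 (outside 0 F (fun n => w (- n))) = l2 (outside 0 [fset (- n)%R | n in F]%fset w).
Proof.
rewrite -l2N; congr l2; apply/funext => n; rewrite /outside opprK.
congr (if _ then _ else _); apply/idP/imfsetP => [nF|[m mF ->]].
  by exists (- n); rewrite ?opprK.
by rewrite opprK.
Qed.

Lemma tail_smallN (v : R -> int -> C) :
  tail_small v -> tail_small (fun x n => v x (- n)).
Proof.
move=> tv e /tv[F Fe]; exists [fset (- n)%R | n in F]%fset.
apply: ae_itvS Fe => x _; rewrite l2_outsideN.
suff -> : [fset (- n)%R | n in [fset (- n)%R | n in F]]%fset = F by [].
apply/fsetP => n; apply/imfsetP/idP => [[m /imfsetP[k kF ->] ->]|nF].
  by rewrite opprK.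
by exists (- n); rewrite ?opprK//; apply/imfsetP; exists n.
Qed.

Lemma eq_tail_small (v w : R -> int -> C) :
  ae_itv (fun x => v x = w x) -> tail_small v -> tail_small w.
Proof.
move=> vw tv e /tv[F Fe]; exists F; move: vw Fe.
by apply: ae_itvS2 => x _ ->.
Qed.

(** The common source of the stability of small tails under sums and multiples: each of the two
    tails is allowed half of [e / M]. *)
Lemma tail_small_dominated (v v1 v2 : R -> int -> C) (M : R) : 0 < M ->
  ae_itv (fun x => forall F, (l2 (outside 0%R F (v x)) <=
    M%:E * (l2 (outside 0%R F (v1 x)) + l2 (outside 0%R F (v2 x))))%E) ->
  tail_small v1 -> tail_small v2 -> tail_small v.
Proof.
move=> M0 vM t1 t2 e e0.
have e' : 0 < e / M / 2 by rewrite !divr_gt0.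
have [F1 h1] := t1 _ e'; have [F2 h2] := t2 _ e'.
exists (F1 `|` F2)%fset; move: vM h1 h2; apply: ae_itvS3 => x _ vM h1 h2.
apply: le_trans (vM _) _; rewrite -lee_pdivlMl// -EFinM mulrC [X in X%:E]splitr EFinD.
apply: leeD.
  exact: le_trans (l2_outside_le _ (fsubsetUl _ _)) h1.
exact: le_trans (l2_outside_le _ (fsubsetUr _ _)) h2.
Qed.

(** The terms in the definition of [Xa] are squared moduli of pieces, that is, of the fibre read
    backwards; square sums and small tails are insensitive to the reversal. *)
Lemma XaP f : @Xa R a f <-> domE f /\ tail_small (fib f).
Proof.
have pE : ae_itv (fun x => (fun n => piece a f n x) = (fun n => fib f x (- n))).
  apply: (@ae_itvS R a (fun=> True)) => [x x0a _|]; last exact: ae_itvW.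
  by apply/funext => n; rewrite pieceE.
split=> [[mf]|[/(La_domP a_gt0)[mf [M fM]] tf]].
  move=> /(norm_sum_sqrP a_gt0 (fun n => cmeasurable_piece a n mf))[[M fM] tf].
  split.
    apply/(La_domP a_gt0); split => //; exists M; move: pE fM;
      apply: ae_itvS2 => x _ ->.
    by rewrite l2N.
  apply: (@eq_tail_small (fun x n => piece a f (- n) x)).
    apply: ae_itvS pE => x _ px; apply/funext => n.
    by have := congr1 (@^~ (- n)) px; rewrite opprK.
  exact: (@tail_smallN (fun x n => piece a f n x)).
split => //; apply/(norm_sum_sqrP a_gt0 (fun n => cmeasurable_piece a n mf)); split.
  by exists M; move: pE fM; apply: ae_itvS2 => x _ ->; rewrite l2N.
apply: (@eq_tail_small (fun x n => fib f x (- n))).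
  by apply: ae_itvS pE => x _ ->.
exact: tail_smallN.
Qed.

Lemma outsideD (v w : int -> C) F :
  outside 0 F (fun n => v n + w n) = fun n => outside 0 F v n + outside 0 F w n.
Proof. by apply/funext => n; rewrite /outside; case: ifP; rewrite ?addr0. Qed.

Lemma outsideZ (c : C) (v : int -> C) F :
  outside 0 F (fun n => c * v n) = fun n => c * outside 0 F v n.
Proof. by apply/funext => n; rewrite /outside; case: ifP; rewrite ?mulr0. Qed.

Lemma l2_outsideD (v w : int -> C) F :
  (l2 (outside 0%R F (fun n => v n + w n)%R) <=
   2%:E * (l2 (outside 0%R F v) + l2 (outside 0%R F w)))%E.
Proof. by rewrite outsideD; apply: le_trans (l2D _ _) _;
  rewrite ge0_muleDr ?l2_ge0. Qed.

Lemma tail_smallD (v w : R -> int -> C) : tail_small v -> tail_small w ->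
  tail_small (fun x n => v x n + w x n).
Proof.
apply: (@tail_small_dominated _ _ _ 2) => //; apply: ae_itvW => x F.
exact: l2_outsideD.
Qed.

Lemma tail_smallM h (v : R -> int -> C) : adomA h -> tail_small v ->
  tail_small (fun x n => h x * v x n).
Proof.
move=> /(adomP a_gt0)[_ [M hM]] tv.
apply: (@tail_small_dominated _ v v (M ^+ 2 + 1)) => //.
  by rewrite ltr_wpDl ?sqr_ge0.
apply: ae_itvS hM => x _ hM F; rewrite outsideZ l2Z.
apply: lee_pmul; rewrite ?lee_fin ?sqr_ge0 ?l2_ge0//.
  have : cmod (h x) ^+ 2 <= M ^+ 2.
    by rewrite ler_pXn2r// nnegrE ?cmod_ge0// (le_trans (cmod_ge0 _) hM).
  by move=> /le_trans; apply; rewrite lerDl.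
by rewrite leeDl ?l2_ge0.
Qed.

Lemma tail_small0 : tail_small (fun=> fun=> 0).
Proof.
move=> e e0; exists fset0; apply: ae_itvW => x.
rewrite (l2_finsupp (F := fset0)) ?big_seq_fset0 ?lee_fin ?ltW//.
Qed.

Lemma Xa_closed_submodule : closed_submodule (@Xa R a).
Proof.
split.
- by move=> f /XaP[].
- split.
  + apply/XaP; split; first exact: dom0.
    exact: tail_small0.
  + move=> f g /XaP[df tf] /XaP[dg tg]; apply/XaP; split; first exact: domD.
    exact: tail_smallD.
  + move=> c f /XaP[df tf]; apply/XaP; split; first exact: domZ.
    by apply: (@tail_smallM (fun=> c)) => //; exact: adom_cst.
  + move=> h f dh /XaP[df tf]; apply/XaP; split; first exact: domA.
    apply: (@eq_tail_small (fun x n => h x * fib f x n)).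
      apply: (@ae_itvS R a (fun=> True)) => [x x0a _|]; last exact: ae_itvW.
      by rewrite fib_act.
    exact: tail_smallM.
- move=> u f Xu df /cvgrPdist_le uf; apply/XaP; split => // e e0.
  (* The tail of [f] is at most [2 * (e / 4 + e / 4)]: one term for the tail of [u N], one for the
     squared norm of [u N - f], whence the square root. *)
  have [N _ /(_ N (leqnn N))] := uf (Num.sqrt (e / 4)) ltac:(by rewrite
    sqrtr_gt0 divr_gt0).
  rewrite sub0r normrN ger0_norm ?normE_ge0// => ufN.
  have /XaP[du tu] := Xu N; have [|F Fe] := tu (e / 4); first by rewrite divr_gt0.
  have duf : domE ((u N : mcar E) - f) by exact: domB.
  exists F; move: Fe (normE_ub a_gt0 duf); apply: ae_itvS2 => x _ Fe ufx.
  have -> : fib f x = fun n => fib (u N) x n + -1 * fib ((u N : mcar E) - f) x n.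
    by apply/funext => n; rewrite mulN1r fibB opprB addrC subrK.
  apply: le_trans (l2_outsideD _ _ _) _; rewrite outsideZ l2Z.
  rewrite (_ : cmod (-1) ^+ 2 = 1) ?mul1e; last first.
    by rewrite cmodN Normc.normc1 expr1n.
  apply: (@le_trans _ _ (2%:E * ((e / 4)%:E + (e / 4)%:E))%E).
    rewrite lee_wpmul2l//; apply: leeD => //.
    apply: le_trans (_ : l2 (fib ((u N : mcar E) - f)%R x) <= _)%E.
      by apply: l2_le => n; rewrite /outside; case: ifP; rewrite ?cmod0 ?cmod_ge0.
    apply: le_trans ufx _; rewrite lee_fin.
    have e40 : 0 <= e / 4 by rewrite divr_ge0// ltW.
    by rewrite -[leRHS]sqr_sqrtr// ler_pXn2r// nnegrE ?sqrtr_ge0 ?normE_ge0.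
  rewrite -EFinD -EFinM lee_fin; lra.
Qed.

Local Notation S2s := (ell2s A).
Local Notation S2 := (ell2 A).

Lemma gram_self b : gram (A := A) b b = fun n x => (cmod (b n x) ^+ 2)%:C.
Proof. by apply/funext => n; apply/funext => x; exact: mulcJ. Qed.

Lemma adom_sqr_cmod h : adomA h -> adomA (fun x => (cmod (h x) ^+ 2)%:C).
Proof.
move=> dh; have -> : (fun x => (cmod (h x) ^+ 2)%:C) = fun x => h x * (h x)^*.
  by apply/funext => x; rewrite mulcJ.
by apply: (adomM a_gt0) => //; exact: adomJ.
Qed.

(** Each bound on a symmetric partial sum holds off a null set depending on [N]; the union of these
    is null, and the boxes are cofinal. *)
Lemma ell2s_domP b : @mdom R A S2s b <-> (forall n, cmeasurable `[0, a] (b n)) /\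
  exists M : R, ae_itv (fun x => (l2 (b^~ x) <= M%:E)%E).
Proof.
have sumE (N : nat) : \sum_(k < N.*2.+1) (gram (A := A) b b) (k%:Z - N%:Z) =
    fun x => (\sum_(n <- box N) cmod (b n x) ^+ 2)%:C.
  rewrite (sum_box (gram (A := A) b b)) gram_self; apply/funext => x.
  by rewrite fct_sumE (rmorph_sum (real_complex R)).
split=> [[db [M bM]]|[mb [M bM]]].
  split=> [n|]; first by have /(adomP a_gt0)[] := db n.
  have : ae_itv (fun x => forall N, \sum_(n <- box N) cmod (b n x) ^+ 2 <= M).
    apply: ae_itv_nat => N; have := bM N; rewrite sumE => NM.
    have dN : adomA (fun x => (\sum_(n <- box N) cmod (b n x) ^+ 2)%:C).
      under eq_fun do rewrite (rmorph_sum (real_complex R)).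
      by apply: (adom_sum a_gt0) => n; exact: adom_sqr_cmod.
    have := anorm_ub a_gt0 dN; apply: ae_itvS => x _ h; apply: le_trans (le_trans h NM).
    by rewrite cmod_realE ler_norm.
  move=> bN; exists M; apply: ae_itvS bN => x _ bN; apply: esum_le_ub => F.
  have [N /(_ N (leqnn N)) FN] := sub_box_ex F.
  rewrite sumEFin lee_fin; apply: le_trans (bN N).
  by apply: ler_sum_fset => // n; exact: sqr_ge0.
have db n : adomA (b n).
  apply/(adomP a_gt0); split => //; exists (Num.sqrt M); apply: ae_itvS bM => x _ bM.
  have M0 : 0 <= M by rewrite -lee_fin; apply: le_trans (l2_ge0 _) bM.
  rewrite -(@ler_pXn2r _ 2)// ?nnegrE ?cmod_ge0 ?sqrtr_ge0// sqr_sqrtr// -lee_fin.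
  by apply: le_trans bM; exact: (l2_coord (b^~ x)).
split => //; exists M => N; rewrite sumE; apply: (anorm_le a_gt0).
apply: ae_itvS bM => x _ bM; rewrite cmod_real ?sumr_ge0// => [|n _];
  last exact: sqr_ge0.
rewrite -lee_fin; apply: le_trans bM; rewrite -sumEFin.
by apply: fsum_le_esum => n; rewrite lee_fin sqr_ge0.
Qed.

Lemma ell2_domP b : @mdom R A S2 b <-> @mdom R A S2s b /\ tail_small (fun x n => b n x).
Proof.
split=> [[db]|[/[dup] db /ell2s_domP[mb [M bM]] tb]].
  rewrite gram_self; have mb n : cmeasurable `[0, a] (b n) by have /(adomP
    a_gt0)[] := db n.
  by move=> /(norm_sum_sqrP a_gt0 mb)[bM tb]; split => //; apply/ell2s_domP.
split; first by case: db.
by rewrite gram_self; apply/(norm_sum_sqrP a_gt0 mb); split => //; exists M.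
Qed.

Lemma ell2s_lty b : @mdom R A S2s b -> ae_itv (fun x => (l2 (b^~ x) < +oo)%E).
Proof.
by move=> /ell2s_domP[_ [M bM]]; apply: ae_itvS bM => x _ /le_lt_trans; apply;
  exact: ltry.
Qed.

Lemma ip_outside (v w : int -> C) (F : {fset int}) : (l2 v < +oo)%E -> (l2 w < +oo)%E ->
  ip v w - \sum_(n <- F) v n * (w n)^* = ip (outside 0 F v) (outside 0 F w).
Proof.
move=> voo woo; rewrite /ip (csum_outside F (ip_csummable voo woo)) addrAC subrr add0r.
by congr csum; apply/funext => n; rewrite /outside; case: ifP; rewrite ?mul0r.
Qed.

Lemma partial_gram u v (F : {fset int}) x :
  (summability.partial_sum (gram (A := A) u v) F : R -> C^o) x =
  \sum_(n <- F) u n x * (v n x)^*.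
Proof. by rewrite partial_sumE fct_sumE. Qed.

Lemma adom_ip u v : @mdom R A S2s u -> @mdom R A S2s v ->
  adomA (fun x => ip (u^~ x) (v^~ x)).
Proof.
move=> /ell2s_domP[mu [M uM]] /ell2s_domP[mv [N vN]]; apply/(adomP a_gt0); split.
  apply: (cmeasurable_csum (h := fun n x => u n x * (v n x)^*)) => // n.
  by apply: cmeasurableM => //; exact: cmeasurableJ.
exists (Num.sqrt M * Num.sqrt N); move: uM vN; apply: ae_itvS2 => x _ uM vN.
have M0 : 0 <= M by rewrite -lee_fin; apply: le_trans (l2_ge0 _) uM.
have N0 : 0 <= N by rewrite -lee_fin; apply: le_trans (l2_ge0 _) vN.
by apply: cmod_ip_le; rewrite ?sqrtr_ge0 ?sqr_sqrtr.
Qed.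

Lemma adom_gram u v n : adomA (u n) -> adomA (v n) -> adomA (gram (A := A) u v n).
Proof. by move=> du dv; apply: (adomM a_gt0) => //; exact: adomJ. Qed.

(** The remainder after a finite set is the inner product of the two tails, at most
    [sqrt e * sqrt e] by Cauchy-Schwarz. *)
Lemma norm_sum_ip u v : @mdom R A S2 u -> @mdom R A S2 v ->
  norm_sum (gram (A := A) u v) (fun x => ip (u^~ x) (v^~ x)).
Proof.
move=> /ell2_domP[du tu] /ell2_domP[dv tv]; split.
- by move=> n; apply: adom_gram; [case: du|case: dv].
- exact: adom_ip.
- have FF : ProperFilter (@summability.totally int) := summability.totally_filter.
  apply/cvgrPdist_le => e e0; have [F1 h1] := tu _ e0; have [F2 h2] := tv _ e0.
  apply: (totally_sub (F := (F1 `|` F2)%fset)) => G.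
  rewrite fsubUset => /andP[FG1 FG2]; rewrite sub0r normrN ger0_norm ?anorm_ge0//.
  apply: (anorm_le a_gt0).
  move: (ae_itvI (ell2s_lty du) (ell2s_lty dv)) h1 h2;
    apply: ae_itvS3 => x _ [uoo voo] h1 h2.
  rewrite -[X in cmod X]/((summability.partial_sum (gram (A := A) u v) G : R ->
    C^o) x - ip (u^~ x) (v^~ x)).
  rewrite partial_gram cmodBC ip_outside//.
  rewrite -[leRHS](sqr_sqrtr (ltW e0)) expr2.
  apply: cmod_ip_le; rewrite ?sqrtr_ge0// (sqr_sqrtr (ltW e0)).
    exact: le_trans (l2_outside_le _ FG1) h1.
  exact: le_trans (l2_outside_le _ FG2) h2.
Qed.

(** The null set may depend on [e], so only the tolerances [n.+1%:R^-1] are kept. *)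
Lemma aeqv_approx (h k : acar A) : (forall e, 0 < e ->
  ae_itv (fun x => cmod (h x - k x) <= e)) ->
  aeqv h k.
Proof.
move=> hk; have : ae_itv (fun x => forall n : nat, cmod (h x - k x) <= n.+1%:R^-1).
  by apply: ae_itv_nat => n; apply: hk; rewrite invr_gt0.
apply: ae_itvS => x _ hkx; apply: cmod_eq => e e0.
have [n ne] : exists n : nat, n.+1%:R^-1 < e.
  exists (Num.truncn e^-1); rewrite invf_plt ?posrE//.
  exact: truncnS_gt.
exact: le_trans (hkx n) (ltW ne).
Qed.

Lemma adom_partial_sum (w : int -> acar A) (F : {fset int}) :
  (forall n, adomA (w n)) -> adomA (summability.partial_sum w F).
Proof.
move=> dw; rewrite partial_sumE.
have -> : \sum_(n <- F) w n = fun x => \sum_(n <- F) w n x by apply/funext =>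
  x; rewrite fct_sumE.
exact: (adom_sum a_gt0).
Qed.

Lemma adomB (h k : acar A) : adomA h -> adomA k -> adomA (h - k).
Proof.
move=> dh dk; apply: (adomD a_gt0) => //.
by rewrite -scaleN1r; exact: (adomZ a_gt0).
Qed.

(** This identifies the sum chosen by [xget] in the inner product with the fibrewise one. Both
    limits are compared with the partial sum over a common finite set. *)
Lemma norm_sum_unique (w : int -> acar A) s s' :
  norm_sum w s -> norm_sum w s' -> aeqv s s'.
Proof.
have FF : ProperFilter (@summability.totally int) := summability.totally_filter.
move=> [dw ds ws] [_ ds' ws']; apply: aeqv_approx => e e0.
have e20 : 0 < e / 2 by rewrite divr_gt0.
move/cvgrPdist_le : ws => /(_ _ e20)[F _ /(_ (F `|` _)%fset (fsubsetUl _ _)) ws].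
move/cvgrPdist_le : ws' => /(_ _ e20)[G _ /(_ (_ `|` G)%fset (fsubsetUr _ _)) ws'].
have := ws G; have := ws' F.
rewrite !sub0r !normrN !ger0_norm ?anorm_ge0// => h' h.
have dp := adom_partial_sum (F `|` G)%fset dw.
move: (anorm_ub a_gt0 (adomB dp ds)) (anorm_ub a_gt0 (adomB dp ds')).
apply: ae_itvS2 => x _ /le_trans-/(_ _ h) h1 /le_trans-/(_ _ h') h2.
rewrite [leRHS]splitr; apply: le_trans (cmodB_le _ _ (summability.partial_sum w
  (F `|` G)%fset x)) _.
by rewrite lerD// cmodBC.
Qed.

Lemma ell2_ip u v : @mdom R A S2 u -> @mdom R A S2 v ->
  norm_sum (gram (A := A) u v) (@mip R A S2 u v).
Proof. by move=> du dv; apply: (xgetPex 0);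
  exists (fun x => ip (u^~ x) (v^~ x)); exact: norm_sum_ip. Qed.

Lemma ell2_ipE u v : @mdom R A S2 u -> @mdom R A S2 v ->
  aeqv (@mip R A S2 u v) (fun x => ip (u^~ x) (v^~ x)).
Proof. by move=> du dv; apply: norm_sum_unique (ell2_ip du dv) (norm_sum_ip du dv). Qed.

End SequenceModules.

(** * Strongly convergent sums *)

Section StrongSums.
Variables (R : realType) (a : R).
Hypothesis a_gt0 : 0 < a.
Local Notation C := R[i].
Local Notation cmod := (@Normc.normc R).
Local Notation mu := (@lebesgue_measure R).
Local Open Scope complex_scope.
Local Notation A := (Linf a).
Local Notation adomA := (@adom R A).
Local Notation ae_itv := (ae_itv a).
Local Notation S2s := (ell2s A).
Implicit Types (h xi : R -> C) (u v : int -> R -> C) (F : {fset int}).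

Let mitv : measurable (`[0, a]%classic : set R). Proof. exact: measurable_itv. Qed.

Lemma hnorm_ge0 xi : 0 <= @hnorm R A xi. Proof. exact: sqrtr_ge0. Qed.

Lemma L2norm2_ge0 xi : (0 <= L2norm2 a xi)%E.
Proof. by apply: integral_ge0 => x _; rewrite lee_fin sqr_ge0. Qed.

Lemma hnorm_le xi (e : R) : 0 <= e -> (L2norm2 a xi <= (e ^+ 2)%:E)%E ->
  @hnorm R A xi <= e.
Proof.
move=> e0 xe; rewrite /hnorm/= -[leRHS](ger0_norm e0) -sqrtr_sqr ler_sqrt ?sqr_ge0//.
rewrite -lee_fin fineK// ge0_fin_numE ?L2norm2_ge0//.
by apply: le_lt_trans xe _; exact: ltry.
Qed.

Lemma L2norm2_le_hnorm xi (e : R) : (L2norm2 a xi < +oo)%E ->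
  @hnorm R A xi <= e -> (L2norm2 a xi <= (e ^+ 2)%:E)%E.
Proof.
move=> xoo xe; have xf : L2norm2 a xi \is a fin_num by rewrite ge0_fin_numE
  ?L2norm2_ge0.
rewrite -(fineK xf) lee_fin -[leLHS]sqr_sqrtr ?fine_ge0 ?L2norm2_ge0//.
by rewrite ler_pXn2r// nnegrE ?sqrtr_ge0// (le_trans (hnorm_ge0 xi)).
Qed.

Lemma cmeasurable_outside u F n : (forall n, cmeasurable `[0, a] (u n)) ->
  cmeasurable `[0, a] (fun x => outside 0 F (u^~ x) n).
Proof.
move=> mu_; rewrite /outside; case: (n \in F); first exact: cmeasurable_cst.
exact: mu_.
Qed.

Lemma l2_box_tail (w : int -> C) : (l2 w < +oo)%E ->
  (fun N => fine (l2 (outside 0 (box N) w))) @ \oo --> (0 : R).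
Proof.
move=> woo; apply/cvgrPdist_le => e e0; have [F Fe] := l2_tail woo e0.
have [N FN] := sub_box_ex F; exists N => // n /= Nn.
rewrite sub0r normrN ger0_norm ?fine_ge0 ?l2_ge0//.
have le := le_trans (l2_outside_le w (FN _ Nn)) Fe.
rewrite -lee_fin fineK// ge0_fin_numE ?l2_ge0//.
by apply: le_lt_trans le _; exact: ltry.
Qed.

(** Dominated convergence concerns sequences, so it is applied to the tails of [u] beyond the boxes,
    with majorant [M |xi|^2]. As tails decrease, the bound obtained for one box holds for every
    finite set containing it, which gives the limit along finite sets. *)
Lemma strong_sum_ip u v : @mdom R A S2s u -> @mdom R A S2s v ->
  strong_sum (gram (A := A) u v) (fun x => ip (u^~ x) (v^~ x)).
Proof.
move=> du dv; split.
- by move=> n; apply: adom_gram => //; [case: du|case: dv].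
- exact: adom_ip.
move=> xi [mxi xioo].
have FF : ProperFilter (@summability.totally int) := summability.totally_filter.
have /(ell2s_domP a_gt0)[mu_ [M0 uM0]] := du.
have /(ell2s_domP a_gt0)[mv_ [K0 vK0]] := dv.
(* The bounds are made nonnegative, and [K] positive because [e ^+ 2 / K] is formed below. *)
pose M := `|M0|; pose K := `|K0| + 1.
have M_ge0 : 0 <= M by exact: normr_ge0.
have K_gt0 : 0 < K by rewrite ltr_wpDl.
have uM : ae_itv (fun x => (l2 (u^~ x) <= M%:E)%E).
  by apply: ae_itvS uM0 => x _ /le_trans; apply; rewrite lee_fin ler_norm.
have vK : ae_itv (fun x => (l2 (v^~ x) <= K%:E)%E).
  apply: ae_itvS vK0 => x _ /le_trans; apply; rewrite lee_fin.
  by apply: le_trans (ler_norm _) _; rewrite lerDl.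
have mxi2 : measurable_fun `[0, a] (fun x =>
  cmod (xi x) ^+ 2) by exact: measurable_sqr_cmod.
(* For any finite set containing [box N], the squared modulus of the remainder applied to [xi] is
   almost everywhere at most [K * f N]. *)
pose f (N : nat) x := (fine (l2 (outside 0 (box N) (u^~ x))) * cmod (xi x) ^+ 2)%:E.
have f0 N x : (0 <= f N x)%E by rewrite lee_fin mulr_ge0 ?fine_ge0 ?l2_ge0 ?sqr_ge0.
have mf N : measurable_fun `[0, a] (f N).
  apply/measurable_EFinP; apply: measurable_funM => //.
  apply: (measurableT_comp (fine_measurable measurableT)).
  by apply: measurable_l2 => n; exact: cmeasurable_outside.
pose g x := (M * cmod (xi x) ^+ 2)%:E.
have ig : mu.-integrable `[0, a] g.
  apply/integrableP; split; first by apply/measurable_EFinP; exact: measurable_funM.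
  rewrite [ltLHS](_ : _ = \int[mu]_(x in `[0%R, a]) (M%:E * (cmod (xi x) ^+ 2)%:E))%E.
    rewrite ge0_integralZl//.
    - by apply: lte_mul_pinfty.
    - exact/measurable_EFinP.
    - by move=> x _; rewrite lee_fin sqr_ge0.
  by apply: eq_integral => x _; rewrite /g gee0_abs// lee_fin mulr_ge0 ?sqr_ge0.
have outM : ae_itv (fun x => forall N, (l2 (outside 0%R (box N) (u^~ x)) <= M%:E)%E).
  apply: ae_itvS uM => x _ uM N; apply: le_trans uM; apply: l2_le => n.
  by rewrite /outside; case: ifP; rewrite ?cmod0 ?cmod_ge0.
have cvgf : ae_itv (fun x => (fun N => f N x) @ \oo --> 0%E).
  move: (ell2s_lty a_gt0 du); apply: ae_itvS => x _ uoo; apply: cvg_EFin;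
    first exact: nearW.
  rewrite -[X in _ --> X](mul0r (cmod (xi x) ^+ 2)).
  by apply: cvgM; [exact: l2_box_tail|exact: cvg_cst].
have domf : \forall x \ae mu, forall N, `[0, a]%classic x -> (`|f N x| <= g x)%E.
  move: outM; rewrite /ae_itv; apply: filterS => x outM N /outM/(_ N) h.
  rewrite gee0_abs// lee_fin ler_wpM2r ?sqr_ge0// -lee_fin fineK//.
  by rewrite ge0_fin_numE ?l2_ge0//; apply: le_lt_trans h _; exact: ltry.
have [_ _] := @dominated_convergence _ (measurableTypeR R) R mu (`[0,
  a])%classic mitv f (cst 0%E) g mf (measurable_cst 0%E) cvgf ig domf.
rewrite integral0 => fcvg.
apply/cvgrPdist_le => e e0.
have [N fN] : exists N, (\int[mu]_(x in `[0%R, a]) f N x <= (e ^+ 2 / K)%:E)%E.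
  have /fine_cvgP[[N1 _ fin] /cvgrPdist_le] := fcvg.
  move=> /(_ (e ^+ 2 / K))[|N2 _ N2e]; first by rewrite divr_gt0 ?exprn_gt0.
  exists (maxn N1 N2); have := N2e (maxn N1 N2) (leq_maxr _ _).
  rewrite /= sub0r normrN => h; have := fin _ (leq_maxl N1 N2) => /= fi.
  by rewrite -(fineK fi) lee_fin; apply: le_trans (ler_norm _) h.
apply: (totally_sub (F := box N)) => G NG; rewrite sub0r normrN ger0_norm ?hnorm_ge0//.
apply: hnorm_le; first exact: ltW.
apply: (@le_trans _ _ (\int[mu]_(x in `[0%R, a]) (K%:E * f N x))%E); last first.
  rewrite (@ge0_integralZl _ (measurableTypeR R) R mu _ mitv _ (mf N))//.
    by rewrite -lee_pdivlMl// -EFinM mulrC.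
  by rewrite lee_fin ltW.
rewrite /L2norm2; apply: (@ae_ge0_le_integral _ (measurableTypeR R) R mu _ mitv) => //.
- by move=> x _; rewrite lee_fin sqr_ge0.
- apply/measurable_EFinP; apply: measurable_sqr_cmod; apply: cmeasurableM => //.
  have dG : adomA ((summability.partial_sum (gram (A := A) u v) G :
    acar A) - (fun x => ip (u^~ x) (v^~ x))).
    apply: (adomB a_gt0); last exact: adom_ip.
    by apply: (adom_partial_sum a_gt0) => n; apply: adom_gram => //;
      [case: du|case: dv].
  by have /(adomP a_gt0)[] := dG.
- by move=> x _; rewrite mule_ge0// lee_fin ltW.
- exact: (measurable_funeM _ (mf N)).
move: (ae_itvI (ell2s_lty a_gt0 du) (ell2s_lty a_gt0 dv)) vK outM.
apply: ae_itvS3 => x _ [uoo voo] vK /(_ N) outM; rewrite Normc.normcM exprMn.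
rewrite /f -[leRHS]EFinM lee_fin [leRHS]mulrA ler_wpM2r ?sqr_ge0//.
have l2f : l2 (outside 0 (box N) (u^~ x)) \is a fin_num.
  by rewrite ge0_fin_numE ?l2_ge0//; apply: le_lt_trans outM _; exact: ltry.
rewrite -[X in cmod X]/((summability.partial_sum (gram (A := A) u v) G : R ->
  C^o) x - ip (u^~ x) (v^~ x)).
rewrite partial_gram cmodBC ip_outside//.
have p0 : 0 <= fine (l2 (outside 0 (box N) (u^~ x))) by rewrite fine_ge0 ?l2_ge0.
rewrite -(sqr_sqrtr p0) -[X in _ <= X * _](sqr_sqrtr (ltW K_gt0)) -exprMn.
rewrite ler_pXn2r// ?nnegrE ?cmod_ge0 ?mulr_ge0 ?sqrtr_ge0// mulrC.
apply: cmod_ip_le; rewrite ?sqrtr_ge0// sqr_sqrtr ?(ltW K_gt0)//.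
  by rewrite fineK//; exact: l2_outside_le.
apply: le_trans vK; apply: l2_le => n.
by rewrite /outside; case: ifP; rewrite ?cmod0 ?cmod_ge0.
Qed.

Lemma L2norm2_adom h : adomA h -> (L2norm2 a h < +oo)%E.
Proof.
move=> /(adomP a_gt0)[mh [M hM]].
apply: (@le_lt_trans _ _ (\int[mu]_(x in `[0%R, a]) (cst (M ^+ 2)%:E x))%E).
  rewrite /L2norm2; apply: (@ae_ge0_le_integral _ (measurableTypeR R) R mu _
    mitv) => //.
  - by move=> x _; rewrite lee_fin sqr_ge0.
  - by apply/measurable_EFinP; exact: measurable_sqr_cmod.
  - by move=> x _; rewrite lee_fin sqr_ge0.
  apply: ae_itvS hM => x _ hM; rewrite lee_fin ler_pXn2r// nnegrE ?cmod_ge0//.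
  exact: le_trans (cmod_ge0 _) hM.
by rewrite integral_cst//= lebesgue_measure_itv/= lte_fin a_gt0 -EFinB -EFinM ltry.
Qed.

(* Testing against the constant vector [1] turns strong convergence into
   convergence in [L^2[0,a]], whose limits are unique almost everywhere. *)
Lemma strong_sum_unique (w : int -> acar A) s s' :
  strong_sum w s -> strong_sum w s' -> aeqv s s'.
Proof.
have FF : ProperFilter (@summability.totally int) := summability.totally_filter.
move=> [dw ds ws] [_ ds' ws'].
have d1 : @hdom R A (fun=> 1).
  split; first exact: cmeasurable_cst.
  by apply: L2norm2_adom; exact: (adom_cst a_gt0).
pose dS : acar A := s - s'.
have dB : adomA dS by exact: (adomB a_gt0).
suff : ((L2norm2 a dS = 0)%E).
  move=> int0; have mB : measurable_fun `[0, a] (fun x => (cmod (dS x) ^+ 2)%:E).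
    apply/measurable_EFinP; apply: measurable_sqr_cmod.
    by have /(adomP a_gt0)[] := dB.
  have /(ae_eq_integral_abs mu mitv mB) : (\int[mu]_(x in `[0%R, a]) `|(cmod
    (dS x) ^+ 2)%:E| = 0)%E.
    by rewrite -[RHS]int0; apply: eq_integral => x _;
      rewrite gee0_abs// lee_fin sqr_ge0.
  apply: ae_itvS => x _ [] /eqP; rewrite sqrf_eq0 => /eqP/Normc.eq0_normc/eqP.
  by rewrite subr_eq0 => /eqP.
apply/eqP; rewrite eq_le L2norm2_ge0 andbT; apply/lee_addgt0Pr => e e0; rewrite add0e.
(* The two errors have squared norms at most [d ^+ 2 = e / 4], which gives [2 * (e / 4 + e / 4) = e]
   for their difference. *)
pose d := Num.sqrt (e / 4); have d0 : 0 < d by rewrite sqrtr_gt0 divr_gt0.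
move/cvgrPdist_le : (ws _ d1) => /(_ _ d0)[F _ /(_ (F `|` _)%fset (fsubsetUl _ _)) h].
move/cvgrPdist_le : (ws' _ d1) => /(_ _ d0)[G _ /(_ (_ `|` G)%fset (fsubsetUr _ _)) h'].
have := h G; have := h' F; rewrite !sub0r !normrN !ger0_norm ?hnorm_ge0//.
set p := summability.partial_sum w (F `|` G)%fset => {}h' {}h.
have dp : adomA p by exact: (adom_partial_sum a_gt0).
pose dp_ (t : acar A) : acar A := p - t.
have le t : adomA t -> @hnorm R A (@aapp R A (p - t) (fun=> 1)) <= d ->
    (L2norm2 a (dp_ t) <= (e / 4)%:E)%E.
  move=> dt ht; have dpt : adomA (p - t) by exact: (adomB a_gt0).
  have E : @aapp R A (p - t) (fun=> 1) = p - t :> (R -> C^o).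
    by apply/funext => x; rewrite /aapp/= mulr1.
  rewrite E in ht; have := L2norm2_le_hnorm (L2norm2_adom dpt) ht.
  by rewrite sqr_sqrtr// divr_ge0// ltW.
have := leeD (le _ ds h) (le _ ds' h').
have mpt t : adomA t -> measurable_fun `[0, a] (fun x => (cmod (dp_ t x) ^+ 2)%:E).
  move=> dt; apply/measurable_EFinP; apply: measurable_sqr_cmod.
  by have /(adomP a_gt0)[] := adomB a_gt0 dp dt.
rewrite -ge0_integralD//; [|by move=> x _; rewrite lee_fin sqr_ge0|exact: mpt
  |by move=> x _; rewrite lee_fin sqr_ge0|exact: mpt].
move=> hh; apply: (@le_trans _ _ (2%:E * (e / 4 + e / 4)%:E)%E); last first.
  by rewrite -EFinM lee_fin; lra.
have two0 : (0 <= 2%:E :> \bar R)%E by rewrite lee_fin.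
rewrite (EFinD (e / 4)); apply: le_trans (lee_wpmul2l two0 hh).
have msum : measurable_fun `[0, a]
    (fun x => (cmod (dp_ s x) ^+ 2)%:E + (cmod (dp_ s' x) ^+ 2)%:E)%E.
  exact: (emeasurable_funD (mpt _ ds) (mpt _ ds')).
rewrite -(@ge0_integralZl _ (measurableTypeR R) R mu _ mitv _ msum)//; last first.
  by move=> x _; rewrite adde_ge0// lee_fin sqr_ge0.
apply: ge0_le_integral => //.
- by move=> x _; rewrite lee_fin sqr_ge0.
- apply/measurable_EFinP; apply: measurable_sqr_cmod.
  by have /(adomP a_gt0)[] := dB.
- exact: (measurable_funeM _ msum).
move=> x _; rewrite -EFinD -EFinM lee_fin mulrDr.
rewrite (_ : dS x = dp_ s' x + - dp_ s x).
  by apply: le_trans (cmodD_sqr _ _) _; rewrite cmodN addrC.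
by rewrite /dS /dp_ !fctE opprB [RHS]addrC addrA subrK.
Qed.

Lemma ell2s_ip u v : @mdom R A S2s u -> @mdom R A S2s v ->
  strong_sum (gram (A := A) u v) (@mip R A S2s u v).
Proof.
move=> du dv; apply: (xgetPex 0); exists (fun x => ip (u^~ x) (v^~ x)).
exact: strong_sum_ip.
Qed.

Lemma ell2s_ipE u v : @mdom R A S2s u -> @mdom R A S2s v ->
  aeqv (@mip R A S2s u v) (fun x => ip (u^~ x) (v^~ x)).
Proof.
by move=> du dv; apply: strong_sum_unique (ell2s_ip du dv) (strong_sum_ip du dv).
Qed.

End StrongSums.

(** * Transport of structure and unitarity *)

Section Transport.
Variables (R : realType) (a : R).
Hypothesis a_gt0 : 0 < a.
Local Notation A := (Linf a).
(** Meant for [T := Uadj] and [U := Ua], once between [La a] and [ell2s], once between [XaM a] and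
    [ell2]. The algebraic hypotheses bear on [T], which commutes with the operations as an equality
    of functions and can be rewritten with; [U] is controlled through [U_dom] and [TU]. *)
Variables (E F : premodule A) (T : mcar F -> mcar E) (U : mcar E -> mcar F).
Hypothesis E_hilbert : hilbert_module E.
Hypothesis T_dom : forall y, mdom y <-> mdom (T y).
Hypothesis TD : forall y z, T (y + z) = T y + T z.
Hypothesis TZ : forall (c : R[i]) y, T (c *: y) = c *: T y.
Hypothesis T_act : forall h y, T (mact h y) = mact h (T y).
Hypothesis T_eqv : forall y z, mdom y -> mdom z -> meqv y z <-> meqv (T y) (T z).
Hypothesis T_ip : forall y z, mdom y -> mdom z -> aeqv (mip y z) (mip (T y) (T z)).
Hypothesis ip_dom : forall y z : mcar F, mdom y -> mdom z -> adom (mip y z).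
Hypothesis U_dom : forall x, mdom x -> mdom (U x).
Hypothesis TU : forall x, mdom x -> meqv (T (U x)) x.

Let T0 : T 0 = 0. Proof. by rewrite -(scale0r 0) TZ scale0r. Qed.

Let TB y z : T (y - z) = T y - T z.
Proof. by rewrite -scaleN1r TD TZ scaleN1r. Qed.

Let clE : mclosed (@mdom R A E). Proof. by case: E_hilbert => _ []. Qed.

Let eqr x : mdom x -> @meqv R A E x x.
Proof. by case: E_hilbert => -[r _ _] _; exact: r. Qed.

Let eqs x y : mdom x -> mdom y -> @meqv R A E x y -> meqv y x.
Proof. by case: E_hilbert => -[_ s _] _; exact: s. Qed.

Let eqt x y z : mdom x -> mdom y -> mdom z ->
  @meqv R A E x y -> meqv y z -> meqv x z.
Proof. by case: E_hilbert => -[_ _ t] _; exact: t. Qed.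

Let cE : mcompat E. Proof. by case: E_hilbert => _ [_ []]. Qed.

Lemma transport_closed : mclosed (@mdom R A F).
Proof.
case: clE => c0 cD cZ cA; split.
- by apply/T_dom; rewrite T0.
- by move=> y z /T_dom dy /T_dom dz; apply/T_dom; rewrite TD; exact: cD.
- by move=> c y /T_dom dy; apply/T_dom; rewrite TZ; exact: cZ.
- by move=> h y dh /T_dom dy; apply/T_dom; rewrite T_act; exact: cA.
Qed.

Let clF := transport_closed.

Lemma transport_mnorm y : mdom y -> mnorm y = mnorm (T y).
Proof. by move=> dy; rewrite /mnorm (eq_anorm (T_ip dy dy)). Qed.

Lemma eqv_mnorm x y : mdom x -> mdom y -> @meqv R A E x y -> mnorm x = mnorm y.
Proof. by move=> dx dy xy; case: cE => _ _ _ ci;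
  rewrite /mnorm (eq_anorm (ci _ _ _ _ dx dy dx dy xy xy)). Qed.

Lemma transport_hilbert : hilbert_module F.
Proof.
have [cF0 cFD cFZ cFA] := clF; have [cE0 cED cEZ cEA] := clE.
have [eD eZ eA ei] := cE.
have [_ [_ [_ [[a1 [a2 [a3 [a4 [a5 a6]]]]]
  [[i1 [i2 [i3 [i4 [i5 [i6 i7]]]]]] cplt]]]]] := E_hilbert.
have d y : mdom y -> mdom (T y) by move/T_dom.
have ip0 y z : mdom y -> mdom z -> aeqv (mip (T y) (T z)) (mip y z).
  by move=> dy dz; apply: aeqv_sym; exact: T_ip.
split.
  split.
  - by move=> y dy; apply/T_eqv => //; apply: eqr; exact: d.
  - by move=> y z dy dz /T_eqv-/(_ dy dz) yz; apply/T_eqv => //;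
    apply: eqs => //; exact: d.
  - move=> y z w dy dz dw /T_eqv-/(_ dy dz) yz /T_eqv-/(_ dz dw) zw.
    by apply/T_eqv => //; apply: (eqt (y := T z)) => //; exact: d.
split; first exact: clF.
split.
  split.
  - move=> y y' z z' dy dy' dz dz' /T_eqv-/(_ dy dy') yy' /T_eqv-/(_ dz dz') zz'.
    by apply/T_eqv; rewrite ?TD; [exact: cFD|exact: cFD|apply: eD => //; exact: d].
  - move=> c y y' dy dy' /T_eqv-/(_ dy dy') yy'.
    by apply/T_eqv; rewrite ?TZ; [exact: cFZ|exact: cFZ|apply: eZ => //; exact: d].
  - move=> h h' y y' dh dh' dy dy' hh' /T_eqv-/(_ dy dy') yy'.
    by apply/T_eqv; rewrite ?T_act; [exact: cFA|exact: cFA|apply: eA => //; exact: d].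
  - move=> y y' z z' dy dy' dz dz' /T_eqv-/(_ dy dy') yy' /T_eqv-/(_ dz dz') zz'.
    apply: aeqv_trans (T_ip dy dz) _; apply: aeqv_trans (ip0 _ _ dy' dz').
    by apply: ei => //; exact: d.
split.
  split; [|split; [|split; [|split; [|split]]]].
  - move=> h y z dh dy dz; apply/T_eqv; [by apply: cFA => //;
    exact: cFD|by apply: cFD; exact: cFA|].
    by rewrite T_act !TD !T_act; apply: a1 => //; exact: d.
  - move=> h k y dh dk dy; have dhk : adom (h + k) by exact: (adomD a_gt0).
    apply/T_eqv; [exact: cFA|by apply: cFD; exact: cFA|].
    by rewrite T_act TD !T_act; apply: a2 => //; exact: d.
  - move=> h k y dh dk dy; have dhk : adom (amul h k) by exact: (adomM a_gt0).
    apply/T_eqv; [exact: cFA|by apply: (cFA) => //; exact: cFA|].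
    by rewrite !T_act; apply: a3 => //; exact: d.
  - move=> y dy; have d1 : adom (aone A) by exact: (adom_cst a_gt0).
    apply/T_eqv => //; first exact: cFA.
    by rewrite T_act; apply: a4; exact: d.
  - move=> c h y dh dy; have dch : adom (c *: h) by exact: (adomZ a_gt0).
    apply/T_eqv; [exact: cFA|by apply: cFZ; exact: cFA|].
    by rewrite TZ !T_act; apply: a5 => //; exact: d.
  - move=> c h y dh dy.
    apply/T_eqv; [by apply: cFA => //; exact: cFZ|by apply: cFZ; exact: cFA|].
    by rewrite TZ !T_act TZ; apply: a6 => //; exact: d.
split.
  split; [|split; [|split; [|split; [|split; [|split]]]]].
  - exact: ip_dom.
  - move=> y z w dy dz dw; apply: aeqv_trans (T_ip (cFD _ _ dy dz) dw) _.
    rewrite TD; apply: aeqv_trans (i2 _ _ _ (d _ dy) (d _ dz) (d _ dw)) _.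
    move: (ip0 _ _ dy dw) (ip0 _ _ dz dw); apply: ae_itvS2 => x _ e1 e2.
    by rewrite !fctE e1 e2.
  - move=> c y z dy dz; apply: aeqv_trans (T_ip (cFZ c _ dy) dz) _.
    rewrite TZ; apply: aeqv_trans (i3 c _ _ (d _ dy) (d _ dz)) _.
    by move: (ip0 _ _ dy dz); apply: ae_itvS => x _ e1; rewrite !fctE e1.
  - move=> h y z dh dy dz; apply: aeqv_trans (T_ip (cFA h _ dh dy) dz) _.
    rewrite T_act; apply: aeqv_trans (i4 h _ _ dh (d _ dy) (d _ dz)) _.
    by move: (ip0 _ _ dy dz); apply: ae_itvS => x _ e1; rewrite /= e1.
  - move=> y z dy dz; apply: aeqv_trans (T_ip dz dy) _.
    apply: aeqv_trans (i5 _ _ (d _ dy) (d _ dz)) _.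
    by move: (ip0 _ _ dy dz); apply: ae_itvS => x _ e1; rewrite /= e1.
  - move=> y dy; have [b db Tb] := i6 _ (d _ dy); exists b => //.
    exact: aeqv_trans (T_ip dy dy) Tb.
  - move=> y dy y0; apply/T_eqv => //; rewrite T0; apply: i7; first exact: d.
    exact: aeqv_trans (ip0 _ _ dy dy) y0.
move=> u du cu.
(* The limit is found in [E] and brought back by [U]. As [T (U x)] is only equivalent to [x], the
   norms of the differences are matched by [eqv_mnorm]. *)
have [|x dx ux] := cplt (T \o u) (fun n => d _ (du n)).
  move=> e /cu[N uN]; exists N => m n Nm Nn /=.
  rewrite -TB -transport_mnorm; first exact: uN.
  by rewrite -scaleN1r; apply: cFD => //; exact: cFZ.
exists (U x); first exact: U_dom.
rewrite /mcvg (_ : (fun n => _) = fun n => mnorm (T (u n) - x))//.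
apply/funext => n; have dUx := U_dom dx.
rewrite transport_mnorm; last by rewrite -scaleN1r; apply: cFD => //; exact: cFZ.
rewrite TB; apply: eqv_mnorm.
- by rewrite -scaleN1r; apply: cED; [exact: d|apply: cEZ; exact: d].
- by rewrite -scaleN1r; apply: cED; [exact: d|exact: cEZ].
rewrite -(scaleN1r (T (U x))) -(scaleN1r x); apply: eD;
  [exact: d|exact: d|apply: cEZ; exact: d|exact: cEZ| |].
  by apply: eqr; exact: d.
by apply: eZ => //; [exact: d|exact: TU].
Qed.

(** [T] reflects equivalence and [T (U x)] is equivalent to [x], so identities about [U] are checked
    after applying [T]. The module map axioms for [U] and its surjectivity are obtained in this
    way. *)
Lemma transport_eqv x y : mdom x -> mdom y -> meqv x (T y) -> meqv (U x) y.
Proof.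
move=> dx dy Tyx; have dUx := U_dom dx; apply/T_eqv => //.
have dTy : mdom (T y) by exact/T_dom.
have dTUx : mdom (T (U x)) by exact/T_dom.
by apply: (eqt (y := x)) => //; exact: TU.
Qed.

Lemma transport_unitary : unitary U.
Proof.
have [cF0 cFD cFZ cFA] := clF; have [cE0 cED cEZ cEA] := clE.
have [eD eZ eA ei] := cE.
have dT y : mdom y -> mdom (T y) by move/T_dom.
split => //; first exact: transport_hilbert.
- split; first exact: U_dom.
  split.
    move=> x y dx dy xy; apply: transport_eqv => //; first exact: U_dom.
    have dUy := U_dom dy; apply: (eqt (y := y)) => //; first exact: dT.
    by apply: eqs => //; [exact: dT|exact: TU].
  split.
    move=> x y dx dy; apply: transport_eqv; first exact: cED.
      by apply: cFD; exact: U_dom.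
    have dUx := U_dom dx; have dUy := U_dom dy.
    by rewrite TD; apply: eD => //; try exact: dT; apply: eqs; try exact: dT;
      try exact: TU.
  split.
    move=> c x dx; apply: transport_eqv; first exact: cEZ.
      by apply: cFZ; exact: U_dom.
    have dUx := U_dom dx.
    by rewrite TZ; apply: eZ => //; try exact: dT; apply: eqs; try exact: dT;
      try exact: TU.
  move=> h x dh dx; apply: transport_eqv; first exact: cEA.
    by apply: cFA => //; exact: U_dom.
  have dUx := U_dom dx.
  rewrite T_act; apply: eA => //; [exact: dT|exact: aeqv_refl|].
  by apply: eqs; try exact: dT; try exact: TU.
- move=> x y dx dy; have dUx := U_dom dx; have dUy := U_dom dy.
  apply: aeqv_trans (T_ip dUx dUy) _.
  by apply: ei => //; try exact: dT; exact: TU.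
- move=> y dy; have dTy := dT _ dy; exists (T y) => //; apply: transport_eqv => //.
  exact: eqr.
Qed.

Lemma transport_adjoint : adjoint U T.
Proof.
have [eD eZ eA ei] := cE.
have dT y : mdom y -> mdom (T y) by move/T_dom.
split=> [y /dT//|x y dx dy]; have dUx := U_dom dx.
apply: aeqv_trans (T_ip dUx dy) _.
by apply: ei => //; try exact: dT; [exact: TU|apply: eqr; exact: dT].
Qed.

End Transport.

(** * The operator [Ua] on [La a] and on [Xa a] *)

Section Unitary.
Variables (R : realType) (a : R).
Hypothesis a_gt0 : 0 < a.
Local Notation C := R[i].
Local Notation A := (Linf a).
Local Notation E := (La a).
Local Notation S2s := (ell2s A).
Local Notation S2 := (ell2 A).
Local Notation fib := (fib a).
Local Notation ae_itv := (ae_itv a).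
Local Notation Uadj := (@Uadj R a).
Implicit Types (f g : R -> C) (b u v : int -> R -> C).

Lemma UadjD (u v : mcar S2s) : Uadj (u + v) = (Uadj u : mcar E) + Uadj v.
Proof. by []. Qed.

Lemma UadjZ (c : C) (u : mcar S2s) : Uadj (c *: u) = c *: (Uadj u : mcar E).
Proof. by []. Qed.

Lemma Uadj_act (h : acar A) (u : mcar S2s) :
  Uadj (@mact R A S2s h u) = @mact R A E h (Uadj u).
Proof. by []. Qed.

Lemma ae_fib_Uadj b : ae_itv (fun x => fib (Uadj b) x = fun n => b (- n) x).
Proof.
apply: (@ae_itvS R a (fun=> True)) => [x x0a _|]; last exact: ae_itvW.
by apply/funext => n; exact: fib_Uadj.
Qed.

(** The converse recovers [b n] on [0,a[ from a translate of [Uadj b]; adding the endpoint does not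
    affect measurability. Membership thereby transfers in both directions, as [T_dom] demands. *)
Lemma cmeasurable_UadjP b :
  cmeasurable setT (Uadj b) <-> forall n, cmeasurable `[0, a] (b n).
Proof.
split=> [mb n|]; last exact: cmeasurable_Uadj.
have mf : cmeasurable `[0, a[ (fun x => fib (Uadj b) x (- n)).
  by apply: cmeasurableS (cmeasurable_fib _ _ mb).
have eqf x : x \in `[0, a[%classic -> fib (Uadj b) x (- n) = b n x.
  by rewrite inE /= in_itv/= => x0a; rewrite fib_Uadj// opprK.
case: mf => mr mi; split; apply/measurable_fun_itv_bndo_bndcP.
  by apply: eq_measurable_fun mr => x /eqf ->.
by apply: eq_measurable_fun mi => x /eqf ->.
Qed.

Lemma La_dom_Uadj b : @mdom R A S2s b <-> @mdom R A E (Uadj b).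
Proof.
split=> [/(ell2s_domP a_gt0)[mb [M bM]]|/(La_domP a_gt0)[/cmeasurable_UadjP mb [M bM]]].
  apply/(La_domP a_gt0); split; first exact/cmeasurable_UadjP.
  exists M; move: (ae_fib_Uadj b) bM; apply: ae_itvS2 => x _ ->.
  by rewrite (l2N (b^~ x)).
apply/(ell2s_domP a_gt0); split => //; exists M.
move: (ae_fib_Uadj b) bM; apply: ae_itvS2 => x _ ->.
by rewrite (l2N (b^~ x)).
Qed.

Lemma Xa_Uadj b : @mdom R A S2 b <-> @Xa R a (Uadj b).
Proof.
split=> [/(ell2_domP a_gt0)[db tb]|/(XaP a_gt0)[db tb]].
  apply/(XaP a_gt0); split; first exact/La_dom_Uadj.
  apply: (@eq_tail_small _ _ (fun x n => b (- n) x)).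
    by apply: ae_itvS (ae_fib_Uadj b) => x _ ->.
  exact: (@tail_smallN _ _ (fun x n => b n x)).
apply/(ell2_domP a_gt0); split; first exact/La_dom_Uadj.
apply: (@eq_tail_small _ _ (fun x n => fib (Uadj b) x (- n))).
  apply: ae_itvS (ae_fib_Uadj b) => x _ ->; apply/funext => n.
  by rewrite opprK.
exact: tail_smallN.
Qed.

Lemma meqv_Uadj u v :
  (forall n, @aeqv R A (u n) (v n)) <-> @meqv R A E (Uadj u) (Uadj v).
Proof.
split=> [uv|/(meqvE a_gt0) uv n].
  apply/(meqvE a_gt0); move: (ae_fib_Uadj u) (ae_fib_Uadj v) (ae_itv_int uv).
  by apply: ae_itvS3 => x _ -> -> uvx; apply/funext => n; exact: uvx.
move: (ae_fib_Uadj u) (ae_fib_Uadj v) uv; apply: ae_itvS3 => x _ -> ->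
  /(congr1 (@^~ (- n))).
by rewrite opprK.
Qed.

Lemma ip_Uadj u v : @mdom R A S2s u -> @mdom R A S2s v ->
  @aeqv R A (fun x => ip (u^~ x) (v^~ x)) (@mip R A E (Uadj u) (Uadj v)).
Proof.
move=> du dv; move: (ae_fib_Uadj u) (ae_fib_Uadj v)
  (ae_itvI (ell2s_lty a_gt0 du) (ell2s_lty a_gt0 dv)).
apply: ae_itvS3 => x _ hu hv [uoo voo]; rewrite ipE_fib hu hv.
by rewrite (ipN uoo voo).
Qed.

Lemma Uadj_Ua f : @meqv R A E (Uadj (@Ua R a f)) f.
Proof.
apply/(meqvE a_gt0).
apply: (@ae_itvS R a (fun=> True)) => [x x0a _|]; last exact: ae_itvW.
exact: fib_Uadj_piece.
Qed.

Lemma Ua_dom f : @mdom R A E f -> @mdom R A S2s (@Ua R a f).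
Proof.
move=> /[dup] df /(La_domP a_gt0)[mf _]; apply/La_dom_Uadj.
apply: (dom_fib_eq a_gt0 _ _ df).
  by apply/cmeasurable_UadjP => n; exact: cmeasurable_piece.
exact/(meqvE a_gt0)/Uadj_Ua.
Qed.

Lemma Ua_Xa f : @Xa R a f -> @mdom R A S2 (@Ua R a f).
Proof.
move=> /(XaP a_gt0)[df tf]; apply/(ell2_domP a_gt0); split; first exact: Ua_dom.
apply: (@eq_tail_small _ _ (fun x n => fib f x (- n))).
  apply: (@ae_itvS R a (fun=> True)) => [x x0a _|]; last exact: ae_itvW.
  by apply/funext => n; rewrite /Ua pieceE.
exact: tail_smallN.
Qed.

Lemma Ua_unitary_adjoint : unitary (@Ua R a) /\ adjoint (@Ua R a) (@Defs.Uadj R a).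
Proof.
have ipd u v : @mdom R A S2s u -> @mdom R A S2s v -> adom (@mip R A S2s u v).
  by move=> du dv; case: (ell2s_ip a_gt0 du dv).
have ipT u v : @mdom R A S2s u -> @mdom R A S2s v ->
    aeqv (@mip R A S2s u v) (@mip R A E (Uadj u) (Uadj v)).
  by move=> du dv; apply: aeqv_trans (ell2s_ipE a_gt0 du dv) (ip_Uadj du dv).
split.
  apply: (@transport_unitary R a a_gt0 E S2s Uadj).
  - exact: La_hilbert.
  - exact: La_dom_Uadj.
  - exact: UadjD.
  - exact: UadjZ.
  - exact: Uadj_act.
  - by move=> u v _ _; exact: meqv_Uadj.
  - exact: ipT.
  - exact: ipd.
  - exact: Ua_dom.
  - by move=> f _; exact: Uadj_Ua.
apply: (@transport_adjoint R a E S2s Uadj).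
- exact: La_hilbert.
- exact: La_dom_Uadj.
- exact: ipT.
- exact: Ua_dom.
- by move=> f _; exact: Uadj_Ua.
Qed.

Lemma XaM_hilbert : hilbert_module (XaM a).
Proof. exact: hilbert_restrict (La_hilbert a_gt0) (Xa_closed_submodule a_gt0). Qed.

Lemma Ua_Xa_unitary : @unitary R A (XaM a) S2 (@Ua R a).
Proof.
have sub u : @mdom R A S2 u -> @mdom R A S2s u by move=> /(ell2_domP a_gt0)[].
apply: (@transport_unitary R a a_gt0 (XaM a) S2 Uadj).
- exact: XaM_hilbert.
- exact: Xa_Uadj.
- exact: UadjD.
- exact: UadjZ.
- exact: Uadj_act.
- by move=> u v _ _; exact: meqv_Uadj.
- move=> u v du dv; apply: aeqv_trans (ell2_ipE a_gt0 du dv) _.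
  exact: ip_Uadj (sub _ du) (sub _ dv).
- by move=> u v du dv; case: (ell2_ip a_gt0 du dv) => _ dip _; exact: dip.
- exact: Ua_Xa.
- by move=> f _; exact: Uadj_Ua.
Qed.

End Unitary.

(** * Duality *)

Section Duality.
Variables (R : realType) (a : R).
Hypothesis a_gt0 : 0 < a.
Local Notation C := R[i].
Local Notation cmod := (@Normc.normc R).
Local Open Scope complex_scope.
Local Notation A := (Linf a).
Local Notation adomA := (@adom R A).
Local Notation anormA := (@anorm R A).
Local Notation E := (La a).
Local Notation domE := (@mdom R A E).
Local Notation normE := (@mnorm R A E).
Local Notation ipE := (@mip R A E).
Local Notation actE := (@mact R A E).
Local Notation fib := (fib a).
Local Notation ae_itv := (ae_itv a).
Implicit Types (f g k y : R -> C) (h : R -> C) (b : int -> R -> C) (s : seq int).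

Lemma ipDr (v w w' : int -> C) : (l2 v < +oo)%E -> (l2 w < +oo)%E -> (l2 w' < +oo)%E ->
  ip v (fun n => w n + w' n) = ip v w + ip v w'.
Proof.
move=> voo woo w'oo; rewrite /ip -csumD; [|exact: ip_csummable..].
by congr csum; apply/funext => n; rewrite rmorphD mulrDr.
Qed.

Lemma ipZr (c : C) (v w : int -> C) : (l2 v < +oo)%E -> (l2 w < +oo)%E ->
  ip v (fun n => c * w n) = c^* * ip v w.
Proof.
move=> voo woo; rewrite /ip -csumZ; last exact: ip_csummable.
by congr csum; apply/funext => n; rewrite rmorphM mulrCA.
Qed.

(* [assemble b] is the function whose values at the points [x - n a], for [x]
   in [0,a[, are the [b n x]. *)
Definition assemble b : R -> C := @Uadj R a (fun n => b (- n)).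

(** A list rather than a finite set, so that [dual_truncate] can go by induction on [s]. *)
Definition truncate s b : int -> R -> C := fun n x => if n \in s then b n x else 0.

Lemma fib_assemble b x : 0 <= x < a -> fib (assemble b) x = b^~ x.
Proof. by move=> x0a; apply/funext => n; rewrite fib_Uadj// opprK. Qed.

Lemma ae_fib_assemble b : ae_itv (fun x => fib (assemble b) x = b^~ x).
Proof.
by apply: (@ae_itvS R a (fun=> True)) => [x x0a _|];
  [exact: fib_assemble|exact: ae_itvW].
Qed.

Lemma cmeasurable_assemble b : (forall n, cmeasurable `[0, a] (b n)) ->
  cmeasurable setT (assemble b).
Proof. by move=> mb; apply: cmeasurable_Uadj => // n; exact: mb. Qed.

Lemma adom_fib f n : domE f -> adomA (fun x => fib f x n).
Proof.
move=> /(La_domP a_gt0)[mf [M fM]]; apply/(adomP a_gt0); split.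
  by apply: cmeasurableS (cmeasurable_fib _ _ mf).
exists (Num.sqrt M); apply: ae_itvS fM => x _ fM.
have M0 : 0 <= M by rewrite -lee_fin; apply: le_trans (l2_ge0 _) fM.
rewrite -(@ler_pXn2r _ 2)// ?nnegrE ?cmod_ge0 ?sqrtr_ge0// sqr_sqrtr// -lee_fin.
by apply: le_trans fM; exact: l2_coord.
Qed.

Lemma adom_truncate s b : (forall n, adomA (b n)) -> forall n, adomA (truncate s b n).
Proof.
by move=> db n; rewrite /truncate; case: (n \in s); [exact: db|exact: (adom_cst a_gt0)].
Qed.

Lemma l2_truncate s b x : uniq s ->
  l2 ((truncate s b)^~ x) = (\sum_(n <- s) cmod (b n x) ^+ 2)%:E.
Proof.
move=> us; pose F := [fset n in s]%fset.
rewrite (@l2_finsupp _ _ F) => [|n]; last by rewrite inE /truncate => /negbTE ->.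
congr EFin; rewrite (perm_big s); last first.
  by apply: uniq_perm; rewrite ?fset_uniq// => n; rewrite inE.
by rewrite !big_seq; apply: eq_bigr => n ns; rewrite /truncate ns.
Qed.

(** Tails vanish beyond [s], so unit pieces and truncations lie in [Xa a] whatever their
    coefficients in [Linf a]; they are the test functions for module maps. *)
Lemma Xa_truncate s b : (forall n, adomA (b n)) -> @Xa R a (assemble (truncate s b)).
Proof.
move=> db; apply/(XaP a_gt0); split; last first.
  move=> e e0; exists [fset n in s]%fset; apply: ae_itvS (ae_fib_assemble
    (truncate s b)) => x _ ->.
  rewrite (@l2_finsupp _ _ fset0) ?big_seq_fset0 ?lee_fin ?ltW// => n _.
  by rewrite /outside /truncate inE; case: (n \in s).
apply/(La_domP a_gt0); split.
  apply: cmeasurable_assemble => n.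
  by have /(adomP a_gt0)[] := adom_truncate s db n.
have dS : adomA (fun x => \sum_(n <- undup s) (cmod (b n x) ^+ 2)%:C).
  by apply: (adom_sum a_gt0) => n; exact: adom_sqr_cmod.
have /(adomP a_gt0)[_ [M SM]] := dS; exists M.
move: (ae_fib_assemble (truncate s b)) SM; apply: ae_itvS2 => x _ ->.
rewrite -(rmorph_sum (real_complex R)) cmod_realE => SM.
rewrite (_ : truncate s b = truncate (undup s) b); last first.
  by apply/funext => n; apply/funext => z; rewrite /truncate mem_undup.
rewrite l2_truncate ?undup_uniq// lee_fin; exact: le_trans (ler_norm _) SM.
Qed.

Lemma dom_Xa f : @Xa R a f -> domE f.
Proof. by move=> /(XaP a_gt0)[]. Qed.

(** From a bound of the form [|f|^2 <= K |f|], as produced by evaluating a bounded map at a suitable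
    [f], one factor of the norm is cancelled; norm 0 is set apart. *)
Lemma normE_le_self f (K : R) : 0 <= K ->
  ae_itv (fun x => (l2 (fib f x) <= (K * normE f)%:E)%E) -> normE f <= K.
Proof.
move=> K0 fK; have [->//|r0] := eqVneq (normE f) 0.
have r_gt0 : 0 < normE f by rewrite lt_neqAle eq_sym r0 normE_ge0.
have Kr : 0 <= K * normE f by rewrite mulr_ge0 ?normE_ge0.
have : normE f <= Num.sqrt (K * normE f).
  by apply: (normE_le a_gt0); rewrite ?sqrtr_ge0// sqr_sqrtr.
rewrite -(@ler_pXn2r _ 2)// ?nnegrE ?normE_ge0 ?sqrtr_ge0// (sqr_sqrtr Kr) expr2.
by rewrite ler_pM2r.
Qed.

Lemma l2_box_le (v : int -> C) (K : R) :
  (forall N, \sum_(n <- box N) cmod (v n) ^+ 2 <= K) -> (l2 v <= K%:E)%E.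
Proof.
move=> vK; apply: esum_le_ub => F; have [N /(_ N (leqnn N)) FN] := sub_box_ex F.
rewrite sumEFin lee_fin; apply: le_trans (vK N).
by apply: ler_sum_fset => // n; exact: sqr_ge0.
Qed.

(** * Bounded module maps on a submodule between [Xa a] and [La a] *)

Section Representation.
(** All of [La a] for self-duality, [Xa a] for the dual of [XaM a]. *)
Variable S : set (mcar E).
Hypothesis SE : forall f, S f -> domE f.
Hypothesis clS : mclosed S.
Hypothesis XS : forall f, @Xa R a f -> S f.
Variable L : mcar E -> acar A.
Hypothesis dL : @in_dual R A (@Defs.restrict R A E S) L.

Let L_dom f : S f -> adomA (L f). Proof. by case: dL => -[h _] _; exact: h. Qed.

Let L_eqv f g : S f -> S g -> @meqv R A E f g -> aeqv (L f) (L g).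
Proof. by case: dL => -[_ [h _]] _; exact: h. Qed.

Let LD f g : S f -> S g -> ae_itv (fun x => L (f + g) x = L f x + L g x).
Proof. by case: dL => -[_ [_ [h _]]] _; exact: h. Qed.

Let LZ (c : C) f : S f -> ae_itv (fun x => L (c *: f) x = c * L f x).
Proof. by case: dL => -[_ [_ [_ [h _]]]] _; exact: h. Qed.

Let LA h f : adomA h -> S f -> ae_itv (fun x => L (actE h f) x = h x * L f x).
Proof. by case: dL => -[_ [_ [_ [_ hL]]]] _; exact: hL. Qed.

Let L_bounded : exists2 M : R, 0 <= M & forall f, S f -> anormA (L f) <= M * normE f.
Proof.
case: dL => _ [M LM]; exists `|M| => // f Sf; apply: le_trans (LM f Sf) _.
by apply: ler_wpM2r; [exact: normE_ge0|exact: ler_norm].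
Qed.

Let coef n := L (assemble (truncate [:: n] (fun _ _ => 1))).

Let S_truncate s b : (forall n, adomA (b n)) -> S (assemble (truncate s b)).
Proof. by move=> db; apply: XS; exact: Xa_truncate. Qed.

Let adom1 : adomA (fun=> 1). Proof. exact: (adom_cst a_gt0). Qed.

Let adom_coef n : adomA (coef n).
Proof. by apply: L_dom; apply: S_truncate. Qed.

(** Adjoining an index [n] adds the unit piece at [n] multiplied by [b n], and [L] is linear over
    [Linf a]; distinct indices prevent a coordinate from being counted twice. *)
Lemma dual_truncate s b : uniq s -> (forall n, adomA (b n)) ->
  ae_itv (fun x => L (assemble (truncate s b)) x = \sum_(n <- s) b n x * coef n x).
Proof.
move=> + db; elim: s => [_|n s IH /= /andP[ns us]].
  have S0 : S 0 by case: clS.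
  have e0 : aeqv (L (assemble (truncate [::] b))) (L 0).
    apply: L_eqv => //.
    apply/(meqvE a_gt0); apply: ae_itvS (ae_fib_assemble (truncate [::] b)) => x _ ->.
    by apply/funext.
  (* [L 0] vanishes by homogeneity, with scalar 0. *)
  move: e0 (LZ 0 S0); rewrite scale0r; apply: ae_itvS2 => x _ ->.
  by rewrite big_nil mul0r.
pose e := assemble (truncate [:: n] (fun _ _ => 1)).
have Se : S e by exact: S_truncate.
have Ss : S (assemble (truncate s b)) by exact: S_truncate.
have Sns : S (assemble (truncate (n :: s) b)) by exact: S_truncate.
have Sbe : S (actE (b n) e) by case: clS => _ _ _; apply.
have Sbes : S (actE (b n) e + (assemble (truncate s b) :
  mcar E)) by case: clS => _ + _ _; apply.
have E1 : aeqv (L (assemble (truncate (n :: s) b))) (L (actE (b n) e +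
  (assemble (truncate s b) : mcar E))).
  apply: L_eqv => //; apply/(meqvE a_gt0).
  apply: (@ae_itvS R a (fun=> True)) => [x x0a _|]; last exact: ae_itvW.
  rewrite fibD fib_act// !fib_assemble//; apply/funext => m.
  rewrite /truncate !inE; have [->|mn] := eqVneq m n.
    by rewrite (negbTE ns) addr0 mulr1.
  by rewrite mulr0 add0r.
have E2 := ae_itvI (LD Sbe Ss) (LA (db n) Se).
move: E1 E2 (IH us); apply: ae_itvS3 => x _ -> [-> ->] ->.
by rewrite big_cons.
Qed.

(* Multiplying [f] by the indicator function of [{<f, f> <= q^2}] localizes
   the norm bound on [L]. *)
Lemma dual_local M f (q : R) :
  (forall f, S f -> anormA (L f) <= M * normE f) -> 0 <= M -> S f -> 0 <= q ->
  ae_itv (fun x => (l2 (fib f x) <= (q ^+ 2)%:E)%E -> cmod (L f x) <= M * q).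
Proof.
move=> LM M0 Sf q0; have df := SE Sf.
have mf : cmeasurable setT f by have /(La_domP a_gt0)[] := df.
pose h x : C := (if (l2 (fib f x) <= (q ^+ 2)%:E)%E then 1 else 0)%:C.
have dh : adomA h.
  apply/(adomP a_gt0); split.
    apply: cmeasurable_real; apply: measurable_funTS.
    apply: measurable_fun_ifT => //.
    apply: measurable_fun_lee; last exact: measurable_cst.
    by apply: measurable_l2 => n; exact: cmeasurable_fib.
  exists 1; apply: ae_itvW => x; rewrite /h cmod_realE.
  by case: ifP; rewrite ?normr1 ?normr0.
have Shf : S (actE h f) by case: clS => _ _ _; apply.
have nhf : normE (actE h f) <= q.
  apply: (normE_le a_gt0) => //.
  apply: (@ae_itvS R a (fun=> True)) => [x x0a _|]; last exact: ae_itvW.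
  rewrite fib_act// l2Z /h cmod_realE; case: ifP => [fq|_].
    by rewrite normr1 expr1n mul1e.
  by rewrite normr0 expr0n mul0e lee_fin sqr_ge0.
move: (LA dh Sf) (anorm_ub a_gt0 (L_dom Shf)); apply: ae_itvS2 => x _ -> hub fq.
have : cmod (h x * L f x) <= M * q.
  by apply: le_trans hub _; apply: le_trans (LM _ Shf) _; exact: ler_wpM2l.
by rewrite /h fq mul1r.
Qed.

(** The partial square sums of [g] get a uniform bound, but its tails no uniform smallness: [g] is
    found in [La a] even if [L] is only given on [Xa a]. *)
Lemma dual_representation : exists2 g, domE g & forall y, S y -> aeqv (L y) (ipE y g).
Proof.
have [M M0 LM] := L_bounded.
pose cc n x := (coef n x)^*; have dcc n : adomA (cc n) by exact: adomJ.
pose g := assemble cc.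
have dg : domE g.
  apply/(La_domP a_gt0); split.
    by apply: cmeasurable_assemble => n; have /(adomP a_gt0)[] := dcc n.
  exists (M ^+ 2).
  suff : ae_itv (fun x => forall N, \sum_(n <- box N) cmod (cc n x) ^+ 2 <= M ^+ 2).
    move: (ae_fib_assemble cc); apply: ae_itvS2 => x _ -> bM.
    exact: l2_box_le.
  apply: ae_itv_nat => N; pose y := assemble (truncate (box N) cc).
  have Xy : @Xa R a y by exact: Xa_truncate.
  have Sy := XS Xy; have dy := SE Sy.
  (* On this truncation [L y] is the square sum of the coefficients, that is [<y, y>], so the bound
     on [L] reads [|y|^2 <= M |y|]. *)
  have ny : normE y <= M.
    apply: normE_le_self => //.
    move: (ae_fib_assemble (truncate (box N) cc))
      (dual_truncate (fset_uniq (box N)) dcc) (anorm_ub a_gt0 (L_dom Sy)).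
    apply: ae_itvS3 => x _ -> -> Lub.
    rewrite l2_truncate ?fset_uniq// lee_fin; apply: le_trans (LM _ Sy).
    apply: le_trans Lub; rewrite (eq_bigr (fun n => (cmod (cc n x) ^+ 2)%:C)).
      by rewrite -(rmorph_sum (real_complex R)) cmod_realE ler_norm.
    by move=> n _; rewrite -mulcJ /cc conjCK.
  move: (ae_fib_assemble (truncate (box N) cc)) (normE_ub a_gt0 dy).
  apply: ae_itvS2 => x _ ->; rewrite l2_truncate ?fset_uniq// lee_fin =>
    /le_trans; apply.
  by rewrite ler_pXn2r// nnegrE ?normE_ge0.
exists g => // y Sy; have dy := SE Sy.
pose b n x := fib y x n; have db n : adomA (b n) by exact: adom_fib.
pose t (N : nat) : mcar E := assemble (truncate (box N) b).
pose d N : mcar E := (y : mcar E) - t N.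
have St N : S (t N) by exact: S_truncate.
have Sd N : S (d N).
  by rewrite /d -scaleN1r; case: clS => _ cD cZ _; apply: cD => //; exact: cZ.
have fd : ae_itv (fun x => forall N, fib (d N) x = outside 0 (box N) (fib y x)).
  apply: (@ae_itvS R a (fun=> True)) => [x x0a _ N|]; last exact: ae_itvW.
  rewrite fibB fib_assemble//; apply/funext => n; rewrite /truncate /outside /b.
  by case: ifP; rewrite ?subrr ?subr0.
have Ly : ae_itv (fun x => forall N, L y x = L (d N) x + \sum_(n <- box N) b n
  x * coef n x).
  apply: ae_itv_nat => N.
  have := LD (Sd N) (St N); rewrite subrK.
  move: (dual_truncate (fset_uniq (box N)) db).
  by apply: ae_itvS2 => x _ <- ->.
(* Countably many radii stand in for a radius that will depend on the point. *)
have Ld : ae_itv (fun x => forall N k : nat,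
    (l2 (fib (d N) x) <= ((k.+1%:R^-1) ^+ 2)%:E)%E ->
      cmod (L (d N) x) <= M * k.+1%:R^-1).
  apply: ae_itv_nat => N; apply: ae_itv_nat => k.
  by apply: dual_local => //; rewrite invr_ge0.
move: (ae_itvI fd (ae_itvI Ly Ld)) (ae_fib_assemble cc) (dom_lty2 a_gt0 dy dg).
apply: ae_itvS3 => x _ [fdx [Lyx Ldx]] gx [yoo goo].
apply: cmod_eq => e e0.
have e20 : 0 < e / 2 by rewrite divr_gt0.
(* The radius is fixed from [M] and [e] before the box, which is then taken large enough to bring
   the tail of [y] below it. *)
have [k ke] : exists k : nat, M * k.+1%:R^-1 <= e / 2.
  exists (Num.truncn (M / (e / 2))); rewrite ler_pdivrMr// mulrC -ler_pdivrMr//.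
  exact/ltW/truncnS_gt.
have k0 : 0 < (k.+1%:R^-1 : R) ^+ 2 by rewrite exprn_gt0 ?invr_gt0.
have [F Fe] := l2_tail yoo k0.
have [G Ge] := csum_approx (ip_csummable yoo goo) e20.
have [N1 FN] := sub_box_ex F; have [N2 GN] := sub_box_ex G.
pose N := maxn N1 N2.
have LdN : cmod (L (d N) x) <= e / 2.
  apply: le_trans ke; apply: Ldx; rewrite fdx.
  by apply: le_trans Fe; apply: l2_outside_le; apply: FN; exact: leq_maxl.
have := Ge _ (GN N (leq_maxr _ _)).
rewrite (eq_bigr (fun n => b n x * coef n x)) => [|n _]; last first.
  by rewrite /g gx /cc conjCK.
rewrite -/(ip (fib y x) (fib g x)) -ipE_fib (Lyx N) => GeN.
rewrite -addrA [leRHS]splitr; apply: le_trans (cmodD _ _) _.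
by rewrite lerD// cmodBC.
Qed.

End Representation.

Lemma La_self_dual : self_dual E.
Proof.
by move=> L dL; exact: (@dual_representation domE (fun _ =>
  id) (La_closed a_gt0) dom_Xa L dL).
Qed.

Lemma ipE_cauchy_schwarz f g : domE f -> domE g ->
  anormA (ipE f g) <= normE g * normE f.
Proof.
move=> df dg; apply: (anorm_le a_gt0); rewrite mulrC.
move: (normE_ub a_gt0 df) (normE_ub a_gt0 dg); apply: ae_itvS2 => x _ fx gx.
by apply: cmod_ip_le; [exact: normE_ge0|exact: normE_ge0|exact: fx|exact: gx].
Qed.

Lemma in_dual_ipE g : domE g -> @in_dual R A (XaM a) (fun f => ipE f g).
Proof.
move=> dg; have cE := La_compat a_gt0.
split; last by exists (normE g) => f /dom_Xa df; exact: ipE_cauchy_schwarz.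
split; first by move=> f /dom_Xa df; exact: adom_ipE.
split.
  move=> f f' /dom_Xa df /dom_Xa df' ff'; case: cE => _ _ _; apply => //.
  by apply/(meqvE a_gt0); exact: ae_itvW.
split; first by move=> f f' /dom_Xa df /dom_Xa df'; exact: ipEDl.
split; first by move=> c f /dom_Xa df; exact: ipEZl.
by move=> h f _ /dom_Xa df; exact: ipEAl.
Qed.

(** Cauchy-Schwarz gives one inequality. As [g] may lie outside [Xa a], the other is tested on its
    truncations [t]: pairing [t], normalised, with [g] gives the square sum of the fibre of [t]
    divided by [|t|], hence [|t| <= sup V] by [normE_le_self]. *)
Lemma dual_norm_ipE g : domE g -> @dual_norm R A (XaM a) (fun f => ipE f g) = normE g.
Proof.
move=> dg; rewrite /dual_norm; set V := [set _ | _ in _].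
have ubV : ubound V (normE g).
  move=> _ [f [/dom_Xa df f1] <-]; apply: le_trans (ipE_cauchy_schwarz df dg) _.
  by rewrite ler_piMr// normE_ge0.
(* The zero function shows that [V] is nonempty; together with [ubV] this makes [sup V] a genuine
   supremum. *)
have X0 : @Xa R a 0 by case: (Xa_closed_submodule a_gt0) => _ [].
have n0 : normE 0 = 0.
  apply/eqP; rewrite eq_le normE_ge0 andbT; apply: (normE_le a_gt0) => //.
  by apply: ae_itvW => x; rewrite (l2_finsupp (F := fset0)) ?big_seq_fset0 ?expr0n.
have V0 : V (anormA (ipE 0 g)).
  by exists 0 => //; split => //; rewrite [mnorm _]n0.
have supV : has_sup V by split; [exists (anormA (ipE 0 g))|exists (normE g)].
have D0 : 0 <= sup V by apply: le_trans (ub_le_sup supV.2 V0); exact: anorm_ge0.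
apply/eqP; rewrite eq_le; apply/andP; split; first by apply: ge_sup => //; case: supV.
apply: (normE_le a_gt0) => //.
pose b n x := fib g x n; have db n : adomA (b n) by exact: adom_fib.
suff : ae_itv (fun x => forall N, \sum_(n <- box N) cmod (b n x) ^+ 2 <= sup V ^+ 2).
  by apply: ae_itvS => x _; exact: l2_box_le.
apply: ae_itv_nat => N; pose t := assemble (truncate (box N) b).
have Xt : @Xa R a t by exact: Xa_truncate.
have dt := dom_Xa Xt.
have tV : normE t <= sup V.
  have [->//|r0] := eqVneq (normE t) 0.
  have r_gt0 : 0 < normE t by rewrite lt_neqAle eq_sym r0 normE_ge0.
  pose c : C := ((normE t)^-1)%:C.
  pose f : mcar E := c *: (t : mcar E).
  have Xf : @Xa R a f by case: (Xa_closed_submodule a_gt0) => _ [_ _ h _] _; exact: h.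
  have cr : cmod c ^+ 2 * normE t ^+ 2 = 1.
    by rewrite /c cmod_real ?invr_ge0 ?normE_ge0// -exprMn mulVf// expr1n.
  have f1 : normE f <= 1.
    apply: (normE_le a_gt0) => //; apply: ae_itvS (normE_ub a_gt0 dt) => x _ tx.
    rewrite fibZ l2Z expr1n -cr [leRHS](EFinM (cmod c ^+ 2)) lee_wpmul2l//.
    by rewrite lee_fin sqr_ge0.
  have fV : anormA (ipE f g) <= sup V.
    by apply: (ub_le_sup supV.2); exists f.
  apply: normE_le_self => //.
  move: (ae_fib_assemble (truncate (box N) b)) (dom_lty2 a_gt0 dt dg)
    (anorm_ub a_gt0 (adom_ipE a_gt0 (dom_Xa Xf) dg)).
  apply: ae_itvS3 => x _ tx [too goo] /le_trans-/(_ _ fV).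
  rewrite ipE_fib /f fibZ ipZl// Normc.normcM.
  have -> : cmod (ip (fib t x) (fib g x)) = \sum_(n <- box N) cmod (b n x) ^+ 2.
    rewrite tx /ip (csum_finsupp (F := box N)); last first.
      by move=> n nN; rewrite /truncate (negbTE nN) mul0r.
    rewrite big_seq (eq_bigr (fun n => (cmod (b n x) ^+ 2)%:C)); last first.
      by move=> n nN; rewrite /truncate nN -mulcJ.
    rewrite -big_seq -(rmorph_sum (real_complex R)) cmod_real// sumr_ge0// => n _.
    exact: sqr_ge0.
  rewrite tx l2_truncate ?fset_uniq// lee_fin /c cmod_real ?invr_ge0 ?normE_ge0//.
  by rewrite mulrC ler_pdivrMr.
move: (ae_fib_assemble (truncate (box N) b)) (normE_ub a_gt0 dt).
apply: ae_itvS2 => x _ ->; rewrite l2_truncate ?fset_uniq// lee_fin => /le_trans; apply.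
by rewrite ler_pXn2r// nnegrE normE_ge0.
Qed.

Lemma dual_antilinear_iso :
  @antilinear_iso_dual R A E (XaM a) (fun g f => ipE f g).
Proof.
split; first exact: in_dual_ipE.
split.
  move=> g k dg dk f /dom_Xa df; move: (dom_lty2 a_gt0 dg dk) (dom_lty a_gt0 df).
  by apply: ae_itvS2 => x _ [goo koo] foo; exact: ipDr.
split.
  move=> c g dg f /dom_Xa df; apply: ae_itvS (dom_lty2 a_gt0 df dg) => x _ [foo goo].
  exact: ipZr.
split.
  move=> h g dh dg f /dom_Xa df; apply: ae_itvS (dom_lty2 a_gt0 df dg) =>
    x x0a [foo goo].
  by rewrite ipE_fib fib_act// ipZr// mulrC.
split.
  move=> g k dg dk; split=> [gk f /dom_Xa df|gk].
    case: (La_compat a_gt0) => _ _ _; apply => //.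
    by apply/(meqvE a_gt0); exact: ae_itvW.
  apply/(meqvE a_gt0).
  suff : ae_itv (fun x => forall n, fib g x n = fib k x n).
    by apply: ae_itvS => x _ gkx; apply/funext.
  apply: ae_itv_int => n.
  (* Pairing with the unit piece at [n] reads off the conjugate of the coordinate [n] of the
     fibre. *)
  pose b : int -> R -> C := fun _ _ => 1.
  have Xe : @Xa R a (assemble (truncate [:: n] b)).
    by apply: Xa_truncate => m; exact: (adom_cst a_gt0).
  move: (gk _ Xe) (ae_fib_assemble (truncate [:: n] b)).
  apply: ae_itvS2 => x _; rewrite !ipE_fib => + ex; rewrite ex.
  have coord (w : int -> C) : ip ((truncate [:: n] b)^~ x) w = (w n)^*.
    rewrite /ip (csum_finsupp (F := [fset n]%fset)) ?big_seq_fset1.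
      by rewrite /truncate mem_head mul1r.
    by move=> m; rewrite inE /truncate inE => /negbTE ->; rewrite mul0r.
  by rewrite !coord => /(congr1 Num.conj); rewrite !conjCK.
split; last exact: dual_norm_ipE.
move=> L dL; have [_ clX _] := Xa_closed_submodule a_gt0.
have [g dg Lg] := @dual_representation (@Xa R a) dom_Xa clX (fun _ => id) L dL.
by exists g => // f Xf; apply: aeqv_sym; exact: Lg.
Qed.

End Duality.

Theorem theorem5p6 (R : realType) (a : R) (a_gt0 : 0 < a) :
  (* the Hilbert module L_a^oo(l^2), its inner product and its norm *)
  hilbert_module (La a) /\
  (forall f g : mcar (La a), mdom f -> mdom g ->
     \forall x \ae (@lebesgue_measure R), csummable (La_terms a f g x)) /\
  (forall f : mcar (La a), mdom f -> ((mnorm f) ^+ 2)%:E = La_norm2 a f) /\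
  closed_submodule (@Xa R a) /\
  (* the sums defining the inner products of the sequence modules converge *)
  (forall u v : mcar (ell2s (Linf a)), mdom u -> mdom v ->
     strong_sum (gram u v) (mip u v)) /\
  (forall u v : mcar (ell2 (Linf a)), mdom u -> mdom v ->
     norm_sum (gram u v) (mip u v)) /\
  unitary (@Ua R a) /\
  adjoint (@Ua R a) (@Uadj R a) /\
  (forall b : mcar (ell2s (Linf a)), mdom b -> forall n : int,
     Uadj b = translate (n%:~R * a) (b n)
       %[ae (@lebesgue_measure R) in `[n%:~R * a, (n + 1)%:~R * a]%classic]) /\
  @unitary R (Linf a) (XaM a) (ell2 (Linf a)) (@Ua R a) /\
  self_dual (La a) /\
  @antilinear_iso_dual R (Linf a) (La a) (XaM a) (fun g f => @mip _ _ (La a) f g).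
Proof.
have [Uun Uad] := Ua_unitary_adjoint a_gt0.
split; first exact: La_hilbert.
split.
  move=> f g df dg; apply/(ae_fib a_gt0).
  apply: ae_itvS (dom_lty2 a_gt0 df dg) => x _ [foo goo] m.
  have := ip_csummable foo goo; rewrite !csummableE.
  (* The point at hand is [x - m a], whose fibre is that of [x] with indices shifted by [m]. *)
  rewrite -(esum_shift (fun n => (Normc.normc (fib a f x n * (fib a g x n)^*))%:E) m).
  apply: le_lt_trans; apply: le_esum => n _.
  have fibE (k : R -> R[i]) : fib a k x (m + n) = k (x - m%:~R * a - n%:~R * a).
    by rewrite /fib intrD mulrDl opprD addrA.
  by rewrite !fibE.
split; first exact: normE_La_norm2.
split; first exact: Xa_closed_submodule.
split; first exact: ell2s_ip.
split; first exact: ell2_ip.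
split; first exact: Uun.
split; first exact: Uad.
split.
  (* At the right endpoint the floor jumps to [n + 1], so this point is excluded. *)
  move=> b _ n; have nb : \forall x \ae (@lebesgue_measure R), x <> (n + 1)%:~R * a.
    exists [set (n + 1)%:~R * a]; split; [exact: measurable_set1|exact: lebesgue_measure_set1|].
    by move=> x /= /contrapT.
  apply: filterS nb => x xn; rewrite /= in_itv/= => /andP[nx xn1].
  rewrite /Uadj (_ : Num.floor (x / a) = n)//; apply: floor_def.
  rewrite ler_pdivlMr// ltr_pdivrMr// nx/= lt_neqAle xn1 andbT.
  exact/eqP.
split; first exact: Ua_Xa_unitary.
split; first exact: La_self_dual.
exact: dual_antilinear_iso.
Qed.
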